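(* Let $\sigma$ be a non-atomic Radon measure on $\mathbb{R}^d$, let $\pi_\sigma$ be the Poisson measure with intensity $\sigma$ on the configuration space $\Gamma$ over $\mathbb{R}^d$, and let $\varphi\in\mathcal{D}$. The closure in $L^2(\pi_\sigma)$ of the directional derivative $\nabla^{P}_\varphi:\mathcal{F}C_b^\infty(\mathcal{D},\Gamma)\to L^2(\pi_\sigma)$, $$(\nabla^{P}_\varphi f)(\gamma)=\int_{\mathbb{R}^d}\big(f(\gamma+\varepsilon_x)-f(\gamma)\big)\varphi(x)\,d\sigma(x),$$ coincides with the image under $I_\sigma$ of the annihilation operator $a^-(\varphi)$ in $\mathrm{Exp}L^2(\sigma)$, i.e. $I_\sigma a^-(\varphi)I_\sigma^{-1}=\nabla^{P}_\varphi$.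
   Context: $\mathcal{D}=C_0^\infty(\mathbb{R}^d)$ (real-valued). The configuration space is $\Gamma=\{\gamma\subset\mathbb{R}^d : |\gamma\cap K|<\infty \text{ for every compact } K\}$, each $\gamma$ being identified with $\sum_{x\in\gamma}\varepsilon_x$ ($\varepsilon_x$ the Dirac measure at $x$), with the $\sigma$-algebra generated by the maps $\gamma\mapsto|\gamma\cap B|$, $B$ bounded Borel; $\langle\gamma,f\rangle=\sum_{x\in\gamma}f(x)$. The Poisson measure $\pi_\sigma$ on $\Gamma$ is determined by $\int_\Gamma e^{\langle\gamma,\varphi\rangle}d\pi_\sigma(\gamma)=\exp\big(\int(e^{\varphi}-1)\,d\sigma\big)$, $\varphi\in\mathcal{D}$. $\mathcal{F}C_b^\infty(\mathcal{D},\Gamma)$ is the set of functions $f(\gamma)=F(\langle\gamma,\varphi_1\rangle,\dots,\langle\gamma,\varphi_N\rangle)$ with $\varphi_i\in\mathcal{D}$ and $F\in C_b^\infty(\mathbb{R}^N)$ ($C^\infty$-functions with bounded derivatives). Fock space: $\mathrm{Exp}L^2(\sigma)=\bigoplus_{n\ge0}\mathrm{Exp}_nL^2(\sigma)$, where $\mathrm{Exp}_nL^2(\sigma)=L^2(\sigma)_{\mathbb{C}}^{\widehat\otimes n}$ (symmetric tensor power of the complexification) and $\mathrm{Exp}_0L^2(\sigma)=\mathbb{C}$, with squared norm $\sum_n n!\,|f^{(n)}|^2_{L^2(\sigma^{\otimes n})}$. The generalized Charlier kernels $C_n^\sigma(\gamma)\in\mathcal{D}'^{\widehat\otimes n}$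 are defined by $\exp(\langle\gamma,\log(1+\psi)\rangle-\int\psi\,d\sigma)=\sum_n\frac1{n!}\langle C_n^\sigma(\gamma),\psi^{\otimes n}\rangle$ for $\psi\in\mathcal{D}$ near $0$; they satisfy $\int\langle C_n^\sigma,\varphi^{(n)}\rangle\langle C_m^\sigma,\psi^{(m)}\rangle d\pi_\sigma=\delta_{nm}n!(\varphi^{(n)},\psi^{(n)})_{L^2(\sigma^{\otimes n})}$ and hence $\langle C_n^\sigma(\cdot),f^{(n)}\rangle\in L^2(\pi_\sigma)$ is defined by extension for all $f^{(n)}\in\mathrm{Exp}_nL^2(\sigma)$. $I_\sigma:\mathrm{Exp}L^2(\sigma)\to L^2(\pi_\sigma)$ is the unitary isomorphism $(f^{(n)})_n\mapsto\sum_n\langle C_n^\sigma(\cdot),f^{(n)}\rangle$. Annihilation operator: for $f^{(n)}=\widehat\otimes_{i=1}^nf_i$ with $f_i\in L^2(\sigma)$, $a^-(\varphi)f^{(n)}=\sum_{j=1}^n\langle\varphi,f_j\rangle\,\widehat\otimes_{i\ne j}f_i\in\mathrm{Exp}_{n-1}L^2(\sigma)$ (with $\langle\varphi,f_j\rangle=\int\varphi f_j\,d\sigma$); this is extended by linearity and boundedness to each $\mathrm{Exp}_nL^2(\sigma)$ and component-wise to the dense subspace of sequences with finitely many nonzero entries. In the proposition $a^-(\varphi)$ denotes the resulting closed operator (the closure) in $\mathrm{Exp}L^2(\sigma)$, and in the last identity $\nabla^{P}_\varphi$ denotes the closure. *)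

(* Defs.v *)
From HB Require Import structures.
From mathcomp Require Import all_boot all_order all_algebra finmap perm.
From mathcomp Require Import all_classical all_reals all_analysis.
From mathcomp Require Import complex.
Set Implicit Arguments.
Unset Strict Implicit.
Unset Printing Implicit Defensive.
Import Order.TTheory GRing.Theory Num.Theory.
Import numFieldNormedType.Exports.
Local Open Scope classical_set_scope.
Local Open Scope ring_scope.

(* R^d with its Borel sigma-algebra; convertible to 'rV[R]_d. *)
Notation Rd R d := (g_sigma_algebraType (@open 'rV[R]_d)).

Section Smooth.
Context {R : realType} {m n : nat}.
Implicit Types f : 'M[R]_(m, n) -> R.

(* Iterated partial derivative; a multi-index is a list of coordinates. *)
Definition partial (s : seq ('I_m * 'I_n)) f : 'M[R]_(m, n) -> R :=
  foldr (fun ij (g : 'M[R]_(m, n) -> R) x => 'D_(delta_mx ij.1 ij.2) g x) f s.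

Definition smooth f := forall s,
  continuous (partial s f) /\
  forall i j x, derivable (partial s f) x (delta_mx i j).

Definition smooth_bounded f :=
  smooth f /\ forall s, exists M : R, forall x, `|partial s f x| <= M.

Definition test_function f :=
  smooth f /\ compact (closure [set x | f x != 0]).

End Smooth.

Record config (R : realType) (d : nat) := Config {
  points :> set 'rV[R]_d;
  config_locally_finite :
    forall K, compact K -> finite_set (points `&` K) }.

Section Configurations.
Context {R : realType} {d : nat}.
Implicit Types (gam : config R d) (x : 'rV[R]_d).

Lemma empty_locally_finite (K : set 'rV[R]_d) :
  compact K -> finite_set (set0 `&` K).
Proof. by move=> _; rewrite set0I; exact: finite_set0. Qed.

HB.instance Definition _ := gen_eqMixin (config R d).
HB.instance Definition _ := gen_choiceMixin (config R d).
HB.instance Definition _ :=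
  isPointed.Build (config R d) (Config empty_locally_finite).

Lemma add_point_locally_finite gam x (K : set 'rV[R]_d) :
  compact K -> finite_set ((gam `|` [set x]) `&` K).
Proof.
move=> cK; rewrite setIUl finite_setU; split; first exact: config_locally_finite.
exact/finite_setIl/finite_set1.
Qed.

(* [gam + eps_x]. When [x] is already a point of [gam] the sum is not a
   configuration and [gam] itself is returned; [gam] is countable, so this
   concerns only a null set of [x] for a non-atomic measure. *)
Definition add_point gam x : config R d :=
  Config (add_point_locally_finite gam x).

(* A finite sum when [f] has compact support. *)
Definition pairing gam (f : 'rV[R]_d -> R) : R := \sum_(x \in points gam) f x.

Definition counting_events : set (set (config R d)) :=
  [set A | exists (B : set (Rd R d)) (Y : set nat),
    [/\ bounded_set (B : set 'rV[R]_d), measurable B &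
        A = [set gam : config R d | Y #|` fset_set (points gam `&` B)|%fset ]]].

End Configurations.

Arguments counting_events : clear implicits.

Notation Gamma R d := (g_sigma_algebraType (counting_events R d)).

Section Measures.
Local Open Scope ereal_scope.
Context {R : realType}.

Definition radon {d : nat} (mu : set (Rd R d) -> \bar R) :=
  (forall K : set 'rV[R]_d, compact K -> mu K < +oo) /\
  (forall B : set (Rd R d), measurable B ->
    mu B = ereal_sup
      [set mu K | K in [set K : set 'rV[R]_d | compact K /\ K `<=` B]]).

Definition atom {disp} {T : measurableType disp} (mu : set T -> \bar R)
    (A : set T) :=
  [/\ measurable A, 0 < mu A &
      forall B, measurable B -> B `<=` A -> mu B = 0 \/ mu (A `\` B) = 0].

Definition non_atomic {disp} {T : measurableType disp}
    (mu : set T -> \bar R) := forall A, ~ atom mu A.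

Definition is_poisson {d : nat} (sigma : {measure set (Rd R d) -> \bar R})
    (P : set (Gamma R d) -> \bar R) :=
  forall phi : 'rV[R]_d -> R, test_function phi ->
    \int[P]_gam (expR (pairing gam phi))%:E =
    (expR (\int[sigma]_x (expR (phi x) - 1)%R)%R)%:E.

(* The n-fold product measure, for sigma-finite [mu]. *)
Fixpoint tensor_measure {disp} {T : measurableType disp}
    (mu : set T -> \bar R) (n : nat) : set (n.-tuple T) -> \bar R :=
  match n with
  | 0 => dirac [tuple]
  | k.+1 => pushforward (tensor_measure mu (n := k) \x mu)
              (fun p => [tuple of p.2 :: p.1])
  end.

End Measures.

(* Elements of the spaces are represented by functions, two representatives
   being identified when their distance vanishes. *)
Record l2space (R : realType) (V : Type) := L2Space {
  mem_l2 : V -> Prop;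
  sqdist : V -> V -> \bar R }.

Section Graphs.
Context {R : realType}.

Definition l2cvg {V} (X : l2space R V) (u : nat -> V) (v : V) :=
  (fun k => sqdist X (u k) v) @ \oo --> 0%E.

Definition graph_closure {V W} (X : l2space R V) (Y : l2space R W)
    (G : V -> W -> Prop) (v : V) (w : W) :=
  [/\ mem_l2 X v, mem_l2 Y w &
      exists (vs : nat -> V) (ws : nat -> W),
        [/\ forall k, G (vs k) (ws k), l2cvg X vs v & l2cvg Y ws w]].

Definition closable {V W} (X : l2space R V) (Y : l2space R W)
    (G : V -> W -> Prop) :=
  forall v w w', graph_closure X Y G v w -> graph_closure X Y G v w' ->
    sqdist Y w w' = 0%E.

Definition graph_span {A B : Type}
    (G : (A -> R[i]) -> (B -> R[i]) -> Prop) (v : A -> R[i]) (w : B -> R[i]) :=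
  exists (k : nat) (c : 'I_k -> R[i]) (vs : 'I_k -> A -> R[i])
    (ws : 'I_k -> B -> R[i]),
    [/\ forall j, G (vs j) (ws j),
        v = (fun x => \sum_(j < k) c j * vs j x) &
        w = (fun y => \sum_(j < k) c j * ws j y)].

Section ComplexL2.
Context {disp : measure_display} {T : measurableType disp}.
Variable mu : set T -> \bar R.

Definition sqnorm (f : T -> R[i]) : \bar R :=
  (\int[mu]_x (complex.Re (f x) ^+ 2 + complex.Im (f x) ^+ 2)%:E)%E.

Definition square_integrable (f : T -> R[i]) :=
  [/\ measurable_fun setT (fun x => complex.Re (f x)),
      measurable_fun setT (fun x => complex.Im (f x)) & (sqnorm f < +oo)%E].

Definition L2 : l2space R (T -> R[i]) :=
  {| mem_l2 := square_integrable;
     sqdist := fun f g => sqnorm (fun x => f x - g x) |}.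

End ComplexL2.

Definition cintegral {disp} {T : measurableType disp}
    (mu : {measure set T -> \bar R}) (f : T -> R[i]) : R[i] :=
  Complex (\int[mu]_x complex.Re (f x)) (\int[mu]_x complex.Im (f x)).

End Graphs.

Definition tuple_perm {T : Type} {n : nat} (s : 'S_n) (t : n.-tuple T) :
  n.-tuple T := [tuple tnth t (s i) | i < n].

Section Tensors.
Context {R : realType} {T : Type}.

Definition tensor_power (n : nat) (psi : T -> R) (t : n.-tuple T) : R :=
  \prod_(i < n) psi (tnth t i).

Definition sym_tensor (n : nat) (f : 'I_n -> T -> R) (t : n.-tuple T) : R :=
  (n`!%:R)^-1 * \sum_(s : 'S_n) \prod_(i < n) f i (tnth t (s i)).

End Tensors.

Section Fock.
Context {R : realType} {d : nat}.
Variable sigma : {measure set (Rd R d) -> \bar R}.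
Local Notation E := (Rd R d).

Definition fock_seq := forall n, n.-tuple E -> R[i].

(* The n-th symmetric tensor power of the complexified L^2(sigma), realized
   as the space of symmetric functions in L^2(sigma^n). *)
Definition Exp_n (n : nat) : l2space R (n.-tuple E -> R[i]) :=
  {| mem_l2 := fun f => square_integrable (tensor_measure sigma (n := n)) f /\
       forall s : 'S_n, {ae tensor_measure sigma (n := n),
         forall t, f (tuple_perm s t) = f t};
     sqdist := sqdist (L2 (tensor_measure sigma (n := n))) |}.

Definition fock_sqdist (f g : fock_seq) : \bar R :=
  (\sum_(0 <= n <oo) (n`!%:R)%:E * sqdist (Exp_n n) (f n) (g n))%E.

Definition fock : l2space R fock_seq :=
  {| mem_l2 := fun f => (forall n, mem_l2 (Exp_n n) (f n)) /\
       (fock_sqdist f (fun _ _ => 0%R) < +oo)%E;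
     sqdist := fock_sqdist |}.

Variable phi : 'rV[R]_d -> R.

Definition annihilation_tensor (n : nat)
    (h : n.+1.-tuple E -> R[i]) (k : n.-tuple E -> R[i]) :=
  exists f : 'I_n.+1 -> E -> R,
    [/\ forall i, square_integrable sigma (fun x => (f i x)%:C%C),
        h = (fun t => (sym_tensor f t)%:C%C) &
        k = (fun t => (\sum_(j < n.+1) (\int[sigma]_x (phi x * f j x)) *
                         sym_tensor (fun i => f (lift j i)) t)%:C%C)].

(* Linear and bounded extension: closure of the span in L^2 x L^2. *)
Definition annihilation_n (n : nat) :=
  graph_closure (Exp_n n.+1) (Exp_n n) (graph_span (@annihilation_tensor n)).

Definition annihilation_finite (f g : fock_seq) :=
  [/\ mem_l2 fock f, mem_l2 fock g,
      exists N, forall n, (N <= n)%N -> forall t, f n t = 0 &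
      forall n, annihilation_n (f n.+1) (g n)].

Definition annihilation := graph_closure fock fock annihilation_finite.

End Fock.

Section Charlier.
Context {R : realType} {d : nat}.
Local Notation E := (Rd R d).

(* A function on (R^d)^n seen as a function of the matrix whose rows are its
   arguments, so that smoothness and compactness make sense. *)
Definition of_rows (n : nat) (h : n.-tuple E -> R) (M : 'M[R]_(n, d)) : R :=
  h [tuple (row i M : E) | i < n].

Definition symmetric_distribution (n : nat) (D : (n.-tuple E -> R) -> R) :=
  [/\ forall (a : R) f g, test_function (of_rows f) ->
        test_function (of_rows g) ->
        D (fun t => a * f t + g t) = a * D f + D g,
      forall K : set 'M[R]_(n, d), compact K ->
        exists (N : nat) (c : R), forall f, test_function (of_rows f) ->
          (forall x, ~ K x -> of_rows f x = 0) ->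
          forall M : R,
            (forall s x, (size s <= N)%N -> `|partial s (of_rows f) x| <= M) ->
            `|D f| <= c * M &
      forall f (s : 'S_n), test_function (of_rows f) ->
        D (fun t => f (tuple_perm s t)) = D f].

(* The expansion is only required for [t psi] with [t] close to 0 (depending on
   [psi]), which holds as soon as it does in a neighbourhood of 0; it already
   determines [C n gam psi^n] by comparing powers of [t]. *)
Definition charlier_kernels (sigma : {measure set E -> \bar R})
    (C : forall n, config R d -> (n.-tuple E -> R) -> R) :=
  (forall n gam, symmetric_distribution (C n gam)) /\
  forall gam (psi : 'rV[R]_d -> R), test_function psi ->
    \forall t \near (0 : R),
      series (fun n => (n`!%:R)^-1 *
        C n gam (tensor_power (fun x => t * psi x))) @ \oo -->
      expR (pairing gam (fun x => ln (1 + t * psi x)) -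
            \int[sigma]_x (t * psi x)).

Variables (sigma : {measure set E -> \bar R}) (P : set (Gamma R d) -> \bar R).
Variable C : forall n, config R d -> (n.-tuple E -> R) -> R.

(* By polarization the powers [psi^n] span the algebraic symmetric tensor
   power of the space of test functions, which is dense. *)
Definition charlier_power (n : nat)
    (h : n.-tuple E -> R[i]) (F : Gamma R d -> R[i]) :=
  exists psi : 'rV[R]_d -> R,
    [/\ test_function psi, h = (fun t => (tensor_power psi t)%:C%C) &
        F = (fun gam => (C gam (@tensor_power R E n psi))%:C%C)].

(* [charlier_integral f F] : F = <C_n, f> in L^2(P). *)
Definition charlier_integral (n : nat) :=
  graph_closure (Exp_n sigma n) (L2 P) (graph_span (@charlier_power n)).

(* The graph of [I_sigma]. *)
Definition chaos (f : fock_seq) (F : Gamma R d -> R[i]) :=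
  [/\ mem_l2 (fock sigma) f, mem_l2 (L2 P) F &
      exists Y : nat -> Gamma R d -> R[i],
        (forall n, charlier_integral (f n) (Y n)) /\
        l2cvg (L2 P) (fun N gam => \sum_(n < N) Y n gam) F].

End Charlier.

Section Derivative.
Context {R : realType} {d : nat}.

(* [F] is complex valued, since [L^2(P)] is the complex space. *)
Definition cylinder (f : Gamma R d -> R[i]) :=
  exists (N : nat) (phis : 'I_N -> 'rV[R]_d -> R) (F : 'rV[R]_N -> R[i]),
    [/\ forall i, test_function (phis i),
        smooth_bounded (fun y => complex.Re (F y)),
        smooth_bounded (fun y => complex.Im (F y)) &
        forall gam, f gam = F (\row_i pairing gam (phis i))].

Definition nablaP (sigma : {measure set (Rd R d) -> \bar R}) (phi : 'rV[R]_d -> R)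
    (f : Gamma R d -> R[i]) (gam : Gamma R d) : R[i] :=
  cintegral sigma (fun x => (f (add_point gam x) - f gam) * (phi x)%:C%C).

Definition nablaP_graph (sigma : {measure set (Rd R d) -> \bar R}) (phi : 'rV[R]_d -> R)
    (f g : Gamma R d -> R[i]) := cylinder f /\ g = nablaP sigma phi f.

End Derivative.

(* Main.v *)
Require Import Defs.
From HB Require Import structures.
From mathcomp Require Import all_boot all_order all_algebra finmap perm.
From mathcomp Require Import all_classical all_reals all_analysis.
From mathcomp Require Import complex measurable_realfun ring lra.
Import Order.TTheory GRing.Theory Num.Theory.
Import numFieldNormedType.Exports.
Local Open Scope classical_set_scope.
Local Open Scope ring_scope.
Set Implicit Arguments.
Unset Strict Implicit.
Unset Printing Implicit Defensive.

(** Write w_psi = exp (<., log (1 + psi)> - int psi dsigma). Both operators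
    multiply w_psi by (phi, psi), and both turn out to have as graph the closure
    V of the span of the pairs (w_psi, (phi, psi) w_psi) in L^2(P) x L^2(P).

    Derivative. A pairing exponential is a dominated limit of bounded cylinder
    functions on which nabla^P converges as well, so V lies in the closure of
    nabla^P. Conversely, consider the functions F of finitely many fixed
    pairings such that (F, nabla^P F) is in V. Difference quotients of exponentials
    give the powers of a linear form, which resum to the trigonometric
    exponentials; a multiplicative class argument then gives all bounded
    continuous F.

    Annihilation. Under I_sigma, w_psi corresponds to the sequence psi^n / n!,
    which a^-(phi) multiplies by (phi, psi); truncating this sequence shows that
    V lies in the image of a^-(phi). Conversely, the coefficient of t^n in
    w_(t psi) shows that (<C_n, psi^n>, n (phi, psi) <C_(n-1), psi^(n-1)>) is in
    V, and since a^-(phi) is bounded on each Exp_n and I_sigma is isometric, this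
    passes to the limit in every chaos; density of the test functions in
    L^2(sigma) is never used. The isometry comes from comparing coefficients in
    int w_(t psi) w_(s chi) dP = exp (t s (psi, chi)). Boundedness of a^-(phi)
    on each Exp_n together with the isometry also gives closability. *)

(** In general neither operator is bounded, and the exponentials are unbounded functions of the
    configuration, so passages to the limit need explicit square integrable majorants. One family
    serves throughout: [exp (c k)], with [k] the number of points in the support of a test function.
    Pairings are at most linear in [k], and the Charlier coefficients are bounded by products over
    these [k] points. Everything rests on the finiteness of the expectation of [exp (c k)].

    The step from exponentials to all cylinder functions works because nabla^P takes differences and
    not derivatives: pointwise convergence of [F] under a common exponential bound already forces
    convergence of nabla^P F. Discontinuous functions, such as indicators of half-spaces, may
    therefore occur on the way.

    Operators are relations between functions, and equality in L^2 is the vanishing of a distance.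
    Closures are thus closed sets of pairs, and single-valuedness is a separate statement, obtained
    from Lipschitz bounds. *)

Section ComplexParts.
Context {R : realType}.
Implicit Types a b : R[i].

Lemma ReD a b : complex.Re (a + b) = complex.Re a + complex.Re b.
Proof. by case: a; case: b. Qed.

Lemma ImD a b : complex.Im (a + b) = complex.Im a + complex.Im b.
Proof. by case: a; case: b. Qed.

Lemma ReN a : complex.Re (- a) = - complex.Re a.
Proof. by case: a. Qed.

Lemma ImN a : complex.Im (- a) = - complex.Im a.
Proof. by case: a. Qed.

Lemma ReM a b :
  complex.Re (a * b) = complex.Re a * complex.Re b - complex.Im a * complex.Im b.
Proof. by case: a; case: b. Qed.

Lemma ImM a b :
  complex.Im (a * b) = complex.Re a * complex.Im b + complex.Im a * complex.Re b.
Proof. by case: a; case: b. Qed.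

Lemma Re_sum I (r : seq I) (Q : pred I) (f : I -> R[i]) :
  complex.Re (\sum_(i <- r | Q i) f i) = \sum_(i <- r | Q i) complex.Re (f i).
Proof. by elim/big_rec2: _ => // i u v _ <-; rewrite ReD. Qed.

Lemma Im_sum I (r : seq I) (Q : pred I) (f : I -> R[i]) :
  complex.Im (\sum_(i <- r | Q i) f i) = \sum_(i <- r | Q i) complex.Im (f i).
Proof. by elim/big_rec2: _ => // i u v _ <-; rewrite ImD. Qed.

Lemma complex_ext a b :
  complex.Re a = complex.Re b -> complex.Im a = complex.Im b -> a = b.
Proof. by case: a => x y; case: b => x' y' /= -> ->. Qed.

Definition sqabs a : R := complex.Re a ^+ 2 + complex.Im a ^+ 2.

Lemma sqabs_ge0 a : 0 <= sqabs a.
Proof. by rewrite addr_ge0// sqr_ge0. Qed.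

Lemma sqabsM a b : sqabs (a * b) = sqabs a * sqabs b.
Proof. by rewrite /sqabs ReM ImM; ring. Qed.

Lemma sqabsB a b : sqabs (a - b) = sqabs (b - a).
Proof. by rewrite /sqabs !ReD !ImD !ReN !ImN; ring. Qed.

Lemma sqabs_real (x : R) : sqabs x%:C%C = x ^+ 2.
Proof. by rewrite /sqabs /= expr0n addr0. Qed.

Lemma le_sqabsD (e : R) a b : 0 < e ->
  sqabs (a + b) <= (1 + e) * sqabs a + (1 + e^-1) * sqabs b.
Proof.
move=> e0.
have sq (x y : R) : (x + y) ^+ 2 <= (1 + e) * x ^+ 2 + (1 + e^-1) * y ^+ 2.
  rewrite -subr_ge0.
  have -> : (1 + e) * x ^+ 2 + (1 + e^-1) * y ^+ 2 - (x + y) ^+ 2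
            = e^-1 * (e * x - y) ^+ 2 by field; lra.
  by rewrite mulr_ge0 ?sqr_ge0// invr_ge0 ltW.
rewrite /sqabs ReD ImD; have := sq (complex.Re a) (complex.Re b).
by have := sq (complex.Im a) (complex.Im b); lra.
Qed.

End ComplexParts.

(** * Pseudo-distances, closures of relations, extension of Lipschitz bounds *)

Section QuasiTriangle.
Context {R : realType}.
Local Open Scope ereal_scope.

(* The inequality |a + b|^2 <= (1 + e) |a|^2 + (1 + 1/e) |b|^2 stands for the
   triangle inequality, so that no square root is needed. *)
Record quadratic {V} (X : l2space R V) (D : V -> Prop) : Prop := Quadratic {
  sqdist_ge0 : forall u v, 0 <= sqdist X u v;
  sqdistxx : forall u, sqdist X u u = 0;
  sqdistC : forall u v, sqdist X u v = sqdist X v u;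
  sqdist_triangle : forall (e : R) u v w, (0 < e)%R -> D u -> D v -> D w ->
    sqdist X u w <= (1 + e)%:E * sqdist X u v + (1 + e^-1)%:E * sqdist X v w }.

Lemma sqdist_triangle2 V (X : l2space R V) D (q : quadratic X D) (c : R) u v w :
  D u -> D v -> D w -> sqdist X u v <= (c / 4)%:E -> sqdist X v w <= (c / 4)%:E ->
  sqdist X u w <= c%:E.
Proof.
move=> Du Dv Dw uv vw; have := sqdist_triangle q ltr01 Du Dv Dw.
move/le_trans; apply; rewrite invr1.
apply: le_trans (leeD (lee_wpmul2l _ uv) (lee_wpmul2l _ vw)) _; rewrite ?lee_fin//.
by lra.
Qed.

Lemma l2cvgP V (X : l2space R V) D (q : quadratic X D) (u : nat -> V) v :
  l2cvg X u v <->
  forall e : R, (0 < e)%R -> exists K, forall k, (K <= k)%N -> sqdist X (u k) v <= e%:E.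
Proof.
rewrite /l2cvg; split.
  move=> /fine_cvgP [] [K1 _ fin] /cvgrPdist_le cv e e0.
  have [K2 _ H] := cv e e0; exists (maxn K1 K2) => k; rewrite geq_max => /andP[k1 k2].
  rewrite -(fineK (fin _ k1)) lee_fin; apply: le_trans (H k k2).
  by rewrite sub0r normrN ler_norm.
move=> H; apply/fine_cvgP; split.
  have [K HK] := H 1%R ltr01; exists K => // k /= Kk.
  rewrite ge0_fin_numE ?(sqdist_ge0 q)//.
  exact: le_lt_trans (HK _ Kk) (ltry _).
apply/cvgrPdist_le => e e0; have [K HK] := H e e0; exists K => // k /= Kk.
rewrite sub0r normrN ger0_norm ?fine_ge0 ?(sqdist_ge0 q)//.
rewrite -lee_fin fineK ?HK//.
rewrite ge0_fin_numE ?(sqdist_ge0 q)//.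
exact: le_lt_trans (HK _ Kk) (ltry _).
Qed.

Lemma graph_closureP V W (X : l2space R V) (Y : l2space R W) D E
  (q : quadratic X D) (r : quadratic Y E) (G : V -> W -> Prop) v w :
  graph_closure X Y G v w <->
  [/\ mem_l2 X v, mem_l2 Y w & forall e : R, (0 < e)%R -> exists v' w',
     [/\ G v' w', sqdist X v' v <= e%:E & sqdist Y w' w <= e%:E]].
Proof.
split=> [[mv mw [vs [ws [Gvw cv cw]]]]|[mv mw H]]; split=> //.
  move=> e e0.
  have [K1 H1] := (l2cvgP q _ _).1 cv e e0.
  have [K2 H2] := (l2cvgP r _ _).1 cw e e0.
  exists (vs (maxn K1 K2)), (ws (maxn K1 K2)).
  by split => //; [apply: H1|apply: H2]; rewrite ?leq_maxl ?leq_maxr.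
have H' k : exists p : V * W,
    [/\ G p.1 p.2, sqdist X p.1 v <= (k.+1%:R^-1)%:E & sqdist Y p.2 w <= (k.+1%:R^-1)%:E].
  have [|v' [w' Hvw]] := H (k.+1%:R^-1)%R; first by rewrite invr_gt0.
  by exists (v', w').
have [p Hp] := choice H'.
exists (fst \o p), (snd \o p); split => [k||].
- by have [] := Hp k.
- apply/(l2cvgP q _ _) => e e0.
  have [K HK] : exists K : nat, (K.+1%:R^-1 <= e)%R.
    have [K _ /(_ _ (leqnn _))HK] := near_infty_natSinv_lt (PosNum e0).
    by exists K; exact: ltW.
  exists K => k Kk; have [_ + _] := Hp k; move=> /le_trans; apply.
  rewrite lee_fin; apply: le_trans HK.
  by rewrite lef_pV2 ?posrE// ler_nat ltnS.
- apply/(l2cvgP r _ _) => e e0.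
  have [K HK] : exists K : nat, (K.+1%:R^-1 <= e)%R.
    have [K _ /(_ _ (leqnn _))HK] := near_infty_natSinv_lt (PosNum e0).
    by exists K; exact: ltW.
  exists K => k Kk; have [_ _ +] := Hp k; move=> /le_trans; apply.
  rewrite lee_fin; apply: le_trans HK.
  by rewrite lef_pV2 ?posrE// ler_nat ltnS.
Qed.

(** A closure is closed. The domains [D] and [E] appear because the triangle inequality is available
    only on them, while an approximating pair is merely known to lie in [G]. *)
Lemma graph_closure_lim V W (X : l2space R V) (Y : l2space R W) D E
  (q : quadratic X D) (r : quadratic Y E) (G : V -> W -> Prop) v w :
  (forall v, mem_l2 X v -> D v) -> (forall w, mem_l2 Y w -> E w) ->
  (forall v w, G v w -> D v /\ E w) ->
  mem_l2 X v -> mem_l2 Y w ->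
  (forall e : R, (0 < e)%R -> exists v' w',
     [/\ graph_closure X Y G v' w', sqdist X v' v <= e%:E & sqdist Y w' w <= e%:E]) ->
  graph_closure X Y G v w.
Proof.
move=> mD mE GDE mv mw H; apply/(graph_closureP q r _ _ _); split=> // e e0.
have e40 : (0 < e / 4)%R by rewrite divr_gt0.
have [v1 [w1 [/(graph_closureP q r _ _ _) [mv1 mw1 H1] e1 e1']]] := H _ e40.
have [v2 [w2 [G2 e2 e2']]] := H1 _ e40; have [Dv2 Ew2] := GDE _ _ G2.
exists v2, w2; split => //.
  exact (sqdist_triangle2 q Dv2 (mD _ mv1) (mD _ mv) e2 e1).
exact (sqdist_triangle2 r Ew2 (mE _ mw1) (mE _ mw) e2' e1').
Qed.

(** The quasi-triangle inequality with parameter [1 / a] multiplies the main term by [1 + a] and the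
    error term by [1 + 1 / a]. An error of size [a ^+ 2] therefore disappears as [a] tends to 0, and
    the constant [C] survives unchanged; this is what lets an isometry pass to limits. *)
Lemma sqdist_le_lim V W (X : l2space R V) (Y : l2space R W) D E
  (q : quadratic X D) (r : quadratic Y E) (C : R) u u0 v v0 :
  (0 <= C)%R -> D u -> D u0 -> E v -> E v0 ->
  (forall e : R, (0 < e)%R -> exists u' v', [/\ D u', E v', sqdist X u u' <= e%:E,
     sqdist Y v' v <= e%:E & sqdist X u' u0 <= C%:E * sqdist Y v' v0]) ->
  sqdist X u u0 <= C%:E * sqdist Y v v0.
Proof.
move=> C0 Du Du0 Ev Ev0 H.
have [yv|] := eqVneq (sqdist Y v v0) +oo.
  (* In [\bar R] the product [0 * +oo] is 0, so for [C = 0] the left distance still has to be shown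
     to vanish. *)
  move: C0; rewrite le_eqVlt => /orP[/eqP C0|C0]; last first.
    by rewrite yv gt0_muley ?lte_fin// leey.
  rewrite -C0 mul0e; apply/lee_addgt0Pr => e e0; rewrite add0e.
  have e40 : (0 < e / 4)%R by rewrite divr_gt0.
  have [u' [v' [Du' Ev' uu' vv' le]]] := H _ e40.
  apply: (sqdist_triangle2 q Du Du' Du0 uu' _); apply: le_trans le _.
  by rewrite -C0 mul0e lee_fin ltW.
rewrite -ltey -ge0_fin_numE ?(sqdist_ge0 r)// => fv.
have [b Eb] : exists b, sqdist Y v v0 = b%:E by exists (fine (sqdist Y v v0)); rewrite fineK.
have b0 : (0 <= b)%R by rewrite -lee_fin -Eb (sqdist_ge0 r).
apply/lee_addgt0Pr => e e0; rewrite Eb -EFinM -EFinD.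
(* [M] collects the coefficients of [a] in the final estimate, once [a <= 1] and [a ^+ 2 <= a] are
   used; the choice of [a] then keeps the excess below [e]. *)
pose M := (3 * C * b + 4 * C + 2 + 1)%R.
have M0 : (0 < M)%R by rewrite /M; nra.
pose a := Num.min 1%R (e / M)%R.
have a0 : (0 < a)%R by rewrite lt_min ltr01 divr_gt0.
have a1 : (a <= 1)%R by rewrite ge_min lexx.
have aM : (a * M <= e)%R by rewrite -ler_pdivlMr// ge_min lexx orbT.
have aa0 : (0 < a ^+ 2)%R by rewrite exprn_gt0.
have [u' [v' [Du' Ev' uu' vv' le]]] := H _ aa0.
have ai0 : (0 < a^-1)%R by rewrite invr_gt0.
have t1 := sqdist_triangle r ai0 Ev' Ev Ev0; rewrite invrK Eb in t1.
have B1 : sqdist Y v' v0 <= ((1 + a^-1) * a ^+ 2 + (1 + a) * b)%:E.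
  apply: le_trans t1 _; rewrite [leRHS]EFinD (EFinM (1 + a^-1)) (EFinM (1 + a)) leeD2r//.
  by rewrite lee_wpmul2l// lee_fin addr_ge0// ltW.
have B2 : sqdist X u' u0 <= (C * ((1 + a^-1) * a ^+ 2 + (1 + a) * b))%:E.
  by apply: le_trans le _; rewrite EFinM lee_wpmul2l// lee_fin.
have t2 := sqdist_triangle q ai0 Du Du' Du0.
rewrite invrK in t2; apply: le_trans t2 _.
apply: le_trans (_ : ((1 + a^-1) * a ^+ 2 +
    (1 + a) * (C * ((1 + a^-1) * a ^+ 2 + (1 + a) * b)))%:E <= _).
  rewrite [leRHS]EFinD (EFinM (1 + a^-1)) (EFinM (1 + a)).
  by apply: leeD; apply: lee_wpmul2l => //; rewrite lee_fin addr_ge0// ltW.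
rewrite lee_fin.
have -> : ((1 + a^-1) * a ^+ 2 = a ^+ 2 + a)%R by field; lra.
have a2 : (a ^+ 2 <= a)%R by rewrite expr2; nra.
apply: le_trans (_ : C * b + a * M <= _)%R; last by lra.
rewrite /M.
have : (a ^+ 2 + a + (1 + a) * (C * (a ^+ 2 + a + (1 + a) * b)) =
   C * b + a + a^+2 + C * (a ^+ 2 + a) * (1 + a) + C * b * (2 * a + a ^+ 2))%R by ring.
move=> ->.
have h1 : ((a ^+ 2 + a) * (1 + a) <= 4 * a)%R by nra.
have h2 : (C * ((a ^+ 2 + a) * (1 + a)) <= C * (4 * a))%R by rewrite ler_wpM2l.
have h3 : (C * b * (2 * a + a ^+ 2) <= C * b * (3 * a))%R.
  by rewrite ler_wpM2l ?mulr_ge0//; lra.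
by lra.
Qed.

End QuasiTriangle.

Section Approximable.
Context {R : realType} {V W : Type}.
Variables (X : l2space R V) (Y : l2space R W) (D : V -> Prop) (E : W -> Prop).
Hypotheses (q : quadratic X D) (r : quadratic Y E).
Variables (G : V -> W -> Prop) (c : R).
Hypotheses (c0 : 0 <= c) (GDE : forall v w, G v w -> D v /\ E w).
Hypothesis G_le : forall v w v' w', G v w -> G v' w' ->
  (sqdist X v v' <= c%:E * sqdist Y w w')%E.

Definition approximable v w := forall e : R, 0 < e ->
  exists v' w', [/\ G v' w', (sqdist X v' v <= e%:E)%E & (sqdist Y w' w <= e%:E)%E].

(** The bound is extended one argument at a time: first to a limit point against an element of [G],
    then to two limit points. Applied with [c = 1] to a graph and to its transpose, it extends an
    isometry. *)
Lemma approximable_le v w v' w' : D v -> E w -> D v' -> E w' ->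
  approximable v w -> approximable v' w' -> (sqdist X v v' <= c%:E * sqdist Y w w')%E.
Proof.
move=> Dv Ew Dv' Ew' H H'.
have clo u x : G u x -> (sqdist X v u <= c%:E * sqdist Y w x)%E.
  move=> Gux; have [Du Ex] := GDE Gux.
  apply: (sqdist_le_lim q r c0 Dv Du Ew Ex) => e e0.
  have [v1 [w1 [G1 d1 d2]]] := H _ e0; have [D1 E1] := GDE G1.
  by exists v1, w1; split=> //; [rewrite (sqdistC q)|exact: G_le].
rewrite (sqdistC q) (sqdistC r).
apply: (sqdist_le_lim q r c0 Dv' Dv Ew' Ew) => e e0.
have [v1 [w1 [G1 d1 d2]]] := H' _ e0; have [D1 E1] := GDE G1.
exists v1, w1; split=> //; first by rewrite (sqdistC q).
by rewrite (sqdistC q) (sqdistC r); exact: clo.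
Qed.

End Approximable.

(** * Complex L^2 spaces *)

Section L2Theory.
Context {disp : measure_display} {T : measurableType disp} {R : realType}.
Variable mu : {measure set T -> \bar R}.
Implicit Types (f g h : T -> R[i]) (X : T -> R).

Definition cmeasurable f :=
  measurable_fun setT (fun x => complex.Re (f x)) /\
  measurable_fun setT (fun x => complex.Im (f x)).

Lemma cmeasurable_real X : measurable_fun setT X -> cmeasurable (fun x => (X x)%:C%C).
Proof. by move=> mX; split => //=; exact: measurable_cst. Qed.

Lemma cmeasurable_cst (c : R[i]) : cmeasurable (fun=> c).
Proof. by split; exact: measurable_cst. Qed.

Lemma cmeasurableD f g : cmeasurable f -> cmeasurable g ->
  cmeasurable (fun x => f x + g x).
Proof.
move=> [f1 f2] [g1 g2]; split.
  by under eq_fun do rewrite ReD; exact: measurable_funD.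
by under eq_fun do rewrite ImD; exact: measurable_funD.
Qed.

Lemma cmeasurableM f g : cmeasurable f -> cmeasurable g ->
  cmeasurable (fun x => f x * g x).
Proof.
move=> [f1 f2] [g1 g2]; split.
  by under eq_fun do rewrite ReM; apply: measurable_funB; exact: measurable_funM.
by under eq_fun do rewrite ImM; apply: measurable_funD; exact: measurable_funM.
Qed.

Lemma cmeasurableZ (c : R[i]) f : cmeasurable f -> cmeasurable (fun x => c * f x).
Proof. by move=> mf; apply: cmeasurableM => //; exact: cmeasurable_cst. Qed.

Lemma cmeasurableB f g : cmeasurable f -> cmeasurable g ->
  cmeasurable (fun x => f x - g x).
Proof.
move=> [f1 f2] [g1 g2]; split.
  by under eq_fun do rewrite ReD ReN; exact: measurable_funB.
by under eq_fun do rewrite ImD ImN; exact: measurable_funB.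
Qed.

Lemma cmeasurable_sum I (r : seq I) (f : I -> T -> R[i]) :
  (forall i, cmeasurable (f i)) -> cmeasurable (fun x => \sum_(i <- r) f i x).
Proof.
move=> mf; elim: r => [|i r IH].
  by under eq_fun do rewrite big_nil; exact: cmeasurable_cst.
by under eq_fun do rewrite big_cons; exact: cmeasurableD.
Qed.

Lemma measurable_sqabs f : cmeasurable f -> measurable_fun setT (fun x => sqabs (f x)).
Proof. by move=> [f1 f2]; apply: measurable_funD; exact: measurable_funX. Qed.

Lemma measurable_sqabsE f : cmeasurable f ->
  measurable_fun setT (fun x => (sqabs (f x))%:E).
Proof. by move/measurable_sqabs/measurable_EFinP. Qed.

Lemma sqnorm_ge0 f : (0 <= sqnorm mu f)%E.
Proof. by apply: integral_ge0 => x _; rewrite lee_fin sqabs_ge0. Qed.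

Lemma le_sqnorm f (g : T -> \bar R) : cmeasurable f -> measurable_fun setT g ->
  (forall x, (sqabs (f x))%:E <= g x)%E -> (sqnorm mu f <= \int[mu]_x g x)%E.
Proof.
move=> mf mg fg; apply: ge0_le_integral => //.
- by move=> x _; rewrite lee_fin sqabs_ge0.
- exact: measurable_sqabsE.
- by move=> x _; exact: fg.
Qed.

Lemma sqnormZ (c : R[i]) f : cmeasurable f ->
  sqnorm mu (fun x => c * f x) = ((sqabs c)%:E * sqnorm mu f)%E.
Proof.
move=> mf; rewrite /sqnorm -ge0_integralZl//.
- by apply: eq_integral => x _; rewrite -EFinM -[in RHS]sqabsM.
- exact: measurable_sqabsE.
- by move=> x _; rewrite lee_fin sqabs_ge0.
- by rewrite lee_fin sqabs_ge0.
Qed.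

Lemma L2_quadratic : quadratic (L2 mu) cmeasurable.
Proof.
split=> /=.
- by move=> u v; exact: sqnorm_ge0.
- move=> u; rewrite /sqnorm; under eq_integral do rewrite subrr /= expr0n addr0.
  exact: integral0.
- by move=> u v; apply: eq_integral => x _; rewrite -/(sqabs _) sqabsB.
- move=> e u v w e0 mu' mv mw; rewrite /sqnorm.
  have e1 : (0 <= 1 + e) by rewrite addr_ge0// ltW.
  have e2 : (0 <= 1 + e^-1) by rewrite addr_ge0// invr_ge0 ltW.
  have muv := measurable_sqabsE (cmeasurableB mu' mv).
  have mvw := measurable_sqabsE (cmeasurableB mv mw).
  rewrite -!ge0_integralZl//; last 2 first.
  - by move=> x _; rewrite lee_fin (sqabs_ge0 (_ - _)).
  - by move=> x _; rewrite lee_fin (sqabs_ge0 (_ - _)).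
  rewrite -ge0_integralD//; last 4 first.
  - by move=> x _; rewrite -EFinM lee_fin mulr_ge0// (sqabs_ge0 (_ - _)).
  - exact: emeasurable_funM.
  - by move=> x _; rewrite -EFinM lee_fin mulr_ge0// (sqabs_ge0 (_ - _)).
  - exact: emeasurable_funM.
  apply: le_sqnorm; first exact: cmeasurableB.
    by apply: emeasurable_funD; exact: emeasurable_funM.
  move=> x; rewrite -!EFinM -EFinD lee_fin -!/(sqabs (_ - _)).
  by rewrite -(subrKA (v x)); exact: le_sqabsD.
Qed.

Lemma square_integrableP f :
  square_integrable mu f <-> cmeasurable f /\ (sqnorm mu f < +oo)%E.
Proof. by split=> [[]|[[]]]. Qed.

Lemma square_integrable_measurable f : square_integrable mu f -> cmeasurable f.
Proof. by case. Qed.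

Lemma sqnormE f : sqnorm mu f = sqdist (L2 mu) f (fun=> 0).
Proof. by apply: eq_integral => x _; rewrite subr0. Qed.

Lemma square_integrable_near f g : cmeasurable f -> square_integrable mu g ->
  (sqdist (L2 mu) f g < +oo)%E -> square_integrable mu f.
Proof.
move=> mf /square_integrableP[mg gf] fg; apply/square_integrableP; split => //.
rewrite sqnormE; apply: le_lt_trans
  (sqdist_triangle L2_quadratic ltr01 mf mg (cmeasurable_cst 0)) _.
rewrite sqnormE in gf.
by apply: lte_add_pinfty; rewrite lte_mul_pinfty// lee_fin addr_ge0.
Qed.

Lemma square_integrableZ (c : R[i]) f : square_integrable mu f ->
  square_integrable mu (fun x => c * f x).
Proof.
move=> /square_integrableP[mf ff]; apply/square_integrableP; split.
  exact: cmeasurableZ.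
by rewrite sqnormZ// lte_mul_pinfty// lee_fin sqabs_ge0.
Qed.

Lemma square_integrable0 : square_integrable mu (fun=> 0).
Proof.
apply/square_integrableP; split; first exact: cmeasurable_cst.
by rewrite sqnormE (sqdistxx L2_quadratic).
Qed.

Lemma square_integrableD f g : square_integrable mu f -> square_integrable mu g ->
  square_integrable mu (fun x => f x + g x).
Proof.
move=> /[dup]/square_integrable_measurable mf sf /[dup]/square_integrable_measurable mg sg.
apply: (square_integrable_near _ sg); first exact: cmeasurableD.
have /square_integrableP[_] := sf; rewrite /sqdist/=.
by congr (_ < _)%E; apply: eq_integral => x _; rewrite addrK.
Qed.

Lemma square_integrable_sum I (r : seq I) (f : I -> T -> R[i]) :
  (forall i, square_integrable mu (f i)) ->
  square_integrable mu (fun x => \sum_(i <- r) f i x).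
Proof.
move=> mf; elim: r => [|i r IH].
  by under eq_fun do rewrite big_nil; exact: square_integrable0.
by under eq_fun do rewrite big_cons; exact: square_integrableD.
Qed.

Lemma square_integrable_le f (G : T -> R) : cmeasurable f ->
  mu.-integrable setT (EFin \o G) -> (forall x, sqabs (f x) <= G x) ->
  square_integrable mu f.
Proof.
move=> mf iG fG; apply/square_integrableP; split => //.
move: (iG) => /integrableP[mG]; apply: le_lt_trans; apply: le_sqnorm => //.
  exact: measurableT_comp.
by move=> x; rewrite lee_fin (le_trans (fG x))//= ler_norm.
Qed.

Lemma L2_dominated (u : nat -> T -> R[i]) f (G : T -> R) :
  (forall k, cmeasurable (u k)) ->
  (forall x, (fun k => complex.Re (u k x)) @ \oo --> complex.Re (f x)) ->
  (forall x, (fun k => complex.Im (u k x)) @ \oo --> complex.Im (f x)) ->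
  (forall k x, sqabs (u k x) <= G x) -> mu.-integrable setT (EFin \o G) ->
  square_integrable mu f /\ l2cvg (L2 mu) u f.
Proof.
move=> mu_ cR cI uG iG.
have mf : cmeasurable f.
  split; first by apply: (measurable_fun_cvg (fun k => (mu_ k).1)) => x _; exact: cR.
  by apply: (measurable_fun_cvg (fun k => (mu_ k).2)) => x _; exact: cI.
have fG x : sqabs (f x) <= G x.
  have c : (fun k => sqabs (u k x)) @ \oo --> sqabs (f x).
    by apply: cvgD; apply: (continuous_cvg _ (@exprn_continuous _ 2 _)).
  by rewrite -(cvg_lim _ c)//; apply: limr_le; [apply/cvg_ex; eexists; exact: c|exact: nearW].
split; first exact: square_integrable_le iG fG.
have := @dominated_cvg _ _ _ mu setT measurableT
  (fun k x => (sqabs (u k x - f x))%:E) (cst 0%E) (fun x => (4 * G x)%:E).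
rewrite integral0; apply.
- by move=> n; apply: measurable_sqabsE; exact: cmeasurableB.
- move=> x _; apply: cvg_EFin; first exact: nearW.
  have -> : 0 = 0 ^+ 2 + 0 ^+ 2 :> R by rewrite expr0n addr0.
  apply: cvgD; apply: (continuous_cvg _ (@exprn_continuous _ 2 _)).
    under eq_fun do rewrite ReD ReN.
    by rewrite -(subrr (complex.Re (f x))); apply: cvgB => //; exact: cvg_cst.
  under eq_fun do rewrite ImD ImN.
  by rewrite -(subrr (complex.Im (f x))); apply: cvgB => //; exact: cvg_cst.
- by [].
- by under eq_fun do rewrite EFinM; exact: integrableZl.
- move=> n x _; rewrite gee0_abs ?lee_fin ?sqabs_ge0//.
  have := le_sqabsD (u n x) (- f x) ltr01.
  rewrite invr1 (_ : sqabs (- f x) = sqabs (f x)); last by rewrite /sqabs ReN ImN !sqrrN.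
  by move/le_trans; apply; have := uG n x; have := fG x; lra.
Qed.

(* The limit depends only on the sequence of values at the point, hence
   inherits the symmetries common to all terms. *)
Definition limsup_value (s : nat -> R[i]) : R[i] :=
  Complex (fine (limn_esup (fun k => (complex.Re (s k))%:E)))
          (fine (limn_esup (fun k => (complex.Im (s k))%:E))).

(** The hypothesis bounds the [j]-th increment by [Num.sqrt M * 2^-1 ^+ j], so the telescoping
    series is dominated by a geometric one. *)
Lemma cvg_cauchy_fast (s : nat -> R) (M : R) :
  (forall j, (4 ^ j)%N%:R * (s j.+1 - s j) ^+ 2 <= M) -> cvgn s.
Proof.
move=> H; have M0 : 0 <= M by apply: le_trans (H 0%N); rewrite mulr_ge0 ?sqr_ge0.
have -> : s = (fun k => s 0%N + series (fun j => s j.+1 - s j) k).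
  by apply/funext => k; rewrite /series/= telescope_sumr// addrC subrK.
apply: is_cvgD; first exact: is_cvg_cst.
apply: normed_cvg; apply: (@series_le_cvg _ _ (geometric (Num.sqrt M) 2^-1)).
- by move=> n; exact: normr_ge0.
- by move=> n; rewrite /geometric/= mulr_ge0 ?sqrtr_ge0 ?exprn_ge0 ?invr_ge0.
- move=> n; rewrite /geometric/= -(ger0_norm (_ : 0 <= Num.sqrt M * 2^-1 ^+ n)); last first.
    by rewrite mulr_ge0 ?sqrtr_ge0 ?exprn_ge0 ?invr_ge0.
  rewrite -ler_sqr ?nnegrE// !real_normK ?num_real// exprMn sqr_sqrtr//.
  rewrite -exprM mulnC exprM exprVn -exprVn (_ : (2^-1 : R) ^+ 2 = 4^-1); last by field.
  by rewrite exprVn ler_pdivlMr ?exprn_gt0// mulrC -natrX.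
- by apply: is_cvg_geometric_series; rewrite ger0_norm ?invr_ge0// invf_lt1// ltr1n.
Qed.

Lemma integral_le_liminf (F : nat -> T -> R) X (c : R) :
  (forall k, measurable_fun setT (F k)) -> measurable_fun setT X ->
  (forall k x, 0 <= F k x) -> (forall x, 0 <= X x) ->
  {ae mu, forall x, (F ^~ x) @ \oo --> X x} ->
  (exists K, forall k, (K <= k)%N -> (\int[mu]_x (F k x)%:E <= c%:E)%E) ->
  (\int[mu]_x (X x)%:E <= c%:E)%E.
Proof.
move=> mF mX F0 X0 cF [K HK].
have mFE k : measurable_fun setT (fun x => (F k x)%:E) by exact/measurable_EFinP.
have := @fatou _ _ _ mu _ measurableT (fun k x => (F k x)%:E) mFE.
move=> /(_ (fun k x _ => F0 k x))/le_trans h.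
apply: (le_trans _ (h c%:E _)).
  apply: ae_ge0_le_integral => //.
  - by move=> x _; rewrite lee_fin.
  - exact/measurable_EFinP.
  - move=> x _; rewrite limn_einf_lim; apply: lime_ge; first exact: is_cvg_einfs.
    by apply: nearW => k; apply: le_ereal_inf_tmp => _ [l _ <-]; rewrite lee_fin.
  - under eq_fun do rewrite -[limn_einf _]oppeK -limn_esupN.
    apply: measurableT_comp; first exact: oppe_measurable.
    apply: measurable_fun_limn_esup => k; apply: measurableT_comp => //.
  - apply: filterS cF => x cFx _.
    have c' : (fun k => (F k x)%:E) @ \oo --> (X x)%:E.
      by apply: cvg_EFin => //; exact: nearW.
    by have [-> _] := cvg_limn_einf_sup c'.
rewrite limn_einf_lim; apply: lime_le; first exact: is_cvg_einfs.
apply: nearW => k; apply: (@le_trans _ _ (\int[mu]_x (F (maxn k K) x)%:E)%E).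
  by apply: ereal_inf_lbound; exists (maxn k K) => //=; rewrite leq_maxl.
by apply: HK; rewrite leq_maxr.
Qed.

(** Riesz-Fischer. The limit is given as an explicit [limsup_value] along a subsequence, so that a
    symmetry valid at every point for all terms is valid at every point for the limit. *)
Lemma L2_complete (u : nat -> T -> R[i]) :
  (forall k, square_integrable mu (u k)) ->
  (forall e : R, 0 < e -> exists K, forall k l, (K <= k)%N -> (K <= l)%N ->
     (sqdist (L2 mu) (u k) (u l) <= e%:E)%E) ->
  exists n : nat -> nat, let f x := limsup_value (fun j => u (n j) x) in
    square_integrable mu f /\ l2cvg (L2 mu) u f.
Proof.
move=> su cu; have mu_ k : cmeasurable (u k) by apply: square_integrable_measurable.
(* The rate [8 ^- j] beats the weights [4 ^ j] in [w] below and leaves [2 ^- j]; those weights are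
   the ones that [cvg_cauchy_fast] asks for. *)
have /choice[K HK] : forall j : nat, exists K, forall k l, (K <= k)%N -> (K <= l)%N ->
     (sqdist (L2 mu) (u k) (u l) <= ((8 ^+ j)^-1)%:E)%E.
  by move=> j; apply: cu; rewrite invr_gt0 exprn_gt0.
(* The sum makes [n j] exceed all thresholds [K i] with [i <= j]; the summand [j] makes it tend to
   infinity. *)
pose n j := (\sum_(i < j.+1) K i + j)%N; exists n => f.
have nK j k : (j <= k)%N -> (K j <= n k)%N.
  by move=> jk; rewrite /n (bigD1 (Ordinal (jk : (j < k.+1)%N)))//= -addnA leq_addr.
pose w j x := (4 ^ j)%N%:R * sqabs (u (n j.+1) x - u (n j) x).
have mw j : measurable_fun setT (fun x => (w j x)%:E).
  apply/measurable_EFinP; apply: measurable_funM; first exact: measurable_cst.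
  by apply: measurable_sqabs; exact: cmeasurableB.
have w0 j x : 0 <= w j x by rewrite mulr_ge0// sqabs_ge0.
have intw : (\int[mu]_x (\sum_(j <oo) (w j x)%:E) < +oo)%E.
  rewrite integral_nneseries//; last by move=> j x _; rewrite lee_fin.
  apply: (@le_lt_trans _ _ (\sum_(j <oo) (geometric 1 (2^-1 : R) j)%:E)%E).
    apply: lee_nneseries => [j _ _|j _]; first by apply: integral_ge0 => x _; rewrite lee_fin.
    rewrite (_ : (\int[mu]_x (w j x)%:E)%E =
      ((4 ^ j)%N%:R%:E * sqdist (L2 mu) (u (n j.+1)) (u (n j)))%E); last first.
      rewrite /= /sqnorm -ge0_integralZl//.
      - by apply: measurable_sqabsE; exact: cmeasurableB.
      - by move=> x _; rewrite lee_fin (sqabs_ge0 (_ - _)).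
    apply: le_trans (lee_wpmul2l _ (HK j _ _ (nK _ _ _) (nK _ _ _))) _ => //.
    rewrite -EFinM lee_fin /geometric/= mul1r exprVn natrX.
    have -> : (8 : R) ^+ j = 4 ^+ j * 2 ^+ j by rewrite -exprMn -natrM.
    by rewrite invfM mulrA divff ?mul1r// expf_neq0.
  have cg : cvgn (series (geometric 1 (2^-1 : R))).
    by apply: is_cvg_geometric_series; rewrite ger0_norm ?invr_ge0// invf_lt1// ltr1n.
  rewrite (_ : (\sum_(j <oo) _)%E = (limn (series (geometric 1 (2^-1 : R))))%:E) ?ltry//.
  rewrite -EFin_lim//; congr (limn _); apply/funext => k /=.
  by rewrite /series/= -sumEFin.
have iw : mu.-integrable setT (fun x => \sum_(j <oo) (w j x)%:E)%E.
  apply/integrableP; split.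
    by apply: ge0_emeasurable_sum => // j x _ _; rewrite lee_fin.
  rewrite (_ : (\int[mu]_x _)%E = (\int[mu]_x (\sum_(j <oo) (w j x)%:E))%E)//.
  apply: eq_integral => x _; rewrite gee0_abs//; apply: nneseries_ge0 => j _ _.
  by rewrite lee_fin.
have conv : {ae mu, forall x, (fun j => complex.Re (u (n j) x)) @ \oo --> complex.Re (f x) /\
    (fun j => complex.Im (u (n j) x)) @ \oo --> complex.Im (f x)}.
  have := integrable_ae measurableT iw; apply: filterS => x /(_ I) fx.
  pose M := fine (\sum_(j <oo) (w j x)%:E)%E.
  have wM j : w j x <= M.
    rewrite -lee_fin /M fineK//.
    have h := @nneseries_lim_ge R (fun j => (w j x)%:E) xpredT 0 j.+1.
    apply: le_trans (h _) => [|i _ _]; last by rewrite lee_fin.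
    by rewrite big_nat_recr//= leeDr// sume_ge0// => i _; rewrite lee_fin.
  have cR : cvgn (fun j => complex.Re (u (n j) x)).
    apply: (@cvg_cauchy_fast _ M) => j; apply: le_trans (wM j).
    rewrite ler_wpM2l// -ReN -ReD lerDl sqr_ge0//.
  have cI : cvgn (fun j => complex.Im (u (n j) x)).
    apply: (@cvg_cauchy_fast _ M) => j; apply: le_trans (wM j).
    rewrite ler_wpM2l// -ImN -ImD lerDr sqr_ge0//.
  have lim_esup (s : nat -> R) : cvgn s -> s @ \oo --> fine (limn_esup (EFin \o s)).
    move=> cs; rewrite is_cvg_limn_esupE; last first.
      by apply/cvg_ex; exists (limn s)%:E; apply: cvg_EFin; [exact: nearW|].
    by rewrite EFin_lim.
  by split; exact: lim_esup.
have mf : cmeasurable f.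
  have mlim (s : nat -> T -> R) : (forall j, measurable_fun setT (s j)) ->
      measurable_fun setT (fun x => fine (limn_esup (fun j => (s j x)%:E))).
    move=> ms; apply: (measurableT_comp (@fine_measurable R setT measurableT)).
    by apply: measurable_fun_limn_esup => j; exact/measurable_EFinP.
  by split; apply: mlim => j; case: (mu_ (n j)).
(* Fatou's lemma in [j], for the distance from [u k] to [u (n j)], turns almost everywhere
   convergence of the subsequence into L^2 convergence of the whole sequence. *)
have cvf : l2cvg (L2 mu) u f.
  apply/(l2cvgP L2_quadratic) => e e0; have [k0 Hk0] := cu e e0.
  exists k0 => k kk.
  apply: (@integral_le_liminf (fun j x => sqabs (u k x - u (n j) x))).
  - by move=> j; apply: measurable_sqabs; exact: cmeasurableB.
  - by apply: (@measurable_sqabs (fun x => u k x - f x)); exact: cmeasurableB.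
  - by move=> j x; exact: sqabs_ge0.
  - by move=> x; exact: (sqabs_ge0 (_ - _)).
  - apply: filterS conv => x [cR cI].
    apply: cvgD; apply: (continuous_cvg _ (@exprn_continuous _ 2 _)).
      rewrite ReD ReN; under eq_fun do rewrite ReD ReN.
      by apply: cvgB => //; exact: cvg_cst.
    rewrite ImD ImN; under eq_fun do rewrite ImD ImN.
    by apply: cvgB => //; exact: cvg_cst.
  - by exists k0 => j k0j; apply: Hk0 => //; apply: leq_trans k0j _; rewrite leq_addl.
split => //.
have [k0 Hk0] := (l2cvgP L2_quadratic _ _).1 cvf 1 ltr01.
apply: (square_integrable_near mf (su k0)); rewrite (sqdistC L2_quadratic).
exact: le_lt_trans (Hk0 _ (leqnn _)) (ltry _).
Qed.

Lemma integrable_prod_square X Y : square_integrable mu (fun x => (X x)%:C%C) ->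
  square_integrable mu (fun x => (Y x)%:C%C) ->
  mu.-integrable setT (fun x => (X x * Y x)%:E).
Proof.
move=> [mX _ fX] [mY _ fY].
have i2 (Z : T -> R) : measurable_fun setT Z ->
    (sqnorm mu (fun x => (Z x)%:C%C) < +oo)%E ->
    mu.-integrable setT (fun x => (Z x ^+ 2)%:E).
  move=> mZ; rewrite /sqnorm/=; under eq_integral do rewrite expr0n addr0.
  move=> fZ; apply/integrableP; split.
    by apply/measurable_EFinP; exact: measurable_funX.
  by under eq_integral do rewrite gee0_abs ?lee_fin ?sqr_ge0//.
apply: (le_integrable measurableT _ _ (integrableD measurableT (i2 _ mX fX) (i2 _ mY fY))).
  by apply/measurable_EFinP; exact: measurable_funM.
move=> x _; rewrite -EFinD !abse_EFin lee_fin.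
rewrite [leRHS]ger0_norm ?addr_ge0 ?sqr_ge0// ler_norml.
by move: (X x) (Y x) => a b /=; apply/andP; split; nra.
Qed.

(** The scalar factor is the real part of [c j] times the conjugate of [c l]; the imaginary parts
    cancel by symmetry. Two families with the same real Gram matrix thus have isometric complex
    spans. *)
Lemma sqnorm_gram k (c : 'I_k -> R[i]) (X : 'I_k -> T -> R) :
  (forall j, square_integrable mu (fun x => (X j x)%:C%C)) ->
  sqnorm mu (fun x => \sum_(j < k) c j * (X j x)%:C%C) =
  (\sum_(j < k) \sum_(l < k)
    (complex.Re (c j) * complex.Re (c l) + complex.Im (c j) * complex.Im (c l)) *
    \int[mu]_x (X j x * X l x))%:E.
Proof.
move=> sX; rewrite /sqnorm.
transitivity (\int[mu]_x (\sum_(j < k) \sum_(l < k)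
    ((complex.Re (c j) * complex.Re (c l) + complex.Im (c j) * complex.Im (c l))%:E *
    (X j x * X l x)%:E)))%E.
  apply: eq_integral => x _; rewrite Re_sum Im_sum !expr2 !mulr_suml -big_split/=.
  rewrite -sumEFin; apply: eq_bigr => j _; rewrite !mulr_sumr -big_split/= -sumEFin.
  apply: eq_bigr => l _; rewrite -EFinM; congr EFin.
  by rewrite !ReM !ImM /=; ring.
have i1 j l : mu.-integrable setT (fun x => (complex.Re (c j) * complex.Re (c l)
    + complex.Im (c j) * complex.Im (c l))%:E * (X j x * X l x)%:E)%E.
  by apply: integrableZl => //; exact: integrable_prod_square.
rewrite integral_sum//; last by move=> j; apply: integrable_sum.
rewrite -sumEFin; apply: eq_bigr => j _; rewrite integral_sum// -sumEFin.
apply: eq_bigr => l _; rewrite integralZl//; last exact: integrable_prod_square.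
rewrite EFinM /Rintegral fineK//; apply: integrable_fin_num => //.
exact: integrable_prod_square.
Qed.

End L2Theory.

(** * Smooth functions and test functions *)

Section SmoothCalculus.
Context {R : realType} {m n : nat}.
Implicit Types (f g : 'M[R]_(m, n) -> R) (Q : ('M[R]_(m, n) -> R) -> Prop).

(** [Q] is continuity for [smooth], continuity and boundedness for [smooth_bounded], so that one set
    of closure rules serves both. The recursion differentiates [f] and continues with the
    derivative, which suits induction on the order, whereas [partial] adds its derivatives on the
    outside. *)
Fixpoint smoothn Q k f : Prop := Q f /\
  if k is k'.+1 then forall i j, (forall x, derivable f x (delta_mx i j)) /\
    smoothn Q k' (fun x => 'D_(delta_mx i j) f x) else True.

Lemma partial_rcons (s : seq ('I_m * 'I_n)) ij f :
  partial (rcons s ij) f = partial s (fun x => 'D_(delta_mx ij.1 ij.2) f x).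
Proof. by rewrite /partial foldr_rcons. Qed.

Lemma smoothnP Q f :
  (forall s, Q (partial s f) /\
     forall i j x, derivable (partial s f) x (delta_mx i j)) <->
  forall k, smoothn Q k f.
Proof.
split.
  move=> H k; elim: k f H => [|k IH] f H /=; first by split => //; exact: (H [::]).1.
  split; first exact: (H [::]).1.
  move=> i j; split=> [x|]; first exact: (H [::]).2.
  by apply: IH => s; rewrite -(partial_rcons s (i, j)).
move=> H s; elim/last_ind: s f H => [|s [i j] IH] f H.
  by split=> [|i j x]; [have /=[] := H 0%N|have /=[_ /(_ i j)[]] := H 1%N].
rewrite partial_rcons; apply: IH => k.
by have /=[_ /(_ i j)[]] := H k.+1.
Qed.

Lemma smoothP f : smooth f <-> forall k, smoothn (fun f => continuous f) k f.
Proof. exact: smoothnP. Qed.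

Lemma smoothn0 Q k f : smoothn Q k f -> Q f.
Proof. by case: k => [|k] []. Qed.

Lemma smoothnS Q k f : smoothn Q k.+1 f -> smoothn Q k f.
Proof.
elim: k f => [|k IH] f; first by case.
move=> [Qf H]; split => // i j; have [d /IH ?] := H i j; split => //.
Qed.

Lemma smoothn_step Q k f : Q f ->
  (forall i j, exists2 g, smoothn Q k g & forall x, is_derive x (delta_mx i j) f (g x)) ->
  smoothn Q k.+1 f.
Proof.
move=> Qf H; split=> // i j; have [g sg dg] := H i j.
split=> [x|]; first by case: (dg x).
suff -> : (fun x => 'D_(delta_mx i j) f x) = g by [].
by apply/funext => x; case: (dg x).
Qed.

Lemma is_derive_smoothn Q k f i j x : smoothn Q k.+1 f ->
  is_derive x (delta_mx i j) f ('D_(delta_mx i j) f x).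
Proof. by move=> [_ /(_ i j)[d _]]; exact/derivableP. Qed.

Section Algebra.
Variable Q : ('M[R]_(m, n) -> R) -> Prop.
Hypothesis Q_cst : forall c : R, Q (fun=> c).
Hypothesis QD : forall f g, Q f -> Q g -> Q (fun x => f x + g x).
Hypothesis QM : forall f g, Q f -> Q g -> Q (fun x => f x * g x).

Lemma smoothn_cst k (c : R) : smoothn Q k (fun=> c).
Proof.
elim: k c => [|k IH] c; first by split.
apply: smoothn_step => // i j; exists (fun=> 0) => // x.
exact: is_derive_cst.
Qed.

Lemma smoothnD k f g : smoothn Q k f -> smoothn Q k g -> smoothn Q k (fun x => f x + g x).
Proof.
elim: k f g => [|k IH] f g sf sg; first by split=> //; apply: QD; [case: sf|case: sg].
apply: smoothn_step; first by apply: QD; [case: sf|case: sg].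
move=> i j; exists (fun x => 'D_(delta_mx i j) f x + 'D_(delta_mx i j) g x).
  by apply: IH; [case: sf => _ /(_ i j)[]|case: sg => _ /(_ i j)[]].
by move=> x; apply: is_deriveD; apply: is_derive_smoothn; eassumption.
Qed.

Lemma smoothnM k f g : smoothn Q k f -> smoothn Q k g -> smoothn Q k (fun x => f x * g x).
Proof.
elim: k f g => [|k IH] f g sf sg; first by split=> //; apply: QM; [case: sf|case: sg].
apply: smoothn_step; first by apply: QM; [case: sf|case: sg].
move=> i j; exists (fun x => f x * 'D_(delta_mx i j) g x + g x * 'D_(delta_mx i j) f x).
  apply: smoothnD; apply: IH; try exact: smoothnS.
    by case: sg => _ /(_ i j)[].
  by case: sf => _ /(_ i j)[].
by move=> x; apply: is_deriveM; apply: is_derive_smoothn; eassumption.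
Qed.

Lemma smoothn_sum k I (r : seq I) (f : I -> 'M[R]_(m, n) -> R) :
  (forall i, smoothn Q k (f i)) -> smoothn Q k (fun x => \sum_(i <- r) f i x).
Proof.
move=> sf; elim: r => [|i r IH].
  by under eq_fun do rewrite big_nil; exact: smoothn_cst.
by under eq_fun do rewrite big_cons; exact: smoothnD.
Qed.

Lemma smoothn_prod k I (r : seq I) (f : I -> 'M[R]_(m, n) -> R) :
  (forall i, smoothn Q k (f i)) -> smoothn Q k (fun x => \prod_(i <- r) f i x).
Proof.
move=> sf; elim: r => [|i r IH].
  by under eq_fun do rewrite big_nil; exact: smoothn_cst.
by under eq_fun do rewrite big_cons; exact: smoothnM.
Qed.

End Algebra.

(** Reduction to the one-variable chain rule along the line [h *: v + x], on which directional
    derivatives become ordinary ones. *)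
Lemma is_derive_outer (u : R -> R) (du : R) f x v :
  is_derive (f x) 1 u du -> derivable f x v ->
  is_derive x v (fun y => u (f y)) (du * 'D_v f x).
Proof.
move=> dU df.
have Dl (g : 'M[R]_(m, n) -> R) : 'D_v g x = 'D_1 (fun h : R => g (h *: v + x)) 0.
  rewrite /derive [X in X @ _](_ : _ = fun h : R => h^-1 *:
    (((fun h => g (h *: v + x)) \o shift 0) (h *: 1) - g (0 *: v + x)))//.
  by apply/funext => h /=; rewrite /shift/= addr0 scale0r add0r [h%:A]mulr1.
have /derivable1P df1 := df.
have d1 : is_derive (0 : R) 1 (fun h : R => f (h *: v + x)) ('D_v f x).
  by rewrite Dl; exact/derivableP.
have fx : (fun h : R => f (h *: v + x)) 0 = f x by rewrite scale0r add0r.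
rewrite -fx in dU.
have [dc ec] := is_derive1_comp dU d1.
have dvb : derivable (fun y => u (f y)) x v by apply/derivable1P.
by apply: DeriveDef => //; rewrite Dl.
Qed.

Lemma smoothn_exp k f : smoothn (fun f => continuous f) k f ->
  smoothn (fun f => continuous f) k (fun x => expR (f x)).
Proof.
have ce g : continuous g -> continuous (fun x => expR (g x)).
  by move=> cg x; apply: continuous_comp; [exact: cg|exact: continuous_expR].
elim: k f => [|k IH] f sf; first by split=> //; apply: ce; case: sf.
apply: smoothn_step; first by apply: ce; case: sf.
move=> i j; exists (fun x => expR (f x) * 'D_(delta_mx i j) f x).
  apply: smoothnM => //.
  - by move=> f2 g2 cf cg x; exact: (cvgD (cf x) (cg x)).
  - by move=> f2 g2 cf cg x; exact: (cvgM (cf x) (cg x)).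
  - by apply: IH; exact: smoothnS.
  - by case: sf => _ /(_ i j)[].
by move=> x; apply: is_derive_outer; have [_ /(_ i j)[]] := sf.
Qed.

End SmoothCalculus.

Section Smooth.
Context {R : realType} {m n : nat}.
Implicit Types (f g : 'M[R]_(m, n) -> R).

Let ccst (c : R) : continuous (fun _ : 'M[R]_(m, n) => c).
Proof. by move=> x; exact: cst_continuous. Qed.

Let cD f g : continuous f -> continuous g -> continuous (fun x => f x + g x).
Proof. by move=> cf cg x; exact: (cvgD (cf x) (cg x)). Qed.

Let cM f g : continuous f -> continuous g -> continuous (fun x => f x * g x).
Proof. by move=> cf cg x; exact: (cvgM (cf x) (cg x)). Qed.

Lemma smooth_cst (c : R) : smooth (fun _ : 'M[R]_(m, n) => c).
Proof. by apply/smoothP => k; exact: smoothn_cst. Qed.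

Lemma smoothD f g : smooth f -> smooth g -> smooth (fun x => f x + g x).
Proof. by move=> /smoothP sf /smoothP sg; apply/smoothP => k; exact: smoothnD. Qed.

Lemma smoothM f g : smooth f -> smooth g -> smooth (fun x => f x * g x).
Proof. by move=> /smoothP sf /smoothP sg; apply/smoothP => k; exact: smoothnM. Qed.

Lemma smoothZ (c : R) f : smooth f -> smooth (fun x => c * f x).
Proof. by move=> sf; exact: (smoothM (smooth_cst c) sf). Qed.

Lemma smoothB f g : smooth f -> smooth g -> smooth (fun x => f x - g x).
Proof.
move=> sf sg; under eq_fun do rewrite -mulN1r.
exact: (smoothD sf (smoothZ (-1) sg)).
Qed.

Lemma smooth_prod I (r : seq I) (f : I -> 'M[R]_(m, n) -> R) :
  (forall i, smooth (f i)) -> smooth (fun x => \prod_(i <- r) f i x).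
Proof.
by move=> sf; apply/smoothP => k; apply: (smoothn_prod ccst cD cM) => i; exact: ((smoothP _).1 (sf i) k).
Qed.

Lemma smooth_exp f : smooth f -> smooth (fun x => expR (f x)).
Proof. by move=> /smoothP sf; apply/smoothP => k; exact: smoothn_exp. Qed.

Lemma smooth_continuous f : smooth f -> continuous f.
Proof. by move=> /(_ [::])[]. Qed.

Lemma smoothV f : smooth f -> (forall x, f x != 0) -> smooth (fun x => (f x)^-1).
Proof.
move=> /smoothP sf f0; apply/smoothP; elim=> [|k IH].
  by split=> // x; exact: (cvgV (f0 x) (smoothn0 (sf 0%N) x)).
apply: smoothn_step; first exact: smoothn0 IH.
move=> i j; exists (fun x => (-1) * (((f x)^-1 * (f x)^-1) * 'D_(delta_mx i j) f x)).
  apply: (smoothnM cD cM); first exact: smoothn_cst.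
  apply: (smoothnM cD cM); first exact: (smoothnM cD cM).
  by have [_ /(_ i j)[]] := sf k.+1.
move=> x; have [_ /(_ i j)[/(_ x) df _]] := sf 1%N.
apply: DeriveDef; first exact: derivableV.
by rewrite deriveV// mulN1r -invfM -expr2 scaleNr.
Qed.

Lemma smooth_ln f : smooth f -> (forall x, 0 < f x) -> smooth (fun x => ln (f x)).
Proof.
move=> sf f0; have /smoothP sV := smoothV sf (fun x => lt0r_neq0 (f0 x)).
move/smoothP in sf.
have cl : continuous (fun x => ln (f x)).
  by move=> x; apply: continuous_comp; [exact: (smoothn0 (sf 0%N))|exact: continuous_ln].
apply/smoothP; case=> [|k]; first by [].
apply: smoothn_step => // i j.
exists (fun x => (f x)^-1 * 'D_(delta_mx i j) f x).
  by apply: smoothnM => //; have [_ /(_ i j)[]] := sf k.+1.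
move=> x; apply: is_derive_outer; last by have [_ /(_ i j)[]] := sf 1%N.
exact: is_derive1_ln.
Qed.

(** As [L] maps each [delta_mx i j] to 0 or to another such matrix, a partial derivative of the
    composite is 0 or a partial derivative of [f] composed with [L], so the induction never leaves
    this form. *)
Lemma smooth_comp_linear p q (L : 'M[R]_(m, n) -> 'M[R]_(p, q)) (f : 'M[R]_(p, q) -> R) :
  continuous L -> (forall (h : R) v x, L (h *: v + x) = h *: L v + L x) ->
  (forall i j, L (delta_mx i j) = 0 \/ exists i' j', L (delta_mx i j) = delta_mx i' j') ->
  smooth f -> smooth (fun x => f (L x)).
Proof.
move=> cL linL dL /smoothP sf; apply/smoothP => k; move: {sf}(sf k).
have cfL (g : 'M[R]_(p, q) -> R) : continuous g -> continuous (fun x => g (L x)).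
  by move=> cg x; apply: continuous_comp; [exact: cL|exact: cg].
elim: k f => [|k IH] f sf; first by split=> //; apply: (cfL _ (smoothn0 sf)).
apply: smoothn_step; first by apply: (cfL _ (smoothn0 sf)).
move=> i j; have [L0|[i' [j' Ld]]] := dL i j.
  exists (fun=> 0); first exact: smoothn_cst.
  move=> x; have E h : f (L (h *: delta_mx i j + x)) = f (L x).
    by rewrite linL L0 scaler0 add0r.
  have E' : (fun h : R => h^-1 *: (((fun y => f (L y)) \o shift x) (h *: delta_mx i j) - f (L x)))
      = (fun=> 0) by apply/funext => h /=; rewrite E subrr scaler0.
  apply: DeriveDef; rewrite /derivable /derive E'; first exact: is_cvg_cst.
  by apply: cvg_lim; [exact: norm_hausdorff|exact: cvg_cst].
exists (fun x => 'D_(delta_mx i' j') f (L x)).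
  by apply: (IH (fun y => 'D_(delta_mx i' j') f y)); case: sf => _ /(_ i' j')[].
move=> x; have [_ /(_ i' j')[/(_ (L x)) df _]] := sf.
have E' : (fun h : R => h^-1 *: (((fun y => f (L y)) \o shift x) (h *: delta_mx i j) - f (L x)))
  = (fun h : R => h^-1 *: ((f \o shift (L x)) (h *: delta_mx i' j') - f (L x))).
  by apply/funext => h /=; rewrite /shift/= linL Ld.
by apply: DeriveDef; rewrite /derivable /derive E'.
Qed.

End Smooth.

Section TestFunctions.
Context {R : realType} {m n : nat}.
Implicit Types (f g : 'M[R]_(m, n) -> R).

Lemma test_continuous f : test_function f -> continuous f.
Proof. by case=> /smooth_continuous. Qed.

Lemma test_sub f g : test_function f -> smooth g -> (forall x, f x = 0 -> g x = 0) ->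
  test_function g.
Proof.
move=> [_ cf] sg fg; split=> //; apply: (subclosed_compact _ cf).
  exact: closed_closure.
apply: closure_subset => x /= /eqP gx; apply/eqP => fx; exact/gx/fg.
Qed.

Lemma test0 : test_function (fun _ : 'M[R]_(m, n) => 0 : R).
Proof.
split; first exact: smooth_cst.
rewrite (_ : [set _ | _] = set0) ?closure0; first exact: compact0.
by rewrite predeqE => x; split => //=; rewrite eqxx.
Qed.

Lemma testD f g : test_function f -> test_function g -> test_function (fun x => f x + g x).
Proof.
move=> [sf cf] [sg cg]; split; first exact: smoothD.
apply: (subclosed_compact _ (compactU cf cg)); first exact: closed_closure.
rewrite -closureU; apply: closure_subset => x /= fg.
have [fx|] := eqVneq (f x) 0; last by left.
by right; move: fg; rewrite fx add0r.
Qed.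

Lemma testM f g : smooth f -> test_function g -> test_function (fun x => f x * g x).
Proof.
move=> sf [sg cg]; apply: (test_sub (conj sg cg)) => [|x ->]; last by rewrite mulr0.
exact: smoothM.
Qed.

Lemma testZ (c : R) f : test_function f -> test_function (fun x => c * f x).
Proof. by apply: testM; exact: smooth_cst. Qed.

Lemma test_sum I (r : seq I) (f : I -> 'M[R]_(m, n) -> R) :
  (forall i, test_function (f i)) -> test_function (fun x => \sum_(i <- r) f i x).
Proof.
move=> sf; elim: r => [|i r IH].
  by under eq_fun do rewrite big_nil; exact: test0.
by under eq_fun do rewrite big_cons; exact: testD.
Qed.

Lemma test_exp f : test_function f -> test_function (fun x => expR (f x) - 1).
Proof.
move=> [sf cf]; apply: (test_sub (conj sf cf)) => [|x ->]; last by rewrite expR0 subrr.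
by apply: smoothB; [exact: smooth_exp|exact: smooth_cst].
Qed.

Lemma test_ln f : test_function f -> (forall x, -1 < f x) ->
  test_function (fun x => ln (1 + f x)).
Proof.
move=> [sf cf] f1; apply: (test_sub (conj sf cf)) => [|x ->]; last by rewrite addr0 ln1.
apply: smooth_ln => [|x]; first exact: (smoothD (smooth_cst 1) sf).
by have := f1 x; lra.
Qed.

Lemma test_bounded f : test_function f -> exists2 M : R, 0 < M & forall x, `|f x| <= M.
Proof.
move=> tf; have cf := test_continuous tf; case: (tf) => _ K.
have : compact (f @` closure [set x | f x != 0]).
  by apply: continuous_compact => //; apply: continuous_subspaceT.
move=> /compact_bounded [M [_ HM]].
exists (`|M| + 1) => [|x]; first by rewrite ltr_pwDr.
have [->|fx] := eqVneq (f x) 0; first by rewrite normr0 addr_ge0.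
apply: (HM (`|M| + 1)); first by rewrite (le_lt_trans (ler_norm M))// ltrDl.
by exists x => //; exact: subset_closure.
Qed.

End TestFunctions.

Section TensorPowerSmooth.
Context {R : realType} {d : nat}.

Lemma continuous_entries (p q k l : nat) (L : 'M[R]_(p, q) -> 'M[R]_(k, l)) :
  (forall i j, exists a b, forall M, L M i j = M a b) -> continuous L.
Proof.
move=> HL M A /nbhs_ballP[e e0 eA]; apply/nbhs_ballP; exists e => // N [_ MN].
apply: eA; split=> // i j; have [a [b Lab]] := HL i j.
by rewrite !Lab; exact: MN.
Qed.

Lemma compact_box (p q : nat) (M : R) :
  compact [set A : 'M[R]_(p, q) | forall i j, `|A i j| <= M].
Proof.
pose B := [set v : 'rV[R]_(p * q) | forall i, `[- M, M]%classic (v ord0 i)].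
have cB : compact B by apply: (@rV_compact _ _ (fun=> `[- M, M]%classic)) => i; exact: segment_compact.
have -> : [set A : 'M[R]_(p, q) | forall i j, `|A i j| <= M] = vec_mx @` B.
  rewrite predeqE => A; split => [HA|[v Hv <-] i j].
    exists (mxvec A); last exact: mxvecK.
    move=> i; case/mxvec_indexP: i => i j; rewrite mxvecE.
    by have := HA i j; rewrite ler_norml /= in_itv.
  by rewrite mxE ler_norml; have := Hv (mxvec_index i j); rewrite /= in_itv.
apply: continuous_compact => //; apply: continuous_subspaceT.
apply: continuous_entries => i j; exists ord0, (mxvec_index i j) => M'.
by rewrite mxE.
Qed.

(** A nonzero product has all rows in the support of [psi], so its support lies in a box. The
    kernels [C] are linear on test functions only; this is what allows scalars to be pulled out of
    tensor powers. *)
Lemma test_tensor_power k (psi : 'rV[R]_d -> R) : test_function psi ->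
  test_function (of_rows (@tensor_power R (Rd R d) k psi)).
Proof.
move=> tpsi; have [sp cp] := tpsi.
have E : of_rows (@tensor_power R (Rd R d) k psi) = fun M : 'M[R]_(k, d) => \prod_(i < k) psi (row i M).
  by apply/funext => M; apply: eq_bigr => i _; rewrite tnth_mktuple.
rewrite E; split.
  apply: smooth_prod => i; apply: (@smooth_comp_linear _ _ _ _ _ (row i) psi) => //.
  - by apply: continuous_entries => a b; exists i, b => M; rewrite mxE.
  - by move=> h v x; rewrite linearD linearZ.
  - move=> a b; have [->|ia] := eqVneq i a.
      by right; exists ord0, b; apply/rowP => l; rewrite !mxE eqxx.
    by left; apply/rowP => l; rewrite !mxE (negbTE ia).
have [M [_ HM]] := compact_bounded cp.
have cb := @compact_box k d (`|M| + 1).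
apply: (subclosed_compact _ cb); first exact: closed_closure.
have /closure_id -> := compact_closed (@norm_hausdorff _ _) cb.
apply: closure_subset => A /= /prodf_neq0 nA i j.
have : closure [set x | psi x != 0] (row i A) by apply/subset_closure/nA.
move=> /(HM (`|M| + 1) _) h.
have {}h : `|row i A| <= `|M| + 1 by apply: h; rewrite (le_lt_trans (ler_norm M))// ltrDl.
apply: le_trans h; rewrite [leRHS](_ : _ = mx_norm (row i A)) // mx_normrE.
by have := le_bigmax 0 (fun ij => `|(row i A) ij.1 ij.2|) (ord0, j); rewrite mxE.
Qed.

End TensorPowerSmooth.

(** * Configurations *)

Import HBSimple HBNNSimple.
Section BorelRd.
Context {R : realType} {d : nat}.
Implicit Types f : 'rV[R]_d -> R.

Lemma open_measurable_Rd (A : set 'rV[R]_d) : open A -> measurable (A : set (Rd R d)).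
Proof. by move=> oA; exact: sub_sigma_algebra. Qed.

Lemma closed_measurable_Rd (A : set 'rV[R]_d) : closed A -> measurable (A : set (Rd R d)).
Proof. by move/closed_openC/open_measurable_Rd/measurableC; rewrite setCK. Qed.

Lemma continuous_measurable_Rd f : continuous f -> measurable_fun setT (f : Rd R d -> R).
Proof.
move=> cf; apply: (measurability _ (RGenOpens.measurableE R)).
move=> _ [_ [a [b ->] <-]]; rewrite setTI; apply: open_measurable_Rd.
by apply: open_comp; [move=> x _; exact: cf|exact: interval_open].
Qed.

Lemma support_measurable f : continuous f ->
  measurable ([set x | f x != 0] : set (Rd R d)).
Proof.
move=> cf; apply: open_measurable_Rd.
rewrite (_ : [set _ | _] = f @^-1` [set~ 0]).
  apply: open_comp; first by move=> x _; exact: cf.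
  by apply: closed_openC; apply: accessible_closed_set1; apply: hausdorff_accessible; exact: Rhausdorff.
by rewrite predeqE => x /=; split => /eqP.
Qed.

Lemma measurable_set1_Rd (x : 'rV[R]_d) : measurable ([set x] : set (Rd R d)).
Proof.
apply: closed_measurable_Rd; apply: accessible_closed_set1.
by apply: hausdorff_accessible; exact: norm_hausdorff.
Qed.

End BorelRd.

Section RadonMeasure.
Context {R : realType} {d : nat}.
Variable sigma : {measure set (Rd R d) -> \bar R}.
Hypothesis sigma_radon : radon sigma.
Hypothesis sigma_non_atomic : non_atomic sigma.
Implicit Types f g chi : 'rV[R]_d -> R.

Lemma sigma_set1 (x : 'rV[R]_d) : sigma [set x] = 0%E.
Proof.
apply/eqP; rewrite eq_le measure_ge0 andbT leNgt; apply/negP => s0.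
apply: (sigma_non_atomic (A := [set x])); split => //.
  exact: measurable_set1_Rd.
move=> B mB /subset_set1[] ->; first by left; rewrite measure0.
by right; rewrite setDv measure0.
Qed.

Lemma negligible_countable (A : set 'rV[R]_d) : countable A ->
  sigma.-negligible (A : set (Rd R d)).
Proof.
move=> /countable_injP[f fi].
rewrite (_ : A = \bigcup_k (A `&` [set x | f x = k])); last first.
  by rewrite predeqE => x; split => [Ax|[k _ []]//]; exists (f x).
apply: negligible_bigcup => k.
have [[x [Ax fx]]|nx] := pselect (exists x, A x /\ f x = k); last first.
  rewrite (_ : _ `&` _ = set0); first exact: negligible_set0.
  by rewrite predeqE => x; split => // -[Ax fx]; apply: nx; exists x.
exists [set x]; split; [exact: measurable_set1_Rd|exact: sigma_set1|].
by move=> y [Ay fy]; apply: fi; rewrite ?inE//= fx fy.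
Qed.

Lemma radon_bounded (B : set (Rd R d)) : bounded_set (B : set 'rV[R]_d) ->
  measurable B -> (sigma B < +oo)%E.
Proof.
move=> bB mB; have cB : compact (closure (B : set 'rV[R]_d)).
  apply: bounded_closed_compact; last exact: closed_closure.
  case: bB => M [Mr HM]; exists M; split => // r Mrr.
  have h : closed [set x : 'rV[R]_d | `|x| <= r].
    rewrite (_ : [set _ | _] = (fun x : 'rV[R]_d => `|x|) @^-1` [set y | y <= r]) //.
    apply: closed_comp; first by move=> x _; exact: norm_continuous.
    exact: closed_le.
  move=> x cx; have : closure [set x : 'rV[R]_d | `|x| <= r] x.
    by apply: closure_subset cx; exact: HM.
  by rewrite -((closure_id _).1 h).
apply: le_lt_trans (sigma_radon.1 _ cB); apply: le_measure.
- by rewrite inE.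
- by rewrite inE; apply: closed_measurable_Rd; exact: closed_closure.
- exact: subset_closure.
Qed.

Lemma test_support_bounded chi : test_function chi -> bounded_set [set x | chi x != 0].
Proof.
case=> _ /compact_bounded [M [Mr HM]]; exists M; split => // r Mr' x xS.
by apply: (HM r Mr'); exact: subset_closure.
Qed.

Lemma sigma_support chi : test_function chi -> (sigma [set x | (chi x != 0)%R] < +oo)%E.
Proof.
move=> tc; apply: radon_bounded; first exact: test_support_bounded.
by apply: support_measurable; exact: test_continuous.
Qed.

Lemma integrable_supp chi g (M : R) : test_function chi ->
  measurable_fun setT (g : Rd R d -> R) ->
  (forall x, `|g x| <= M) -> (forall x, chi x = 0 -> g x = 0) ->
  sigma.-integrable setT (EFin \o g).
Proof.
move=> tc mg gM gc; have mS := support_measurable (test_continuous tc).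
have M0 : 0 <= M by apply: le_trans (gM 0).
have iS : sigma.-integrable setT (fun x => (M * \1_[set x | chi x != 0] x)%:E).
  under eq_fun do rewrite EFinM.
  apply: integrableZl => //; apply/integrableP; split; first exact/measurable_EFinP.
  under eq_integral do rewrite gee0_abs ?lee_fin//.
  by rewrite integral_indic// setIT; exact: sigma_support.
apply: (le_integrable measurableT _ _ iS); first exact/measurable_EFinP.
move=> x _; rewrite /= lee_fin [leRHS]ger0_norm ?mulr_ge0//.
have [cx|cx] := eqVneq (chi x) 0; first by rewrite gc// normr0 mulr_ge0.
by rewrite indicE mem_set// mulr1.
Qed.

Lemma integrable_test f : test_function f -> sigma.-integrable setT (EFin \o f).
Proof.
move=> tf; have [M _ fM] := test_bounded tf; apply: (integrable_supp tf _ fM) => //.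
by apply: continuous_measurable_Rd; exact: test_continuous.
Qed.

End RadonMeasure.

Section Configurations.
Context {R : realType} {d : nat}.
Implicit Types (gam : config R d) (f chi : 'rV[R]_d -> R).

Lemma config_support_finite gam chi : test_function chi ->
  finite_set (points gam `&` [set x | chi x != 0]).
Proof.
case=> _ cK; apply: sub_finite_set (config_locally_finite gam cK).
by apply: setIS; exact: subset_closure.
Qed.

Definition supp_points chi gam : {fset 'rV[R]_d} :=
  fset_set (points gam `&` [set x | chi x != 0]).

Definition supp_count chi gam : nat := #|` supp_points chi gam|%fset.

(** Sums over the points charged by one common [chi] can be added, exchanged and bounded by the
    number of these points, whatever the supports of the individual functions. *)
Lemma pairing_supp gam chi f : test_function chi -> (forall x, chi x = 0 -> f x = 0) ->
  pairing gam f = \sum_(x <- supp_points chi gam) f x.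
Proof.
move=> tc cf; rewrite /pairing.
rewrite -(@fsbig_widen _ _ _ _ (points gam `&` [set x | chi x != 0])).
- by rewrite fsbig_finite//; exact: config_support_finite.
- exact: subIsetl.
- move=> x [gx /= nx]; apply: cf; apply: contrapT => /eqP cx; exact: nx.
Qed.

Lemma config_countable gam : countable (points gam).
Proof.
rewrite (_ : points gam = \bigcup_(k in @setT nat) (points gam `&` [set x | `|x| <= k%:R])).
  apply: bigcup_countable; first exact: countableP.
  move=> k _; apply: finite_set_countable.
  apply: sub_finite_set (config_locally_finite gam (@compact_box R 1 d k%:R)).
  move=> x [gx xk]; split=> // i j; apply: le_trans xk.
  rewrite (_ : `|x| = mx_norm x)// mx_normrE.
  exact: (le_bigmax 0 (fun ij => `|x ij.1 ij.2|) (i, j)).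
rewrite -setI_bigcupr setIidl// => x gx.
by exists (Num.truncn `|x|).+1 => //=; rewrite ltW// truncnS_gt.
Qed.

Lemma pairing_add_point gam x f chi : test_function chi ->
  (forall x, chi x = 0 -> f x = 0) -> ~ points gam x ->
  pairing (add_point gam x) f = pairing gam f + f x.
Proof.
move=> tc cf gx; rewrite !(pairing_supp _ tc cf) /supp_points /=.
have fin := config_support_finite gam tc.
have [cx|cx] := eqVneq (chi x) 0.
  rewrite setIUl (_ : [set x] `&` _ = set0) ?setU0; last first.
    by rewrite predeqE => y; split=> // -[-> /=]; rewrite cx eqxx.
  by rewrite (cf _ cx) addr0.
rewrite setIUl (_ : [set x] `&` _ = [set x]); last first.
  by rewrite predeqE => y; split=> [[]//|->]; split.
rewrite setUC fset_setU1//.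
rewrite big_fsetU1/=; first by rewrite addrC.
by rewrite in_fset_set//; apply/negP; rewrite inE => -[].
Qed.

Lemma measurable_count (B : set (Rd R d)) : bounded_set (B : set 'rV[R]_d) -> measurable B ->
  measurable_fun setT (fun gam : Gamma R d =>
    (#|` fset_set (points gam `&` B)|%fset)%:R : R).
Proof.
move=> bB mB _ Y mY; rewrite setTI; apply: sub_sigma_algebra.
by exists B, [set n : nat | Y n%:R].
Qed.

Lemma measurable_supp_count chi : test_function chi ->
  measurable_fun setT (fun gam : Gamma R d => (supp_count chi gam)%:R : R).
Proof.
move=> tc; apply: measurable_count; first exact: test_support_bounded.
by apply: support_measurable; exact: test_continuous.
Qed.

(** The sigma-algebra is generated by counts in bounded Borel sets. For a simple function the
    pairing is a finite combination of counts in its level sets within the support of [chi];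
    approximation by simple functions and splitting into positive and negative parts do the rest. *)
Lemma measurable_pairing chi f : test_function chi ->
  measurable_fun setT (f : Rd R d -> R) -> (forall x, chi x = 0 -> f x = 0) ->
  measurable_fun setT (fun gam : Gamma R d => pairing gam f).
Proof.
move=> tc; have mS := support_measurable (test_continuous tc).
have bS := test_support_bounded tc.
have pos g : measurable_fun setT (g : Rd R d -> R) -> (forall x, 0 <= g x) ->
    measurable_fun setT (fun gam : Gamma R d => \sum_(x <- supp_points chi gam) g x).
  move=> mg g0; have mgE : measurable_fun setT (EFin \o (g : Rd R d -> R)) by exact/measurable_EFinP.
  pose a := nnsfun_approx measurableT mgE.
  pose h k (gam : Gamma R d) : R := \sum_(x <- supp_points chi gam) (a k : Rd R d -> R) x.
  have mh k : measurable_fun setT (h k).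
    have -> : h k = fun gam : Gamma R d =>
      \sum_(y <- fset_set (range (a k : Rd R d -> R))) y *
        (#|` fset_set (points gam `&` ([set x | chi x != 0] `&` (a k : Rd R d -> R) @^-1` [set y]))|%fset)%:R.
      apply/funext => gam; rewrite /h; under eq_bigr do rewrite fimfunE fsbig_finite//.
      rewrite exchange_big/=; apply: eq_bigr => y _; rewrite -mulr_sumr; congr (_ * _).
      have fin := config_support_finite gam tc.
      have fin2 : finite_set (points gam `&` ([set x | chi x != 0] `&` (a k : Rd R d -> R) @^-1` [set y])).
        by apply: sub_finite_set fin => x [gx [xS _]].
      rewrite (eq_bigr (fun x => if x \in (a k : Rd R d -> R) @^-1` [set y] then 1 else 0)); last first.
        by move=> x _; rewrite indicE; case: ifP.
      rewrite -big_mkcond/= -big_filter big_const_seq count_predT iter_addr_0; congr (_ *+ _).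
      apply: perm_size; apply: uniq_perm; rewrite ?filter_uniq ?fset_uniq// => x.
      rewrite mem_filter !in_fset_set//; apply/andP/idP; rewrite !in_setE.
        by move=> [axy [gx xS]].
      by move=> [gx [xS axy]].
    apply: measurable_sum => y; apply: measurable_funM; first exact: measurable_cst.
    apply: measurable_count; last exact: measurableI.
    by case: bS => M [Mr HM]; exists M; split => // r Mr' x [xS _]; exact: HM Mr' x xS.
  have ch gam : setT gam -> h ^~ gam @ \oo --> \sum_(x <- supp_points chi gam) g x.
    move=> _; apply: cvg_big => [|x _]; first exact: add_continuous.
    have /fine_cvgP[_] := @cvg_nnsfun_approx _ _ _ _ measurableT _ mgE (fun x _ => g0 x) x I.
    by [].
  exact: (measurable_fun_cvg mh ch).
move=> mf cf; rewrite (_ : (fun gam => _) = fun gam : Gamma R d =>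
   (\sum_(x <- supp_points chi gam) Num.max (f x) 0) -
   (\sum_(x <- supp_points chi gam) Num.max (- f x) 0)).
  apply: measurable_funB; apply: pos.
  - by apply: measurable_maxr => //; exact: measurable_cst.
  - by move=> x; rewrite le_max lexx orbT.
  - by apply: measurable_maxr; [exact: measurable_funN|exact: measurable_cst].
  - by move=> x; rewrite le_max lexx orbT.
apply/funext => gam; rewrite (pairing_supp _ tc cf) -sumrB; apply: eq_bigr => x _.
by case: (leP (f x) 0) => h; case: (leP (- f x) 0) => h'; lra.
Qed.

End Configurations.

(** * Power series *)

Section PowerSeries.
Context {R : realType}.
Implicit Types (a b c : nat -> R) (f : R -> R).

(** Convergence at [delta / 2] bounds the terms there by some [B]. At a point [q] times smaller, the
    terms after the first add up to at most [2 * q * B], so the first one is arbitrarily small. *)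
Lemma pseries_eq0_head c (delta : R) : 0 < delta ->
  (forall t, 0 < t < delta -> series (fun n => c n * t ^+ n) @ \oo --> 0) -> c 0%N = 0.
Proof.
move=> d0 H; pose t0 := delta / 2.
have t00 : 0 < t0 by rewrite divr_gt0.
have t0d : 0 < t0 < delta by rewrite t00 ltr_pdivrMr// ltr_pMr// ltr1n.
have [B Bp HB] : exists2 B : R, 0 < B & forall n, `|c n * t0 ^+ n| <= B.
  have /cvg_series_cvg_0/cvgP/cvg_seq_bounded : cvgn (series (fun n => c n * t0 ^+ n)).
    by apply/cvg_ex; exists 0; exact: H.
  move=> [M [_ HM]]; exists (`|M| + 1); first by rewrite ltr_wpDl.
  by move=> n; apply: (HM (`|M| + 1)) => //; rewrite (le_lt_trans (ler_norm M))// ltrDl.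
apply/normr0_eq0/eqP; rewrite eq_le normr_ge0 andbT.
apply/ler_addgt0Pl => e e0; rewrite addr0.
(* [q <= 2^-1] bounds the geometric sum by 2, and [4 * B * q <= e] then makes the tail at most
   [e / 2]. *)
pose q := Num.min 2^-1 (e / (4 * B)).
have q0 : 0 < q by rewrite lt_min invr_gt0 ltr0n divr_gt0 ?mulr_gt0.
have q2 : q <= 2^-1 by rewrite ge_min lexx.
have qB : 4 * B * q <= e by rewrite mulrC -ler_pdivlMr ?mulr_gt0// ge_min lexx orbT.
have qd : 0 < q * t0 < delta.
  rewrite mulr_gt0//=; apply: le_lt_trans (_ : 1 * t0 < _); last by rewrite mul1r; case/andP: t0d.
  by rewrite ler_wpM2r ?ltW//; lra.
have /cvgrPdist_le /(_ (e / 2)) [|N _ HN] := H _ qd; first by rewrite divr_gt0.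
have := HN N.+1 (leqnSn _); rewrite sub0r normrN /series/= big_nat_recl//= expr0 mulr1.
have bnd n : `|\sum_(0 <= i < n) c i.+1 * (q * t0) ^+ i.+1| <= B * (2 * q).
  have h k : `|c k.+1 * (q * t0) ^+ k.+1| <= B * (q * (2^-1) ^+ k).
    rewrite exprMn mulrCA normrM [leRHS]mulrC; apply: ler_pM => //.
    have -> : `|q ^+ k.+1| = q * q ^+ k by rewrite -exprS ger0_norm// exprn_ge0// ltW.
    apply: ler_wpM2l; first exact: ltW.
    by apply: lerXn2r => //; rewrite nnegrE ltW.
  apply: le_trans (ler_norm_sum _ _ _) _; apply: le_trans (ler_sum _ (fun k _ => h k)) _.
  rewrite -!mulr_sumr ler_pM2l// mulrC ler_pM2r//.
  have -> : \sum_(0 <= i < n) (2^-1 : R) ^+ i = series (geometric 1 2^-1) n.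
    by rewrite /series/=; apply: eq_bigr => i _; rewrite /geometric/= mul1r.
  rewrite geometric_seriesE; last by apply/eqP => h2; lra.
  rewrite /= mul1r (_ : 1 - 2^-1 = 2^-1); last by field.
  by rewrite invrK ler_piMl// lerBlDr lerDl exprn_ge0// invr_ge0.
have {}bnd := bnd N; set S := \sum_(_ <= _ < _) _ in bnd * => h1.
have : `|c 0%N| <= `|c 0%N + S| + `|S|.
  by rewrite -{1}(addrK S (c 0%N)); exact: ler_normB.
by move=> h2; apply: le_trans h2 _; lra.
Qed.

Lemma pseries_eq0 c (delta : R) : 0 < delta ->
  (forall t, 0 < t < delta -> series (fun n => c n * t ^+ n) @ \oo --> 0) ->
  forall n, c n = 0.
Proof.
move=> d0 H n; elim: n c H => [|n IH] c H; first exact: pseries_eq0_head H.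
have c0 := pseries_eq0_head d0 H.
apply: (IH (fun n => c n.+1)) => t /[dup] /andP[t0 _] td.
have h : (fun n => t^-1 * series (fun n => c n * t ^+ n) n.+1) @ \oo --> t^-1 * 0.
  apply: cvgM; first exact: cvg_cst.
  by have := H t td; rewrite -(cvg_shiftS (series _)).
rewrite mulr0 in h; apply: cvg_trans h.
apply: near_eq_cvg; apply: nearW => k; rewrite /series/= big_nat_recl//= c0 mul0r add0r.
rewrite mulr_sumr; apply: eq_bigr => i _.
by rewrite exprS mulrCA mulKf ?gt_eqF//.
Qed.

Lemma pseries_inj a b f (delta : R) : 0 < delta ->
  (forall t, 0 < t < delta -> series (fun n => a n * t ^+ n) @ \oo --> f t) ->
  (forall t, 0 < t < delta -> series (fun n => b n * t ^+ n) @ \oo --> f t) ->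
  forall n, a n = b n.
Proof.
move=> d0 Ha Hb n; apply/eqP; rewrite -subr_eq0; apply/eqP.
apply: (pseries_eq0 (c := fun n => a n - b n) d0) => t td.
have -> : series (fun n => (a n - b n) * t ^+ n) =
    fun k => series (fun n => a n * t ^+ n) k - series (fun n => b n * t ^+ n) k.
  apply/funext => k; rewrite /series/= -sumrB.
  by apply: eq_bigr => i _; rewrite mulrBl.
by rewrite -(subrr (f t)); exact: cvgB (Ha t td) (Hb t td).
Qed.

(** The single number [G] controls, for [t] in the unit interval, all partial sums and all
    remainders divided by their leading power. For coefficients depending on a configuration it is
    the source of majorants. *)
Definition pseries_rep a f (G : R) :=
  (forall t, series (fun n => a n * t ^+ n) @ \oo --> f t) /\
  (forall n, \sum_(k < n) `|a k| <= G).

Lemma pseries_rep_exp (m : R) :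
  pseries_rep (fun n => (- m) ^+ n / n`!%:R) (fun t => expR (- (m * t))) (expR `|m|).
Proof.
split=> [t|n].
  rewrite (_ : (fun n => _) = exp_coeff (- (m * t))).
    by rewrite /expR; exact: is_cvg_series_exp_coeff.
  by apply/funext => n; rewrite exp_coeffE mulrAC -exprMn mulNr mulrC.
have -> : \sum_(k < n) `|(- m) ^+ k / k`!%:R| = series (exp_coeff `|m|) n.
  rewrite /series/= big_mkord; apply: eq_bigr => k _.
  by rewrite exp_coeffE normrM normrX normrN mulrC normfV normr_nat.
apply: nondecreasing_cvgn_le; last exact: is_cvg_series_exp_coeff.
apply: nondecreasing_series => k _ _; rewrite exp_coeffE.
by rewrite mulr_ge0 ?invr_ge0 ?ler0n ?exprn_ge0.
Qed.

Lemma pseries_rep_factor a f G (x : R) : pseries_rep a f G ->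
  pseries_rep (fun n => a n + x * (if n is k.+1 then a k else 0))
    (fun t => (1 + t * x) * f t) ((1 + `|x|) * G).
Proof.
move=> [af aG]; split=> [t|n].
  rewrite -cvg_shiftS.
  have E n : series (fun n => (a n + x * (if n is k.+1 then a k else 0)) * t ^+ n) n.+1 =
      series (fun n => a n * t ^+ n) n.+1 + t * x * series (fun n => a n * t ^+ n) n.
    rewrite /series/= [in LHS]big_nat_recl//= mulr0 addr0 [in RHS]big_nat_recl//= -addrA.
    congr (_ + _); rewrite mulr_sumr -big_split/=; apply: eq_bigr => k _.
    by rewrite exprS; ring.
  under eq_fun do rewrite E.
  rewrite mulrDl mul1r; apply: cvgD; first by rewrite (cvg_shiftS (series _)); exact: af.
  by apply: cvgM; [exact: cvg_cst|exact: af].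
apply: le_trans (_ : \sum_(k < n) (`|a k| + `|x| * `|if (k : nat) is j.+1 then a j else 0|) <= _).
  by apply: ler_sum => k _; apply: le_trans (ler_normD _ _) _; rewrite normrM.
rewrite big_split/= -mulr_sumr mulrDl mul1r lerD ?aG// ler_wpM2l//.
case: n => [|n]; first by rewrite big_ord0; have := aG 0%N; rewrite big_ord0.
by rewrite big_ord_recl/= normr0 add0r aG.
Qed.

(** Multiplication by [1 + t * x] adds a shifted copy of the coefficients and costs a factor
    [1 + |x|] in the bound. In this product form the logarithm of the Wick exponential is gone, so
    the expansion converges for every [t]. *)
Lemma pseries_rep_prod (T : Type) (m : R) (s : seq T) (psi : T -> R) :
  exists a, pseries_rep a (fun t => expR (- (m * t)) * \prod_(x <- s) (1 + t * psi x))
    (expR `|m| * \prod_(x <- s) (1 + `|psi x|)).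
Proof.
elim: s => [|x s [a IH]].
  exists (fun n => (- m) ^+ n / n`!%:R); rewrite big_nil mulr1.
  have -> : (fun t : R => expR (- (m * t)) * \prod_(x <- [::]) (1 + t * psi x)) =
      fun t => expR (- (m * t)) by apply/funext => t; rewrite big_nil mulr1.
  exact: pseries_rep_exp.
exists (fun n => a n + psi x * (if n is k.+1 then a k else 0)).
rewrite big_cons mulrCA.
have -> : (fun t : R => expR (- (m * t)) * \prod_(y <- x :: s) (1 + t * psi y)) =
    fun t => (1 + t * psi x) * (expR (- (m * t)) * \prod_(y <- s) (1 + t * psi y)).
  by apply/funext => t; rewrite big_cons mulrCA.
exact: pseries_rep_factor.
Qed.

Lemma pseries_rep_remainder a f G t n : pseries_rep a f G -> 0 <= t <= 1 ->
  `|f t - \sum_(k < n) a k * t ^+ k| <= t ^+ n * G.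
Proof.
move=> [af aG] /andP[t0 t1].
have c : (fun N => `|series (fun n => a n * t ^+ n) N - \sum_(k < n) a k * t ^+ k|) @ \oo -->
    `|f t - \sum_(k < n) a k * t ^+ k|.
  by apply: cvg_norm; apply: cvgB; [exact: af|exact: cvg_cst].
rewrite -(cvg_lim _ c)//; apply: limr_le; first by apply/cvg_ex; eexists; exact: c.
exists n => // N /= nN; rewrite /series/=.
rewrite -(big_mkord xpredT (fun k => a k * t ^+ k)) (big_cat_nat (leq0n n) nN)//= addrAC subrr add0r.
apply: le_trans (ler_norm_sum _ _ _) _.
apply: le_trans (_ : \sum_(n <= k < N) t ^+ n * `|a k| <= _).
  rewrite !big_nat; apply: ler_sum => k /andP[nk _]; rewrite normrM mulrC ler_wpM2r//.
  by rewrite ger0_norm ?exprn_ge0// ler_wiXn2l.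
rewrite -mulr_sumr ler_wpM2l ?exprn_ge0//; apply: le_trans (aG N).
by rewrite -(big_mkord xpredT (fun k => `|a k|)) (big_cat_nat (leq0n n) nN)//= lerDr sumr_ge0.
Qed.

Lemma pseries_rep_partial a f G t n : pseries_rep a f G -> `|t| <= 1 ->
  `|\sum_(k < n) a k * t ^+ k| <= G.
Proof.
move=> [_ aG] t1; apply: le_trans (ler_norm_sum _ _ _) _; apply: le_trans (aG n).
by apply: ler_sum => k _; rewrite normrM normrX ler_piMr// exprn_ile1.
Qed.

End PowerSeries.

Section RealDominated.
Context {disp : measure_display} {T : measurableType disp} {R : realType}.
Variable mu : {measure set T -> \bar R}.

Lemma Rintegral_dominated (u : nat -> T -> R) (f G : T -> R) :
  (forall k, measurable_fun setT (u k)) ->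
  (forall x, (u ^~ x) @ \oo --> f x) -> (forall k x, `|u k x| <= G x) ->
  mu.-integrable setT (EFin \o G) ->
  mu.-integrable setT (EFin \o f) /\
  (fun k => \int[mu]_x u k x) @ \oo --> \int[mu]_x f x.
Proof.
move=> mu_ uf uG iG.
have cE x : setT x -> (fun k => (u k x)%:E) @ \oo --> (f x)%:E.
  by move=> _; apply: cvg_EFin; [exact: nearW|exact: uf].
have mE k : measurable_fun setT (fun x => (u k x)%:E) by exact/measurable_EFinP.
have GE k x : setT x -> (`|(u k x)%:E| <= (G x)%:E)%E by rewrite lee_fin.
have [i _ cv] := dominated_convergence measurableT mE
  (emeasurable_fun_cvg _ _ mE cE) (aeW _ cE) iG (aeW _ (fun x k => @GE k x)).
split=> //; rewrite /Rintegral; apply: fine_cvg.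
by rewrite fineK//; exact: integrable_fin_num.
Qed.

End RealDominated.

Section PowerSeriesCoefficient.
Context {R : realType}.

(** A coefficient is a limit of quotients formed from values of [f] and earlier coefficients. A
    property stable under linear combinations and limits thus passes from the values of [f] to its
    coefficients by strong induction; measurability and membership in the closure are obtained in
    this way. *)
Lemma pseries_rep_coefficient (a : nat -> R) f G (t : nat -> R) n : pseries_rep a f G ->
  (forall j, 0 < t j <= 1) -> t @ \oo --> 0 ->
  (fun j => (f (t j) - \sum_(k < n) a k * t j ^+ k) / t j ^+ n) @ \oo --> a n.
Proof.
move=> rep t01 t0; apply/subr_cvg0.
apply: (@squeeze_cvgr _ _ _ _ (fun j => - (t j * G)) (fun j => t j * G)).
- apply: nearW => j; rewrite -ler_norml.
  have /andP[tj0 tj1] := t01 j; have tn0 : 0 < t j ^+ n by rewrite exprn_gt0.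
  have -> : (f (t j) - \sum_(k < n) a k * t j ^+ k) / t j ^+ n - a n =
      (f (t j) - \sum_(k < n.+1) a k * t j ^+ k) / t j ^+ n.
    by rewrite big_ord_recr/= opprD addrA [RHS]mulrDl mulNr mulfK// gt_eqF.
  rewrite normrM normfV (gtr0_norm tn0) ler_pdivrMr// mulrAC -exprS.
  by apply: pseries_rep_remainder => //; rewrite ltW.
- rewrite -oppr0 -(mul0r G); apply: cvgN; apply: cvgM => //; exact: cvg_cst.
- rewrite -(mul0r G); apply: cvgM => //; exact: cvg_cst.
Qed.

End PowerSeriesCoefficient.

(** * Wick exponentials and Charlier kernels *)

Import HBSimple HBNNSimple.

Section SquareSums.
Context {R : realType} {d : nat}.

(* A test function whose support contains those of finitely many others. *)
Definition square_sum (I : finType) (phis : I -> 'rV[R]_d -> R) (x : 'rV[R]_d) : R :=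
  \sum_i phis i x * phis i x.

Lemma test_square_sum (I : finType) (phis : I -> 'rV[R]_d -> R) :
  (forall i, test_function (phis i)) -> test_function (square_sum phis).
Proof.
by move=> t; apply: test_sum => i; apply: testM; [case: (t i)|].
Qed.

Lemma square_sum_eq0 (I : finType) (phis : I -> 'rV[R]_d -> R) x i :
  square_sum phis x = 0 -> phis i x = 0.
Proof.
move=> /psumr_eq0P H; have /eqP := H (fun i _ => sqr_ge0 (phis i x)) i isT.
by rewrite mulf_eq0 orbb => /eqP.
Qed.

Definition square_sum2 (f g : 'rV[R]_d -> R) (x : 'rV[R]_d) : R := f x * f x + g x * g x.

Lemma test_square_sum2 f g : test_function f -> test_function g ->
  test_function (square_sum2 f g).
Proof. by move=> tf tg; apply: testD; apply: testM => //; [case: tf|case: tg]. Qed.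

Lemma square_sum2_eq0l f g x : square_sum2 f g x = 0 -> f x = 0.
Proof. by rewrite /square_sum2 => h; apply/eqP; rewrite -sqrf_eq0 expr2; nra. Qed.

Lemma square_sum2_eq0r f g x : square_sum2 f g x = 0 -> g x = 0.
Proof. by rewrite /square_sum2 addrC; exact: square_sum2_eq0l. Qed.

End SquareSums.

(** * Exponential moments of the Poisson measure *)

Section Poisson.
Context {R : realType} {d : nat}.
Variable sigma : {measure set (Rd R d) -> \bar R}.
Hypothesis sigma_radon : radon sigma.
Variable P : probability (Gamma R d) R.
Hypothesis P_poisson : is_poisson sigma P.
Implicit Types (gam : Gamma R d) (chi psi : 'rV[R]_d -> R).

Lemma pairing_sumD chi f g gam : test_function chi ->
  (forall x, chi x = 0 -> f x = 0) -> (forall x, chi x = 0 -> g x = 0) ->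
  pairing gam (fun x => f x + g x) = pairing gam f + pairing gam g.
Proof.
move=> tc cf cg; rewrite !(pairing_supp _ tc) ?big_split//.
by move=> x cx; rewrite cf ?cg ?addr0.
Qed.

Lemma measurable_pairing_test psi : test_function psi ->
  measurable_fun setT (fun gam => pairing gam psi).
Proof.
move=> tp; apply: (measurable_pairing tp) => //.
by apply: continuous_measurable_Rd; exact: test_continuous.
Qed.

(** The Laplace functional is given on test functions, but the count pairs with an indicator. The
    test functions [g k] approximate [c] times this indicator pointwise; Fatou's lemma and the
    uniform bound [expR (g k x) - 1 <= B x] conclude. *)
Lemma exp_count_integrable chi (c : R) : test_function chi -> 0 <= c ->
  P.-integrable setT (fun gam => (expR (c * (supp_count chi gam)%:R))%:E).
Proof.
move=> tc c0; have [sc _] := tc.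
(* [w] is 1 where [chi] vanishes and smaller than 1 elsewhere, so [w ^+ k] tends to the indicator of
   the zero set of [chi]. *)
pose w x := (1 + chi x * chi x)^-1.
have w0 x : 0 < 1 + chi x * chi x by rewrite ltr_pwDl// sqr_ge0.
have w1 x : 0 <= w x <= 1.
  by rewrite /w invr_ge0 ltW//= invf_le1// lerDl sqr_ge0.
pose g k x := c * (1 - \prod_(i < k) w x).
have gE k x : g k x = c * (1 - w x ^+ k) by rewrite /g prodr_const card_ord.
have gc x k : chi x = 0 -> g k x = 0.
  by move=> cx; rewrite gE /w cx mulr0 addr0 invr1 expr1n subrr mulr0.
have sw : smooth w.
  apply: smoothV => [|x]; last by rewrite gt_eqF.
  by apply: smoothD; [exact: smooth_cst|exact: smoothM].
have tg k : test_function (g k).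
  apply: (test_sub tc) => [|x /gc//]; apply: smoothZ; apply: smoothB.
    exact: smooth_cst.
  by apply: smooth_prod.
have g0 k x : 0 <= g k x <= c.
  rewrite gE; have /andP[w0' w1'] := w1 x.
  have := exprn_ge0 k w0'; have := exprn_ile1 k w0' w1'; nra.
have mS := support_measurable (test_continuous tc).
pose B x : R := (expR c - 1) * \1_[set x | chi x != 0] x.
have iB : sigma.-integrable setT (EFin \o B).
  apply: (integrable_supp sigma_radon tc (M := expR c - 1)).
  - by apply: measurable_funM; [exact: measurable_cst|exact: measurable_indic].
  - have e0 : 0 <= expR c - 1 by rewrite subr_ge0 -expR0 ler_expR.
    by move=> x; rewrite /B indicE ger0_norm ?mulr_ge0//; case: (_ \in _); rewrite ?mulr1 ?mulr0.
  - by move=> x cx; rewrite /B indicE memNset ?mulr0//= cx eqxx.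
have mX : measurable_fun setT (fun gam => expR (c * (supp_count chi gam)%:R)).
  apply: measurableT_comp; first exact: measurable_expR.
  by apply: measurable_funM; [exact: measurable_cst|exact: measurable_supp_count].
apply/integrableP; split; first exact/measurable_EFinP.
under eq_integral do rewrite gee0_abs ?lee_fin ?expR_ge0//.
apply: (le_lt_trans (y := (expR (\int[sigma]_x B x))%:E)); last exact: ltry.
apply: (integral_le_liminf (F := fun k gam => expR (pairing gam (g k)))).
- move=> k; apply: measurableT_comp; first exact: measurable_expR.
  exact: measurable_pairing_test.
- exact: mX.
- by move=> k gam; exact: expR_ge0.
- by move=> gam; exact: expR_ge0.
- apply: aeW => gam; apply: continuous_cvg; first exact: continuous_expR.
  rewrite (_ : c * _ = \sum_(x <- supp_points chi gam) (if chi x == 0 then 0 else c)).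
    under eq_fun do rewrite (pairing_supp _ tc (fun x => gc x _)).
    apply: cvg_big => [|x _]; first exact: add_continuous.
    case: eqVneq => cx; first by under eq_fun do rewrite gc//; exact: cvg_cst.
    under eq_fun do rewrite gE.
    have cw : (fun k => w x ^+ k) @ \oo --> (0 : R).
      apply: cvg_expr; have /andP[h _] := w1 x; rewrite ger0_norm// /w invf_lt1// ltrDl.
      by rewrite lt0r sqr_ge0 mulf_neq0.
    have h : (fun k => c * (1 - w x ^+ k)) @ \oo --> c * (1 - 0).
      by apply: cvgM; [exact: cvg_cst|apply: cvgB => //; exact: cvg_cst].
    by rewrite subr0 mulr1 in h.
  rewrite /supp_count -[size _]count_predT -sum1_count natr_sum mulr_sumr.
  rewrite !big_seq; apply: eq_bigr => x; rewrite /supp_points in_fset_set; last first.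
    exact: config_support_finite.
  by rewrite inE => -[_ /= /negPf ->]; rewrite mulr1.
- exists 0%N => k _; rewrite P_poisson// lee_fin ler_expR; apply: le_Rintegral => //.
    exact: (integrable_test sigma_radon (test_exp _)).
  move=> x _; rewrite /B indicE; have [cx|cx] := eqVneq (chi x) 0.
    by rewrite gc// expR0 subrr mulr_ge0// subr_ge0 -[leLHS]expR0 ler_expR.
  by rewrite mem_set// mulr1 lerD2r ler_expR; case/andP: (g0 k x).
Qed.

Definition wick psi gam : R :=
  expR (pairing gam (fun x => ln (1 + psi x)) - \int[sigma]_x psi x).

Lemma measurable_wick psi : test_function psi -> (forall x, -1 < psi x) ->
  measurable_fun setT (wick psi).
Proof.
move=> tp p1; apply: measurableT_comp; first exact: measurable_expR.
apply: measurable_funB; last exact: measurable_cst.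
by apply: measurable_pairing_test; exact: test_ln.
Qed.

(** Since [(1 + psi) * (1 + psi') - 1 = psi + psi' + psi * psi'], the linear terms of the Laplace
    functional cancel against the normalizations. *)
Lemma wick_moment psi psi' : test_function psi -> (forall x, -1 < psi x) ->
  test_function psi' -> (forall x, -1 < psi' x) ->
  (\int[P]_gam (wick psi gam * wick psi' gam)%:E =
   (expR (\int[sigma]_x (psi x * psi' x)))%:E)%E.
Proof.
move=> tp p1 tp' p1'.
have tc := test_square_sum2 tp tp'.
pose th x := ln (1 + psi x) + ln (1 + psi' x).
have tth : test_function th by apply: testD; exact: test_ln.
transitivity (\int[P]_gam ((expR (pairing gam th))%:E *
    (expR (- (\int[sigma]_x psi x + \int[sigma]_x psi' x)))%:E))%E.
  apply: eq_integral => gam _; rewrite -EFinM /wick -!expRD; congr (expR _)%:E.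
  rewrite (pairing_sumD (chi := square_sum2 psi psi'))//.
  - by ring.
  - by move=> x /square_sum2_eq0l ->; rewrite addr0 ln1.
  - by move=> x /square_sum2_eq0r ->; rewrite addr0 ln1.
have mth : measurable_fun setT (fun gam => (expR (pairing gam th))%:E).
  apply/measurable_EFinP; apply: measurableT_comp; first exact: measurable_expR.
  exact: measurable_pairing_test.
rewrite ge0_integralZr//.
rewrite P_poisson// -EFinM -expRD; congr (expR _)%:E.
have -> : \int[sigma]_x (expR (th x) - 1) =
    \int[sigma]_x ((psi x + psi' x) + psi x * psi' x).
  apply: eq_Rintegral => x _; rewrite /th expRD; have h := p1 x; have h' := p1' x.
  by rewrite !lnK ?posrE; [ring|lra|lra].
have ip := integrable_test sigma_radon tp.
have ip' := integrable_test sigma_radon tp'.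
have ipp : sigma.-integrable setT (EFin \o (fun x => psi x * psi' x)).
  by apply: (integrable_test sigma_radon); apply: testM => //; case: tp.
rewrite RintegralD//; last exact: (integrable_test sigma_radon (testD tp tp')).
by rewrite RintegralD//; ring.
Qed.

End Poisson.

(** * Charlier kernels as coefficients of the Wick exponentials *)

Section CharlierCoefficients.
Context {R : realType} {d : nat}.
Variable sigma : {measure set (Rd R d) -> \bar R}.
Hypothesis sigma_radon : radon sigma.
Variable P : probability (Gamma R d) R.
Hypothesis P_poisson : is_poisson sigma P.
Variable C : forall n, config R d -> (n.-tuple (Rd R d) -> R) -> R.
Hypothesis C_charlier : charlier_kernels sigma C.
Implicit Types (gam : Gamma R d) (chi psi : 'rV[R]_d -> R).

Lemma symmetric_distributionZ n (D : (n.-tuple (Rd R d) -> R) -> R) a f :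
  symmetric_distribution D -> test_function (of_rows f) -> D (fun t => a * f t) = a * D f.
Proof.
move=> [lin _ _] tf; have t0 : test_function (of_rows (fun _ : n.-tuple (Rd R d) => 0 : R)).
  exact: test0.
have D0 : D (fun=> 0) = 0.
  have := lin 1 _ _ t0 t0; under [X in D X = _]eq_fun do rewrite mulr0 addr0.
  by rewrite mul1r => /eqP; rewrite -subr_eq subrr eq_sym => /eqP.
by have := lin a _ _ tf t0; under [X in D X = _]eq_fun do rewrite addr0; rewrite D0 addr0.
Qed.

Lemma tensor_powerZ n (a : R) (psi : Rd R d -> R) :
  @tensor_power R (Rd R d) n (fun x => a * psi x) =
  fun t => a ^+ n * tensor_power psi t.
Proof.
by apply/funext => t; rewrite /tensor_power big_split/= prodr_const card_ord.
Qed.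

Definition charlier_coef n psi gam : R := C gam (@tensor_power R (Rd R d) n psi) / n`!%:R.

Definition charlier_bound chi psi gam : R :=
  expR `|\int[sigma]_x psi x| * \prod_(x <- supp_points chi gam) (1 + `|psi x|).

(** The Wick exponential of [t psi] with its logarithm resolved: both agree while [1 + t psi] is
    positive, but this form is entire in [t]. *)
Definition charlier_sum chi psi gam (t : R) : R :=
  expR (- (\int[sigma]_x psi x * t)) * \prod_(x <- supp_points chi gam) (1 + t * psi x).

Lemma charlier_sum_wick chi psi gam t : test_function chi -> test_function psi ->
  (forall x, chi x = 0 -> psi x = 0) -> (forall x, -1 < t * psi x) ->
  charlier_sum chi psi gam t = wick sigma (fun x => t * psi x) gam.
Proof.
move=> tc tp cp t1; rewrite /charlier_sum /wick expRD [RHS]mulrC; congr (_ * _).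
  by rewrite RintegralZl//; [rewrite mulrC|exact: integrable_test].
rewrite (pairing_supp _ tc); last by move=> x /cp ->; rewrite mulr0 addr0 ln1.
rewrite expR_sum; apply: eq_bigr => x _; rewrite lnK// posrE.
by have := t1 x; lra.
Qed.

Lemma small_perturbation psi (M t : R) : (forall x, `|psi x| <= M) -> 0 < t ->
  t * M < 1 -> forall x, -1 < t * psi x.
Proof.
move=> pM t0 tM x; have := pM x; rewrite ler_norml => /andP[h _].
by have : t * - M <= t * psi x by [rewrite ler_pM2l]; lra.
Qed.

(** The expansion of the kernels holds near [t = 0], with a radius depending on [gam] and [psi].
    Comparing coefficients there with the entire function [charlier_sum] replaces it by an expansion
    with an explicit bound. *)
Lemma charlier_coef_rep chi psi gam : test_function chi -> test_function psi ->
  (forall x, chi x = 0 -> psi x = 0) ->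
  pseries_rep (fun n => charlier_coef n psi gam) (charlier_sum chi psi gam)
    (charlier_bound chi psi gam).
Proof.
move=> tc tp cp; have [Cs CE] := C_charlier.
have [a ra] := pseries_rep_prod (\int[sigma]_x psi x) (supp_points chi gam) psi.
suff E : (fun n => charlier_coef n psi gam) = a by rewrite E.
apply/funext; have [M M0 pM] := test_bounded tp.
have /nbhs_ballP[e/= e0 He] := CE gam psi tp.
(* Below [e] the expansion of the kernels holds; below [M^-1] the argument of the logarithm is
   positive. *)
pose delta := Num.min e M^-1.
have d0 : 0 < delta by rewrite lt_min e0 invr_gt0.
apply: (pseries_inj d0 (f := charlier_sum chi psi gam)) => t /andP[t0]; last first.
  by move=> _; exact: ra.1.
rewrite lt_min => /andP[te tM].
have {}tM : t * M < 1 by rewrite -ltr_pdivlMr// div1r.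
rewrite charlier_sum_wick//; last exact: small_perturbation pM t0 tM.
have bt : ball (0 : R) e t by rewrite /ball/= sub0r normrN gtr0_norm.
have := He t bt; rewrite (_ : (fun n => n`!%:R^-1 * _) = fun n => charlier_coef n psi gam * t ^+ n)//.
apply/funext => n; rewrite tensor_powerZ (symmetric_distributionZ _ (Cs n gam)).
  by rewrite /charlier_coef; ring.
exact: test_tensor_power.
Qed.

Lemma charlier_bound_le chi psi gam (M : R) : (forall x, `|psi x| <= M) ->
  charlier_bound chi psi gam <=
  expR `|\int[sigma]_x psi x| * expR (M * (supp_count chi gam)%:R).
Proof.
move=> pM; rewrite ler_pM2l ?expR_gt0//.
apply: (@le_trans _ _ (\prod_(x <- supp_points chi gam) expR M)).
  apply: ler_prod => x _; rewrite addr_ge0//=; apply: le_trans (expR_ge1Dx _).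
  by rewrite lerD2l.
by rewrite -expR_sum big_const_seq count_predT iter_addr_0 mulr_natr.
Qed.

(** The kernels are given configuration by configuration, so measurability has to be derived: it is
    inherited from the Wick exponentials through divided remainders. *)
Lemma measurable_charlier_coef n psi : test_function psi ->
  measurable_fun setT (charlier_coef n psi).
Proof.
move=> tp; elim/ltn_ind: n => n IH; have [M M0 pM] := test_bounded tp.
(* The factor [(M + 1)^-1] keeps [t j * psi x] above -1 for all [x] at once, and [t j] at most 1. *)
pose t j : R := (M + 1)^-1 * j.+1%:R^-1.
have M1 : 0 < M + 1 by rewrite addr_gt0.
have t0 j : 0 < t j by rewrite mulr_gt0 ?invr_gt0.
have tM1 j : t j * (M + 1) <= 1.
  by rewrite /t mulrAC mulVf ?gt_eqF// mul1r invf_le1// ler1n.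
have t1 j : 0 < t j <= 1.
  by rewrite t0/=; apply: le_trans (tM1 j); rewrite ler_pMr ?t0// lerDr ltW.
have cvt : t @ \oo --> 0.
  rewrite -(mulr0 (M + 1)^-1); apply: cvgM; first exact: cvg_cst.
  exact: cvg_harmonic.
have sp j x : -1 < t j * psi x.
  apply: (small_perturbation pM) => //; apply: lt_le_trans (tM1 j).
  by rewrite ltr_pM2l ?t0// ltrDl.
apply: (@measurable_fun_cvg _ _ _ setT (fun j gam =>
   (wick sigma (fun x => t j * psi x) gam - \sum_(k < n) charlier_coef k psi gam * t j ^+ k)
   / t j ^+ n)).
  move=> j; apply: measurable_funM; last exact: measurable_cst.
  apply: measurable_funB; first by apply: measurable_wick => //; exact: testZ.
  apply: measurable_sum => k; apply: measurable_funM; last exact: measurable_cst.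
  exact: IH.
move=> gam _.
under eq_fun do rewrite -(charlier_sum_wick _ tp tp)//.
exact: pseries_rep_coefficient (charlier_coef_rep gam tp tp _) t1 cvt.
Qed.

Lemma charlier_bound_square_integrable chi psi : test_function chi -> test_function psi ->
  exists2 G : Gamma R d -> R, square_integrable P (fun gam => (G gam)%:C%C) &
    forall gam, charlier_bound chi psi gam <= G gam.
Proof.
move=> tc tp; have [M M0 pM] := test_bounded tp.
exists (fun gam => expR `|\int[sigma]_x psi x| * expR (M * (supp_count chi gam)%:R)).
  have E gam : expR (M * (supp_count chi gam)%:R) ^+ 2 = expR (2 * M * (supp_count chi gam)%:R).
    by rewrite -mulrA expRM_natl.
  apply: (@square_integrable_le _ _ _ _ _
    (fun gam => expR `|\int[sigma]_x psi x| ^+ 2 * expR (2 * M * (supp_count chi gam)%:R))).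
  - apply: cmeasurable_real; apply: measurable_funM; first exact: measurable_cst.
    apply: measurableT_comp; first exact: measurable_expR.
    by apply: measurable_funM; [exact: measurable_cst|exact: measurable_supp_count].
  - have h := exp_count_integrable sigma_radon P_poisson tc (mulr_ge0 (ler0n R 2) (ltW M0)).
    have := integrableZl measurableT (expR `|\int[sigma]_x psi x| ^+ 2) h.
    by under eq_fun do rewrite -EFinM.
  - by move=> gam; rewrite sqabs_real -E -exprMn lexx.
by move=> gam; exact: charlier_bound_le.
Qed.

Lemma charlier_bound_ge0 chi psi gam : 0 <= charlier_bound chi psi gam.
Proof.
by rewrite mulr_ge0 ?expR_ge0// prodr_ge0// => x _; rewrite addr_ge0.
Qed.

End CharlierCoefficients.

(** * Linear spans of graphs and their closures in L^2 *)

Section GraphLinear.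
Context {R : realType}.

Lemma graph_spanD A B (G : (A -> R[i]) -> (B -> R[i]) -> Prop) v w v' w' :
  graph_span G v w -> graph_span G v' w' ->
  graph_span G (fun x => v x + v' x) (fun y => w y + w' y).
Proof.
move=> [k [c [vs [ws [Gv -> ->]]]]] [k' [c' [vs' [ws' [Gv' -> ->]]]]].
exists (k + k')%N, (fun j => match fintype.split j with inl i => c i | inr i => c' i end),
  (fun j => match fintype.split j with inl i => vs i | inr i => vs' i end),
  (fun j => match fintype.split j with inl i => ws i | inr i => ws' i end).
split=> [j||]; first by case: (fintype.split j).
  apply/funext => x; rewrite big_split_ord/=; congr (_ + _); apply: eq_bigr => i _.
    by rewrite (unsplitK (inl i)).
  by rewrite (unsplitK (inr i)).
apply/funext => x; rewrite big_split_ord/=; congr (_ + _); apply: eq_bigr => i _.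
  by rewrite (unsplitK (inl i)).
by rewrite (unsplitK (inr i)).
Qed.

Lemma graph_spanZ A B (G : (A -> R[i]) -> (B -> R[i]) -> Prop) (a : R[i]) v w :
  graph_span G v w -> graph_span G (fun x => a * v x) (fun y => a * w y).
Proof.
move=> [k [c [vs [ws [Gv -> ->]]]]]; exists k, (fun j => a * c j), vs, ws; split=> //.
  by apply/funext => x; rewrite mulr_sumr; apply: eq_bigr => j _; rewrite mulrA.
by apply/funext => x; rewrite mulr_sumr; apply: eq_bigr => j _; rewrite mulrA.
Qed.

Lemma graph_span_gen A B (G : (A -> R[i]) -> (B -> R[i]) -> Prop) v w :
  G v w -> graph_span G v w.
Proof.
move=> Gvw; exists 1%N, (fun=> 1), (fun=> v), (fun=> w); split=> //.
  by apply/funext => x; rewrite big_ord_recl big_ord0 addr0 mul1r.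
by apply/funext => x; rewrite big_ord_recl big_ord0 addr0 mul1r.
Qed.

Lemma graph_span_ind A B (G : (A -> R[i]) -> (B -> R[i]) -> Prop)
    (H : (A -> R[i]) -> (B -> R[i]) -> Prop) v w :
  H (fun=> 0) (fun=> 0) -> (forall a v w v' w', G v w -> H v' w' ->
     H (fun x => a * v x + v' x) (fun y => a * w y + w' y)) ->
  graph_span G v w -> H v w.
Proof.
move=> H0 HD [k [c [vs [ws [Gv -> ->]]]]]; elim: k c vs ws Gv => [|k IH] c vs ws Gv.
  rewrite (_ : (fun _ => _) = fun=> 0); last by apply/funext => x; rewrite big_ord0.
  by rewrite (_ : (fun _ : B => _) = fun=> 0)//; apply/funext => x; rewrite big_ord0.
rewrite (_ : (fun _ => _) = fun x => c ord0 * vs ord0 x +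
   \sum_(j < k) c (lift ord0 j) * vs (lift ord0 j) x); last first.
  by apply/funext => x; rewrite big_ord_recl.
rewrite (_ : (fun y : B => _) = fun x => c ord0 * ws ord0 x +
   \sum_(j < k) c (lift ord0 j) * ws (lift ord0 j) x); last first.
  by apply/funext => x; rewrite big_ord_recl.
apply: HD; first exact: Gv.
by apply: IH => j; exact: Gv.
Qed.

Context {disp : measure_display} {T : measurableType disp}.
Variable mu : {measure set T -> \bar R}.

Lemma sqdistD (u u' v v' : T -> R[i]) (e : R) :
  cmeasurable u -> cmeasurable u' -> cmeasurable v -> cmeasurable v' ->
  (sqdist (L2 mu) u u' <= (e / 4)%:E)%E -> (sqdist (L2 mu) v v' <= (e / 4)%:E)%E ->
  (sqdist (L2 mu) (fun x => u x + v x)%R (fun x => u' x + v' x)%R <= e%:E)%E.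
Proof.
move=> mu1 mu2 mv1 mv2 uu' vv'.
have E1 : sqdist (L2 mu) (fun x => u x + v x) (fun x => u' x + v x) = sqdist (L2 mu) u u'.
  by congr (sqnorm mu _); apply/funext => x; rewrite opprD addrACA subrr addr0.
have E2 : sqdist (L2 mu) (fun x => u' x + v x) (fun x => u' x + v' x) = sqdist (L2 mu) v v'.
  by congr (sqnorm mu _); apply/funext => x; rewrite opprD addrACA subrr add0r.
rewrite -E1 in uu'; rewrite -E2 in vv'.
by apply (sqdist_triangle2 (L2_quadratic mu) (cmeasurableD mu1 mv1)
  (cmeasurableD mu2 mv1) (cmeasurableD mu2 mv2) uu' vv').
Qed.

Lemma sqdistZ (a : R[i]) (u v : T -> R[i]) : cmeasurable u -> cmeasurable v ->
  sqdist (L2 mu) (fun x => a * u x) (fun x => a * v x) =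
  ((sqabs a)%:E * sqdist (L2 mu) u v)%E.
Proof.
move=> mu1 mv; rewrite -sqnormZ; last exact: cmeasurableB.
by congr (sqnorm mu _); apply/funext => x; rewrite mulrBr.
Qed.

End GraphLinear.

Section GraphClosureL2.
Context {R : realType} {d1 d2 : measure_display}.
Context {T1 : measurableType d1} {T2 : measurableType d2}.
Variables (mu : {measure set T1 -> \bar R}) (nu : {measure set T2 -> \bar R}).
Variable G : (T1 -> R[i]) -> (T2 -> R[i]) -> Prop.
Hypothesis G_cmeasurable : forall v w, G v w -> cmeasurable v /\ cmeasurable w.

Local Notation cl := (graph_closure (L2 mu) (L2 nu) (graph_span G)).

Lemma graph_span_cmeasurable v w : graph_span G v w -> cmeasurable v /\ cmeasurable w.
Proof.
apply: (graph_span_ind (H := fun v w => cmeasurable v /\ cmeasurable w)) => [|a v1 w1 v2 w2 /G_cmeasurable[m1 m2] [m3 m4]].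
  by split; exact: cmeasurable_cst.
by split; apply: cmeasurableD => //; exact: cmeasurableZ.
Qed.

Lemma L2_closureP v w : cl v w <->
  [/\ square_integrable mu v, square_integrable nu w & forall e : R, 0 < e ->
   exists v' w', [/\ graph_span G v' w', (sqdist (L2 mu) v' v <= e%:E)%E &
     (sqdist (L2 nu) w' w <= e%:E)%E]].
Proof. exact: graph_closureP (L2_quadratic mu) (L2_quadratic nu) _ _ _. Qed.

Lemma L2_closureD v w v' w' : cl v w -> cl v' w' ->
  cl (fun x => v x + v' x) (fun x => w x + w' x).
Proof.
move=> /L2_closureP[sv sw H] /L2_closureP[sv' sw' H']; apply/L2_closureP; split.
- exact: square_integrableD.
- exact: square_integrableD.
move=> e e0; have e4 : 0 < e / 4 by rewrite divr_gt0.
have [a [b [Gab ae be]]] := H _ e4; have [a' [b' [Gab' ae' be']]] := H' _ e4.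
have [ma mb] := graph_span_cmeasurable Gab; have [ma' mb'] := graph_span_cmeasurable Gab'.
have mv := square_integrable_measurable sv; have mv' := square_integrable_measurable sv'.
have mw := square_integrable_measurable sw; have mw' := square_integrable_measurable sw'.
exists (fun x => a x + a' x), (fun x => b x + b' x); split.
- exact: graph_spanD.
- exact: sqdistD.
- exact: sqdistD.
Qed.

Lemma L2_closureZ (c : R[i]) v w : cl v w -> cl (fun x => c * v x) (fun x => c * w x).
Proof.
move=> /L2_closureP[sv sw H]; apply/L2_closureP; split.
- exact: square_integrableZ.
- exact: square_integrableZ.
move=> e e0; have c1 : 0 < sqabs c + 1 by rewrite ltr_wpDl ?sqabs_ge0.
have ec : 0 < e / (sqabs c + 1) by rewrite divr_gt0.
have [a [b [Gab ae be]]] := H _ ec; have [ma mb] := graph_span_cmeasurable Gab.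
have bnd : ((sqabs c)%:E * (e / (sqabs c + 1))%:E <= e%:E)%E.
  rewrite -EFinM lee_fin mulrCA -[leRHS]mulr1; apply: ler_wpM2l; first exact: ltW.
  by rewrite ler_pdivrMr// mul1r lerDl.
exists (fun x => c * a x), (fun x => c * b x); split; first exact: graph_spanZ.
- rewrite sqdistZ//; last exact: square_integrable_measurable sv.
  by apply: le_trans bnd; rewrite lee_wpmul2l// lee_fin sqabs_ge0.
- rewrite sqdistZ//; last exact: square_integrable_measurable sw.
  by apply: le_trans bnd; rewrite lee_wpmul2l// lee_fin sqabs_ge0.
Qed.

Lemma L2_closure0 : cl (fun=> 0) (fun=> 0).
Proof.
apply/L2_closureP; split; [exact: square_integrable0|exact: square_integrable0|].
move=> e e0; exists (fun=> 0), (fun=> 0); split.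
- exists 0%N, (fun=> 0), (fun=> fun=> 0), (fun=> fun=> 0); split; first by case.
    by apply/funext => x; rewrite big_ord0.
  by apply/funext => x; rewrite big_ord0.
- by rewrite (sqdistxx (L2_quadratic mu)) lee_fin ltW.
- by rewrite (sqdistxx (L2_quadratic nu)) lee_fin ltW.
Qed.

Lemma L2_closure_sum I (r : seq I) (v : I -> T1 -> R[i]) (w : I -> T2 -> R[i]) :
  (forall i, cl (v i) (w i)) ->
  cl (fun x => \sum_(i <- r) v i x) (fun x => \sum_(i <- r) w i x).
Proof.
move=> H; elim: r => [|i r IH].
  under eq_fun do rewrite big_nil; under [X in graph_closure _ _ _ _ X]eq_fun do rewrite big_nil.
  exact: L2_closure0.
under eq_fun do rewrite big_cons; under [X in graph_closure _ _ _ _ X]eq_fun do rewrite big_cons.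
exact: L2_closureD.
Qed.

Lemma L2_closure_gen v w : square_integrable mu v -> square_integrable nu w ->
  G v w -> cl v w.
Proof.
move=> sv sw Gvw; apply/L2_closureP; split=> // e e0; exists v, w; split.
- exact: graph_span_gen.
- by rewrite (sqdistxx (L2_quadratic mu)) lee_fin ltW.
- by rewrite (sqdistxx (L2_quadratic nu)) lee_fin ltW.
Qed.

Lemma L2_closure_lim v w : square_integrable mu v -> square_integrable nu w ->
  (forall e : R, 0 < e -> exists v' w', [/\ cl v' w', (sqdist (L2 mu) v' v <= e%:E)%E &
     (sqdist (L2 nu) w' w <= e%:E)%E]) -> cl v w.
Proof.
move=> sv sw; apply: (graph_closure_lim (L2_quadratic mu) (L2_quadratic nu)) => //.
- by move=> u; exact: square_integrable_measurable.
- by move=> u; exact: square_integrable_measurable.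
- exact: graph_span_cmeasurable.
Qed.

Lemma L2_closure_cvg (u : nat -> T1 -> R[i]) (w : nat -> T2 -> R[i]) u' w' :
  (forall k, cl (u k) (w k)) -> square_integrable mu u' -> square_integrable nu w' ->
  l2cvg (L2 mu) u u' -> l2cvg (L2 nu) w w' -> cl u' w'.
Proof.
move=> H su sw /(l2cvgP (L2_quadratic mu)) cu /(l2cvgP (L2_quadratic nu)) cw.
apply: L2_closure_lim => // e e0; have [K1 H1] := cu e e0; have [K2 H2] := cw e e0.
exists (u (maxn K1 K2)), (w (maxn K1 K2)); split=> //.
  by apply: H1; rewrite leq_maxl.
by apply: H2; rewrite leq_maxr.
Qed.

End GraphClosureL2.

(** * Termwise integration and orthogonality of the Charlier kernels *)

Section ProductIntegrals.
Context {disp : measure_display} {T : measurableType disp} {R : realType}.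
Variable mu : {measure set T -> \bar R}.

Lemma Rintegral_sum I (r : seq I) (f : I -> T -> R) :
  (forall k, mu.-integrable setT (EFin \o f k)) ->
  \int[mu]_x (\sum_(k <- r) f k x) = \sum_(k <- r) \int[mu]_x f k x.
Proof.
move=> fi; have sumi s : mu.-integrable setT (EFin \o (fun x => \sum_(k <- s) f k x)).
  rewrite (_ : EFin \o _ = fun x => (\sum_(k <- s) (EFin \o f k) x)%E); last first.
    by apply/funext => x /=; rewrite sumEFin.
  by apply: (integrable_sum measurableT) => k _; exact: fi.
elim: r => [|k r IH].
  by rewrite big_nil; under eq_Rintegral do rewrite big_nil; rewrite Rintegral_cst// mul0r.
rewrite big_cons -IH -RintegralD//.
by apply: eq_Rintegral => x _; rewrite big_cons.
Qed.

(** Dominated convergence: the partial sums are bounded by [G], and [G * Y] is integrable as a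
    product of square integrable functions. Identities between generating functions thereby become
    identities between coefficients. *)
Lemma Rintegral_pseries (a : nat -> T -> R) (f : T -> R) (G Y : T -> R) t :
  (forall n, square_integrable mu (fun x => (a n x)%:C%C)) ->
  square_integrable mu (fun x => (G x)%:C%C) ->
  square_integrable mu (fun x => (Y x)%:C%C) ->
  (forall x, series (fun n => a n x * t ^+ n) @ \oo --> f x) ->
  (forall n x, `|\sum_(k < n) a k x * t ^+ k| <= G x) ->
  series (fun n => (\int[mu]_x (a n x * Y x)) * t ^+ n) @ \oo --> \int[mu]_x (f x * Y x).
Proof.
move=> sa sG sY af aG.
have iaY n : mu.-integrable setT (EFin \o (fun x => a n x * t ^+ n * Y x)).
  have h := integrableZl measurableT (t ^+ n) (integrable_prod_square (sa n) sY).
  by move: h; under eq_fun do rewrite -EFinM mulrA [t ^+ n * _]mulrC.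
pose u n x := (\sum_(0 <= k < n) a k x * t ^+ k) * Y x.
have mu_ k : measurable_fun setT (u k).
  apply: measurable_funM; last by case: sY.
  by apply: measurable_sum => n; apply: measurable_funM => //; case: (sa n).
have uf x : (u ^~ x) @ \oo --> f x * Y x.
  by apply: cvgM; [exact: af|exact: cvg_cst].
have uG k x : `|u k x| <= `|G x * Y x|.
  rewrite /u !normrM ler_wpM2r// big_mkord.
  by apply: le_trans (aG k x) _; exact: ler_norm.
have [_] := Rintegral_dominated mu_ uf uG (integrable_norm (integrable_prod_square sG sY)).
apply: cvg_trans; apply: near_eq_cvg; apply: nearW => n /=.
rewrite /u; under eq_Rintegral do rewrite mulr_suml.
rewrite Rintegral_sum// /series/=; apply: eq_bigr => k _.
rewrite -RintegralZr//; last exact: integrable_prod_square.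
by apply: eq_Rintegral => x _; ring.
Qed.

End ProductIntegrals.

Section WickGraph.
Context {R : realType} {d : nat}.
Variable sigma : {measure set (Rd R d) -> \bar R}.
Hypothesis sigma_radon : radon sigma.
Variable P : probability (Gamma R d) R.
Hypothesis P_poisson : is_poisson sigma P.
Variable C : forall n, config R d -> (n.-tuple (Rd R d) -> R) -> R.
Hypothesis C_charlier : charlier_kernels sigma C.
Implicit Types (gam : Gamma R d) (psi : 'rV[R]_d -> R).

Local Notation coef := (charlier_coef C).

Lemma wick_square_integrable psi : test_function psi -> (forall x, -1 < psi x) ->
  square_integrable P (fun gam => (wick sigma psi gam)%:C%C).
Proof.
move=> tp p1; apply/square_integrableP; split.
  by apply: cmeasurable_real; exact: measurable_wick.
rewrite /sqnorm/=; under eq_integral do rewrite expr0n addr0 expr2.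
by rewrite wick_moment// ltry.
Qed.

Lemma charlier_coef_bound n psi gam : test_function psi ->
  `|coef n psi gam| <= charlier_bound sigma psi psi gam.
Proof.
move=> tp; have [_ /(_ n.+1)] := charlier_coef_rep sigma_radon C_charlier gam tp tp (fun x h => h).
by apply: le_trans; rewrite big_ord_recr/= lerDr sumr_ge0.
Qed.

Lemma charlier_coef_square_integrable n psi : test_function psi ->
  square_integrable P (fun gam => (coef n psi gam)%:C%C).
Proof.
move=> tp; have [G sG bG] := charlier_bound_square_integrable sigma_radon P_poisson tp tp.
apply: (square_integrable_le (G := fun gam => G gam * G gam)).
- by apply: cmeasurable_real; apply: (measurable_charlier_coef sigma_radon C_charlier).
- exact: integrable_prod_square.
- move=> gam; rewrite sqabs_real -real_normK ?num_real// expr2.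
  have h := le_trans (charlier_coef_bound n gam tp) (bG gam).
  by apply: ler_pM.
Qed.

Lemma small_radius psi : test_function psi -> exists2 e : R, 0 < e <= 1 &
  forall t, 0 < t < e -> forall x, -1 < t * psi x.
Proof.
move=> tp; have [M M0 pM] := test_bounded tp.
exists (Num.min 1 M^-1); first by rewrite lt_min ltr01 invr_gt0 M0 ge_min lexx.
move=> t /andP[t0]; rewrite lt_min => /andP[_ tM].
by apply: (small_perturbation pM) => //; rewrite -ltr_pdivlMr// div1r.
Qed.

Lemma charlier_coef_series psi t gam : test_function psi -> (forall x, -1 < t * psi x) ->
  series (fun n => coef n psi gam * t ^+ n) @ \oo --> wick sigma (fun x => t * psi x) gam.
Proof.
move=> tp t1; have [h _] := charlier_coef_rep sigma_radon C_charlier gam tp tp (fun x h => h).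
by rewrite -(charlier_sum_wick sigma_radon (chi := psi)).
Qed.

Lemma charlier_coef_partial psi t n gam : test_function psi -> `|t| <= 1 ->
  `|\sum_(k < n) coef k psi gam * t ^+ k| <= charlier_bound sigma psi psi gam.
Proof.
move=> tp t1; have rep := charlier_coef_rep sigma_radon C_charlier gam tp tp (fun x h => h).
exact: pseries_rep_partial rep t1.
Qed.

Lemma exp_series (x t : R) :
  series (fun n => x ^+ n / n`!%:R * t ^+ n) @ \oo --> expR (t * x).
Proof.
rewrite (_ : (fun n => _) = exp_coeff (t * x)).
  by rewrite /expR; exact: is_cvg_series_exp_coeff.
by apply/funext => n; rewrite exp_coeffE exprMn; ring.
Qed.

(** For fixed [t], both sides are the coefficients of [s ^+ n] in the integral of the Wick
    exponentials of [s psi] and [t psi']. The two parameters are expanded one after the other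
    because coefficients are compared in one variable. *)
Lemma wick_charlier_coef psi psi' t n : test_function psi -> test_function psi' ->
  (forall x, -1 < t * psi' x) ->
  \int[P]_gam (coef n psi gam * wick sigma (fun x => t * psi' x) gam) =
  (\int[sigma]_x (psi x * psi' x)) ^+ n / n`!%:R * t ^+ n.
Proof.
move=> tp tp' t1; pose q := \int[sigma]_x (psi x * psi' x).
have [e /andP[e0 e1] He] := small_radius tp.
have [G sG bG] := charlier_bound_square_integrable sigma_radon P_poisson tp tp.
have ttp' := testZ t tp'.
have sw := wick_square_integrable ttp' t1.
have -> : q ^+ n / n`!%:R * t ^+ n = (t * q) ^+ n / n`!%:R by rewrite exprMn; ring.
move: n; apply: (pseries_inj e0 (f := fun s => expR (s * (t * q)))) => s; last first.
  by move=> _; exact: exp_series.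
move=> /[dup] /He s1 /andP[s0 se].
have -> : expR (s * (t * q)) = \int[P]_gam (wick sigma (fun x => s * psi x) gam *
    wick sigma (fun x => t * psi' x) gam).
  rewrite /Rintegral wick_moment//; last exact: testZ.
  congr expR; rewrite /q mulrA -RintegralZl//; first by apply: eq_Rintegral => x _; ring.
  by apply: (integrable_test sigma_radon); apply: testM => //; case: tp.
apply: (Rintegral_pseries (G := G)) => //.
- by move=> k; exact: charlier_coef_square_integrable.
- by move=> gam; exact: charlier_coef_series.
- move=> k gam; apply: le_trans (bG gam); apply: charlier_coef_partial => //.
  by rewrite gtr0_norm// ltW// (lt_le_trans se).
Qed.

Lemma charlier_coef_orthogonal psi psi' n m : test_function psi -> test_function psi' ->
  \int[P]_gam (coef n psi gam * coef m psi' gam) =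
  if n == m then (\int[sigma]_x (psi x * psi' x)) ^+ n / n`!%:R else 0.
Proof.
move=> tp tp'; pose q := \int[sigma]_x (psi x * psi' x).
have [e /andP[e0 e1] He] := small_radius tp'.
have [G sG bG] := charlier_bound_square_integrable sigma_radon P_poisson tp' tp'.
move: m; apply: (pseries_inj e0 (f := fun s => q ^+ n / n`!%:R * s ^+ n)) => t.
  move=> /[dup] /He t1 /andP[t0 te]; rewrite -wick_charlier_coef//.
  under eq_fun do (under eq_Rintegral do rewrite mulrC).
  under eq_Rintegral do rewrite mulrC.
  apply: (Rintegral_pseries (G := G)) => //.
  - by move=> k; exact: charlier_coef_square_integrable.
  - exact: charlier_coef_square_integrable.
  - by move=> gam; exact: charlier_coef_series.
  - move=> k gam; apply: le_trans (bG gam); apply: charlier_coef_partial => //.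
    by rewrite gtr0_norm// ltW// (lt_le_trans te).
(* Only the term of index [n] is nonzero, so the partial sums are constant from [n.+1] on. *)
move=> _; rewrite -(cvg_shiftn n.+1); apply: cvg_near_cst; apply: nearW => k.
rewrite /series/= (bigD1_seq n) ?iota_uniq ?mem_index_iota ?addnS ?ltnS ?leq_addl//=.
rewrite eqxx big1 ?addr0// => i; rewrite eq_sym => /negPf ->; exact: mul0r.
Qed.

End WickGraph.

(** * The closure of the exponential graph *)

Section RealComplex.
Context {R : realType}.

Lemma real_complexM (x y : R) : (x * y)%:C%C = x%:C%C * y%:C%C :> R[i].
Proof. exact: rmorphM. Qed.

Lemma real_complexD (x y : R) : (x + y)%:C%C = x%:C%C + y%:C%C :> R[i].
Proof. exact: rmorphD. Qed.

Lemma real_complex_sum I (r : seq I) (f : I -> R) :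
  (\sum_(i <- r) f i)%:C%C = \sum_(i <- r) (f i)%:C%C :> R[i].
Proof. exact: rmorph_sum. Qed.

End RealComplex.

Section PowerSeriesShift.
Context {R : realType}.

(** The scalar [(phi, t psi)] is linear in [t], and the extra factor [t] shifts the coefficients by
    one: this is how the derivative lowers the degree. *)
Lemma pseries_rep_shift (a : nat -> R) f G (q : R) : pseries_rep a f G ->
  pseries_rep (fun n => q * (if n is k.+1 then a k else 0)) (fun t => t * q * f t) (`|q| * G).
Proof.
move=> [af aG]; split=> [t|n].
  rewrite -cvg_shiftS.
  have E n : series (fun n => q * (if n is k.+1 then a k else 0) * t ^+ n) n.+1 =
      t * q * series (fun n => a n * t ^+ n) n.
    rewrite /series/= big_nat_recl//= mulr0 mul0r add0r mulr_sumr.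
    by apply: eq_bigr => k _; rewrite exprS; ring.
  by under eq_fun do rewrite E; apply: cvgM; [exact: cvg_cst|exact: af].
under eq_bigr do rewrite normrM; rewrite -mulr_sumr ler_wpM2l//.
case: n => [|n]; first by rewrite big_ord0; have := aG 0%N; rewrite big_ord0.
by rewrite big_ord_recl/= normr0 add0r aG.
Qed.

Lemma pseries_rep_quotient (a : nat -> R) f G t n : pseries_rep a f G -> 0 < t <= 1 ->
  `|(f t - \sum_(k < n) a k * t ^+ k) / t ^+ n| <= G.
Proof.
move=> rep /andP[t0 t1]; have tn : 0 < t ^+ n by rewrite exprn_gt0.
rewrite normrM normfV (gtr0_norm tn) ler_pdivrMr// mulrC.
by apply: pseries_rep_remainder => //; rewrite ltW.
Qed.

End PowerSeriesShift.

Section WickClosure.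
Context {R : realType} {d : nat}.
Variable sigma : {measure set (Rd R d) -> \bar R}.
Hypothesis sigma_radon : radon sigma.
Variable P : probability (Gamma R d) R.
Hypothesis P_poisson : is_poisson sigma P.
Variable phi : 'rV[R]_d -> R.
Hypothesis phi_test : test_function phi.
Implicit Types (gam : Gamma R d) (psi : 'rV[R]_d -> R).

(* On the exponential vectors both operators of the theorem act as
   multiplication by [(phi, psi)]; the theorem amounts to both having the
   closure of this graph as their graph. *)
Definition wick_graph (F G : Gamma R d -> R[i]) :=
  exists psi, [/\ test_function psi, forall x, -1 < psi x,
    F = (fun gam => (wick sigma psi gam)%:C%C) &
    G = (fun gam => (\int[sigma]_x (phi x * psi x) * wick sigma psi gam)%:C%C)].

Definition wick_closure := graph_closure (L2 P) (L2 P) (graph_span wick_graph).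

Lemma wick_graph_cmeasurable F G : wick_graph F G -> cmeasurable F /\ cmeasurable G.
Proof.
move=> [psi [tp p1 -> ->]]; have m := measurable_wick sigma tp p1.
split; apply: cmeasurable_real; first exact: m.
by apply: measurable_funM; [exact: measurable_cst|exact: m].
Qed.

Lemma wick_closure_wick psi : test_function psi -> (forall x, -1 < psi x) ->
  wick_closure (fun gam => (wick sigma psi gam)%:C%C)
    (fun gam => (\int[sigma]_x (phi x * psi x) * wick sigma psi gam)%:C%C).
Proof.
move=> tp p1; have sw := wick_square_integrable sigma_radon P_poisson tp p1.
apply: L2_closure_gen => //; last by exists psi.
by under eq_fun do rewrite rmorphM; exact: square_integrableZ.
Qed.

Lemma wick_closure_dominated (u w : nat -> Gamma R d -> R) (u' w' G : Gamma R d -> R) :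
  (forall k, wick_closure (fun gam => (u k gam)%:C%C) (fun gam => (w k gam)%:C%C)) ->
  (forall gam, (u ^~ gam) @ \oo --> u' gam) -> (forall gam, (w ^~ gam) @ \oo --> w' gam) ->
  (forall k gam, `|u k gam| <= G gam) -> (forall k gam, `|w k gam| <= G gam) ->
  square_integrable P (fun gam => (G gam)%:C%C) ->
  wick_closure (fun gam => (u' gam)%:C%C) (fun gam => (w' gam)%:C%C).
Proof.
move=> H cu cw uG wG sG.
have iG := integrable_prod_square sG sG.
have dom (v : nat -> Gamma R d -> R) (v' : Gamma R d -> R) : (forall k, cmeasurable (fun gam => (v k gam)%:C%C)) ->
    (forall gam, (v ^~ gam) @ \oo --> v' gam) -> (forall k gam, `|v k gam| <= G gam) ->
    square_integrable P (fun gam => (v' gam)%:C%C) /\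
    l2cvg (L2 P) (fun k gam => (v k gam)%:C%C) (fun gam => (v' gam)%:C%C).
  move=> mv cv vG; apply: (L2_dominated (G := fun gam => G gam * G gam)) => //.
  - by move=> gam /=; exact: cvg_cst.
  - move=> k gam; rewrite sqabs_real -real_normK ?num_real// expr2.
    by apply: ler_pM.
have mv k : cmeasurable (fun gam => (u k gam)%:C%C).
  by case: (H k) => m _ _; exact: square_integrable_measurable m.
have mw k : cmeasurable (fun gam => (w k gam)%:C%C).
  by case: (H k) => _ m _; exact: square_integrable_measurable m.
have [su lu] := dom _ _ mv cu uG; have [sw lw] := dom _ _ mw cw wG.
exact: (L2_closure_cvg wick_graph_cmeasurable H su sw lu lw).
Qed.

Variable C : forall n, config R d -> (n.-tuple (Rd R d) -> R) -> R.
Hypothesis C_charlier : charlier_kernels sigma C.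

Lemma wick_closure_charlier n psi : test_function psi ->
  wick_closure (fun gam => (charlier_coef C n psi gam)%:C%C)
    (fun gam => (\int[sigma]_x (phi x * psi x) *
       (if n is k.+1 then charlier_coef C k psi gam else 0))%:C%C).
Proof.
move=> tp; pose q := \int[sigma]_x (phi x * psi x).
pose a k gam := charlier_coef C k psi gam.
pose b k gam := q * (if k is l.+1 then charlier_coef C l psi gam else 0).
pose f gam t := charlier_sum sigma psi psi gam t.
have ra gam : pseries_rep (a ^~ gam) (f gam) (charlier_bound sigma psi psi gam).
  exact: (charlier_coef_rep sigma_radon C_charlier gam tp tp (fun x h => h)).
have rb gam : pseries_rep (b ^~ gam) (fun t => t * q * f gam t)
    (`|q| * charlier_bound sigma psi psi gam) by exact: (pseries_rep_shift q (ra gam)).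
have [G sG bG] := charlier_bound_square_integrable sigma_radon P_poisson tp tp.
have [e /andP[e0 e1] He] := small_radius tp.
pose t (j : nat) : R := e / 2 * j.+1%:R^-1.
have t0 j : 0 < t j by rewrite !mulr_gt0 ?invr_gt0.
have te j : t j < e.
  apply: le_lt_trans (_ : e / 2 < e); last by rewrite ltr_pdivrMr// ltr_pMr// ltr1n.
  by apply: ler_piMr; [rewrite divr_ge0// ltW|rewrite invf_le1// ler1n].
have t01 j : 0 < t j <= 1 by rewrite t0 (le_trans (ltW (te j))).
have tlim : t @ \oo --> 0.
  rewrite -(mulr0 (e / 2)); apply: cvgM; first exact: cvg_cst.
  exact: cvg_harmonic.
elim/ltn_ind: n => n IH.
(* Divided remainders of the two generating functions. They form pairs in the closure by linearity
   and the induction hypothesis, and [(1 + |q|) * G] majorizes both uniformly in [j]. *)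
apply: (wick_closure_dominated (G := fun gam => (1 + `|q|) * G gam)
  (u := fun j gam => (f gam (t j) - \sum_(k < n) a k gam * t j ^+ k) / t j ^+ n)
  (w := fun j gam => (t j * q * f gam (t j) - \sum_(k < n) b k gam * t j ^+ k) / t j ^+ n)).
- move=> j; have tj : 0 < t j < e by rewrite t0 te.
  have h0 := wick_closure_wick (testZ (t j) tp) (He _ tj).
  have -> : (fun gam => ((f gam (t j) - \sum_(k < n) a k gam * t j ^+ k) / t j ^+ n)%:C%C) =
    (fun gam => ((t j ^+ n)^-1)%:C%C * ((wick sigma (fun x => t j * psi x) gam)%:C%C +
       \sum_(k < n) (- t j ^+ k)%:C%C * (a k gam)%:C%C)).
    apply/funext => gam; rewrite /f charlier_sum_wick//; last exact: He.
    under [in RHS]eq_bigr do rewrite -real_complexM; rewrite -real_complex_sum -real_complexD -real_complexM.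
    congr (_%:C)%C; rewrite mulrC; congr (_ * (_ + _)).
    by rewrite -sumrN; apply: eq_bigr => k _; rewrite mulNr mulrC.
  have -> : (fun gam => ((t j * q * f gam (t j) - \sum_(k < n) b k gam * t j ^+ k)
       / t j ^+ n)%:C%C) =
    (fun gam => ((t j ^+ n)^-1)%:C%C * ((\int[sigma]_x (phi x * (t j * psi x)) *
       wick sigma (fun x => t j * psi x) gam)%:C%C +
       \sum_(k < n) (- t j ^+ k)%:C%C * (b k gam)%:C%C)).
    apply/funext => gam; rewrite /f charlier_sum_wick//; last exact: He.
    under [in RHS]eq_bigr do rewrite -real_complexM; rewrite -real_complex_sum -real_complexD -real_complexM.
    congr (_%:C)%C; rewrite mulrC; congr (_ * (_ + _)).
      congr (_ * _); rewrite /q -RintegralZl//; first by apply: eq_Rintegral => x _; ring.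
      by apply: (integrable_test sigma_radon); apply: testM => //; case: phi_test.
    by rewrite -sumrN; apply: eq_bigr => k _; rewrite mulNr mulrC.
  apply: (L2_closureZ wick_graph_cmeasurable); apply: (L2_closureD wick_graph_cmeasurable) => //.
  apply: (L2_closure_sum wick_graph_cmeasurable) => k.
  by apply: (L2_closureZ wick_graph_cmeasurable); exact: IH.
- by move=> gam; exact: (pseries_rep_coefficient (ra gam) t01 tlim).
- by move=> gam; exact: (pseries_rep_coefficient (rb gam) t01 tlim).
- move=> j gam; apply: le_trans (pseries_rep_quotient n (ra gam) (t01 j)) _.
  have bg := bG gam; have b0 := charlier_bound_ge0 sigma psi psi gam.
  by rewrite mulrDl mul1r; have := normr_ge0 q; nra.
- move=> j gam; apply: le_trans (pseries_rep_quotient n (rb gam) (t01 j)) _.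
  have bg := bG gam; have b0 := charlier_bound_ge0 sigma psi psi gam.
  by rewrite mulrDl mul1r; have := normr_ge0 q; nra.
- by under eq_fun do rewrite rmorphM; exact: square_integrableZ.
Qed.

End WickClosure.

(** * Cylinder functions *)

Section CylinderClass.
Context {R : realType} {d : nat}.
Variable sigma : {measure set (Rd R d) -> \bar R}.
Hypothesis sigma_radon : radon sigma.
Variable P : probability (Gamma R d) R.
Hypothesis P_poisson : is_poisson sigma P.
Variable phi : 'rV[R]_d -> R.
Hypothesis phi_test : test_function phi.
Variables (N : nat) (phis : 'I_N -> 'rV[R]_d -> R).
Hypothesis phis_test : forall i, test_function (phis i).
Implicit Types (gam : Gamma R d) (y : 'rV[R]_N) (f : 'rV[R]_N -> R) (F : 'rV[R]_N -> R[i]).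

Definition pairings gam : 'rV[R]_N := \row_i pairing gam (phis i).

Definition shifts (x : Rd R d) : 'rV[R]_N := \row_i phis i x.

Definition norm1 y : R := \sum_i `|y 0 i|.

(** The derivative in the coordinates given by the pairings: adding a new point [x] to a
    configuration translates [pairings] by [shifts x]. *)
Definition nabla_real f y : R := \int[sigma]_x ((f (y + shifts x) - f y) * phi x).

Definition nabla F gam : R[i] :=
  Complex (nabla_real (fun y => complex.Re (F y)) (pairings gam))
    (nabla_real (fun y => complex.Im (F y)) (pairings gam)).

Lemma norm1D y z : norm1 (y + z) <= norm1 y + norm1 z.
Proof.
by rewrite /norm1 -big_split/=; apply: ler_sum => i _; rewrite mxE ler_normD.
Qed.

Lemma norm1_ge0 y : 0 <= norm1 y.
Proof. exact: sumr_ge0. Qed.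

Lemma phis_bounded : exists2 L : R, 0 <= L & forall x, \sum_i `|phis i x| <= L.
Proof.
have /choice[M HM] : forall i, exists M : R, 0 <= M /\ forall x, `|phis i x| <= M.
  by move=> i; have [M M0 h] := test_bounded (phis_test i); exists M; split => //; exact: ltW.
exists (\sum_i M i); first by apply: sumr_ge0 => i _; case: (HM i).
by move=> x; apply: ler_sum => i _; case: (HM i).
Qed.

Lemma pairings_bound (L : R) gam : (forall x, \sum_i `|phis i x| <= L) ->
  norm1 (pairings gam) <= L * (supp_count (square_sum phis) gam)%:R.
Proof.
move=> HL; have tc := test_square_sum phis_test.
apply: (@le_trans _ _ (\sum_i \sum_(x <- supp_points (square_sum phis) gam) `|phis i x|)).
  apply: ler_sum => i _; rewrite mxE (pairing_supp _ tc); first exact: ler_norm_sum.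
  by move=> x; exact: square_sum_eq0.
rewrite exchange_big/=; apply: le_trans (ler_sum _ (fun x _ => HL x)) _.
by rewrite big_const_seq count_predT iter_addr_0 mulr_natr.
Qed.

(** This growth stays square integrable along [pairings], whose [norm1] is at most linear in the
    number of points, and [nabla_real] preserves it with the same exponent [c], since translation by
    [shifts x] costs a bounded factor. *)
Definition exp_bounded (K c : R) f := forall y, `|f y| <= K * expR (c * norm1 y).

Lemma exp_bounded_ge0 K c f : exp_bounded K c f -> 0 <= K.
Proof.
by move=> /(_ 0) /(le_trans (normr_ge0 _)); rewrite pmulr_lge0// expR_gt0.
Qed.

Lemma nabla_integrand_bound K c L f y x : 0 <= c -> (forall x, \sum_i `|phis i x| <= L) ->
  exp_bounded K c f ->
  `|(f (y + shifts x) - f y) * phi x| <= (2 * K * expR (c * L) * expR (c * norm1 y)) * `|phi x|.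
Proof.
move=> c0 HL fK; have K0 := exp_bounded_ge0 fK; rewrite normrM ler_wpM2r//.
apply: le_trans (ler_normB _ _) _.
have L0 : 0 <= L by apply: le_trans (HL x); exact: sumr_ge0.
have h1 : `|f (y + shifts x)| <= K * (expR (c * L) * expR (c * norm1 y)).
  apply: le_trans (fK _) _; rewrite ler_wpM2l// -expRD ler_expR -mulrDr ler_wpM2l//.
  apply: le_trans (norm1D _ _) _; rewrite addrC lerD2r.
  by rewrite /norm1; under eq_bigr do rewrite mxE; exact: HL.
have h2 : `|f y| <= K * (expR (c * L) * expR (c * norm1 y)).
  apply: le_trans (fK _) _; rewrite ler_wpM2l// ler_peMl ?expR_ge0//.
  by rewrite -expR0 ler_expR mulr_ge0.
by lra.
Qed.

Lemma nabla_integrable K c f y : 0 <= c -> exp_bounded K c f ->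
  measurable_fun setT (fun x => f (y + shifts x)) ->
  sigma.-integrable setT (EFin \o (fun x => (f (y + shifts x) - f y) * phi x)).
Proof.
move=> c0 fK mf; have [L L0 HL] := phis_bounded.
have [M M0 phiM] := test_bounded phi_test.
have K0 := exp_bounded_ge0 fK.
apply: (integrable_supp sigma_radon phi_test
  (M := 2 * K * expR (c * L) * expR (c * norm1 y) * M)).
- apply: measurable_funM; last by apply: continuous_measurable_Rd; exact: test_continuous.
  by apply: measurable_funB => //; exact: measurable_cst.
- move=> x; apply: le_trans (nabla_integrand_bound _ _ c0 HL fK) _.
  by rewrite ler_wpM2l// !mulr_ge0// expR_ge0.
- by move=> x ->; rewrite mulr0.
Qed.

Lemma nabla_real_bound K c L f y : 0 <= c -> (forall x, \sum_i `|phis i x| <= L) ->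
  exp_bounded K c f -> measurable_fun setT (fun x => f (y + shifts x)) ->
  `|nabla_real f y| <= 2 * expR (c * L) * (\int[sigma]_x `|phi x|) * (K * expR (c * norm1 y)).
Proof.
move=> c0 HL fK mf; have iN := integrable_norm (integrable_test sigma_radon phi_test).
apply: le_trans (le_normr_Rintegral measurableT (nabla_integrable c0 fK mf)) _.
rewrite (_ : _ * (K * _) = 2 * K * expR (c * L) * expR (c * norm1 y) * \int[sigma]_x `|phi x|);
  last by ring.
rewrite -RintegralZl//; apply: le_Rintegral => //.
- exact: (integrable_norm (nabla_integrable c0 fK mf)).
- have := integrableZl measurableT (2 * K * expR (c * L) * expR (c * norm1 y)) iN.
  by under eq_fun do rewrite -EFinM.
- by move=> x _; exact: nabla_integrand_bound.
Qed.

Lemma nabla_real_cvg K c (f_ : nat -> 'rV[R]_N -> R) f y : 0 <= c ->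
  (forall k, exp_bounded K c (f_ k)) ->
  (forall k, measurable_fun setT (fun x => f_ k (y + shifts x))) ->
  (forall y, (f_ ^~ y) @ \oo --> f y) ->
  (fun k => nabla_real (f_ k) y) @ \oo --> nabla_real f y.
Proof.
move=> c0 fK mf ff; have [L L0 HL] := phis_bounded.
have iN := integrable_norm (integrable_test sigma_radon phi_test).
have iG := integrableZl measurableT (2 * K * expR (c * L) * expR (c * norm1 y)) iN.
have mu_ k : measurable_fun setT (fun x => (f_ k (y + shifts x) - f_ k y) * phi x).
  apply: measurable_funM.
    by apply: measurable_funB => //; exact: measurable_cst.
  by apply: continuous_measurable_Rd; exact: test_continuous.
have uf x : (fun k => (f_ k (y + shifts x) - f_ k y) * phi x) @ \oo -->
    (f (y + shifts x) - f y) * phi x.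
  by apply: cvgM; [apply: cvgB; exact: ff|exact: cvg_cst].
have [_] := Rintegral_dominated mu_ uf (fun k x => nabla_integrand_bound y x c0 HL (fK k)) iG.
exact.
Qed.

Definition cexp_bounded K c F :=
  exp_bounded K c (fun y => complex.Re (F y)) /\ exp_bounded K c (fun y => complex.Im (F y)).

(** Measurability is asked along the slices integrated by [nabla_real]; it passes to pointwise
    limits without a sigma-algebra on the row vectors. *)
Definition slice_measurable F := forall y, cmeasurable (fun x => F (y + shifts x)).

Definition ccvg T (F_ : nat -> T -> R[i]) (F : T -> R[i]) := forall t,
  (fun k => complex.Re (F_ k t)) @ \oo --> complex.Re (F t) /\
  (fun k => complex.Im (F_ k t)) @ \oo --> complex.Im (F t).

Lemma ccvg_cmeasurable disp (T : measurableType disp) (F_ : nat -> T -> R[i]) (F : T -> R[i]) :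
  (forall k, cmeasurable (F_ k)) -> ccvg F_ F -> cmeasurable F.
Proof.
move=> mF cF; split.
  by apply: (measurable_fun_cvg (fun k => (mF k).1)) => y _; case: (cF y).
by apply: (measurable_fun_cvg (fun k => (mF k).2)) => y _; case: (cF y).
Qed.

(** Dominated convergence is used twice: over [sigma], with a majorant proportional to [|phi|], for
    the values of [nabla (F_ k)] at each configuration; then over [P], with an exponential of the
    count, for the limits in L^2. *)
Lemma nabla_dominated K c (F_ : nat -> 'rV[R]_N -> R[i]) F : 0 <= c ->
  (forall k, cexp_bounded K c (F_ k)) -> (forall k, slice_measurable (F_ k)) ->
  (forall k, cmeasurable (fun gam => F_ k (pairings gam))) ->
  (forall k, cmeasurable (nabla (F_ k))) -> ccvg F_ F ->
  [/\ square_integrable P (fun gam => F (pairings gam)), square_integrable P (nabla F),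
    l2cvg (L2 P) (fun k gam => F_ k (pairings gam)) (fun gam => F (pairings gam)) &
    l2cvg (L2 P) (fun k => nabla (F_ k)) (nabla F)].
Proof.
move=> c0 FK sF mF mnF cF; have [L L0 HL] := phis_bounded.
have tc := test_square_sum phis_test.
have K0 := exp_bounded_ge0 (FK 0%N).1.
have expc gam : expR (c * norm1 (pairings gam)) <=
    expR (c * L * (supp_count (square_sum phis) gam)%:R).
  by rewrite ler_expR -mulrA ler_wpM2l//; exact: pairings_bound.
have dom (H_ : nat -> Gamma R d -> R[i]) (H : Gamma R d -> R[i]) (A : R) : 0 <= A ->
    (forall k, cmeasurable (H_ k)) -> ccvg H_ H ->
    (forall k gam, `|complex.Re (H_ k gam)| <= A * (K * expR (c * norm1 (pairings gam))) /\
                   `|complex.Im (H_ k gam)| <= A * (K * expR (c * norm1 (pairings gam)))) ->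
    square_integrable P H /\ l2cvg (L2 P) H_ H.
  move=> A0 mH cH HB.
  apply: (L2_dominated (G := fun gam => 2 * (A * K) ^+ 2 *
      expR (2 * (c * L) * (supp_count (square_sum phis) gam)%:R))) => //.
  - by move=> gam; case: (cH gam).
  - by move=> gam; case: (cH gam).
  - move=> k gam; have [h1 h2] := HB k gam.
    have E : expR (2 * (c * L) * (supp_count (square_sum phis) gam)%:R) =
      expR (c * L * (supp_count (square_sum phis) gam)%:R) ^+ 2 by rewrite -mulrA expRM_natl.
    have nx (z : R) : z ^+ 2 = `|z| ^+ 2 by rewrite real_normK ?num_real.
    rewrite E -mulrA -exprMn /sqabs (nx (complex.Re _)) (nx (complex.Im _)).
    have le a : 0 <= a -> a <= A * (K * expR (c * norm1 (pairings gam))) ->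
       a ^+ 2 <= (A * K * expR (c * L * (supp_count (square_sum phis) gam)%:R)) ^+ 2.
      move=> a0 h; rewrite ler_sqr ?nnegrE ?mulr_ge0 ?expR_ge0//; apply: le_trans h _.
      by rewrite mulrA ler_wpM2l// mulr_ge0.
    by have := le _ (normr_ge0 _) h1; have := le _ (normr_ge0 _) h2; lra.
  - have := exp_count_integrable sigma_radon P_poisson tc (mulr_ge0 (ler0n R 2) (mulr_ge0 c0 L0)).
    move=> /(integrableZl measurableT (2 * (A * K) ^+ 2)).
    by under eq_fun do rewrite -EFinM.
have [s1 l1] : square_integrable P (fun gam => F (pairings gam)) /\
    l2cvg (L2 P) (fun k gam => F_ k (pairings gam)) (fun gam => F (pairings gam)).
  apply: (dom _ _ 1 ler01 mF (fun gam => cF (pairings gam))).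
  by move=> k gam; rewrite mul1r; have [h1 h2] := FK k; split; [exact: h1|exact: h2].
have [s2 l2] : square_integrable P (nabla F) /\ l2cvg (L2 P) (fun k => nabla (F_ k)) (nabla F).
  apply: (dom _ _ (2 * expR (c * L) * (\int[sigma]_x `|phi x|))) => //.
  - by rewrite !mulr_ge0 ?expR_ge0// Rintegral_ge0.
  - move=> gam; split.
      apply: (nabla_real_cvg c0 (fun k => (FK k).1)) => [k|y]; last by case: (cF y).
      by case: (sF k (pairings gam)).
    apply: (nabla_real_cvg c0 (fun k => (FK k).2)) => [k|y]; last by case: (cF y).
    by case: (sF k (pairings gam)).
  - move=> k gam; have [h1 h2] := FK k; have [m1 m2] := sF k (pairings gam).
    by split; [exact: (nabla_real_bound c0 HL h1 m1)|exact: (nabla_real_bound c0 HL h2 m2)].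
by [].
Qed.

(** The first two clauses make the integrals in [nabla] finite, which its linearity in [F]
    requires. *)
Definition closure_class F := [/\ slice_measurable F,
  exists K c, 0 <= c /\ cexp_bounded K c F &
  wick_closure sigma P phi (fun gam => F (pairings gam)) (nabla F)].

Lemma closure_class_lim K c (F_ : nat -> 'rV[R]_N -> R[i]) F : 0 <= c ->
  (forall k, closure_class (F_ k)) -> (forall k, cexp_bounded K c (F_ k)) -> ccvg F_ F ->
  closure_class F.
Proof.
move=> c0 HF FK cF; have sF k : slice_measurable (F_ k) by case: (HF k).
have mF k : cmeasurable (fun gam => F_ k (pairings gam)).
  by case: (HF k) => _ _ [m _ _]; exact: square_integrable_measurable m.
have mnF k : cmeasurable (nabla (F_ k)).
  by case: (HF k) => _ _ [_ m _]; exact: square_integrable_measurable m.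
have [s1 s2 l1 l2] := nabla_dominated c0 FK sF mF mnF cF.
split.
- move=> y; apply: (ccvg_cmeasurable (fun k => sF k y)) => x; exact: cF.
- have bnd (g_ : nat -> 'rV[R]_N -> R) g : (forall k, exp_bounded K c (g_ k)) ->
      (forall y, (g_ ^~ y) @ \oo --> g y) -> exp_bounded K c g.
    move=> gK cg y; rewrite -(cvg_lim _ (cvg_norm (cg y)))//; apply: limr_le.
      by apply/cvg_ex; eexists; apply: cvg_norm; exact: cg.
    by apply: nearW => k; exact: gK.
  exists K, c; split=> //; split.
    by apply: bnd (fun k => (FK k).1) _ => y; case: (cF y).
  by apply: bnd (fun k => (FK k).2) _ => y; case: (cF y).
- apply: (L2_closure_cvg (@wick_graph_cmeasurable _ _ sigma phi) _ s1 s2 l1 l2).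
  by move=> k; case: (HF k).
Qed.

Lemma nabla_realZD K c K' c' (a b : R) f g y : 0 <= c -> 0 <= c' ->
  exp_bounded K c f -> exp_bounded K' c' g ->
  measurable_fun setT (fun x => f (y + shifts x)) ->
  measurable_fun setT (fun x => g (y + shifts x)) ->
  nabla_real (fun y => a * f y + b * g y) y = a * nabla_real f y + b * nabla_real g y.
Proof.
move=> c0 c0' fK gK mf mg; have i1 := nabla_integrable c0 fK mf.
have i2 := nabla_integrable c0' gK mg.
rewrite /nabla_real -!RintegralZl// -RintegralD//.
- by apply: eq_Rintegral => x _; ring.
- by have := integrableZl measurableT a i1; under eq_fun do rewrite -EFinM.
- by have := integrableZl measurableT b i2; under eq_fun do rewrite -EFinM.
Qed.

Lemma exp_boundedZD K c K' c' (a b : R) f g : 0 <= c -> 0 <= c' ->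
  exp_bounded K c f -> exp_bounded K' c' g ->
  exp_bounded (`|a| * K + `|b| * K') (c + c') (fun y => a * f y + b * g y).
Proof.
move=> c0 c0' fK gK y; apply: le_trans (ler_normD _ _) _; rewrite !normrM mulrDl.
have K0 := exp_bounded_ge0 fK; have K0' := exp_bounded_ge0 gK.
apply: lerD; rewrite -mulrA ler_wpM2l//.
  apply: le_trans (fK y) _; rewrite ler_wpM2l// ler_expR ler_wpM2r ?norm1_ge0//.
  by rewrite lerDl.
apply: le_trans (gK y) _; rewrite ler_wpM2l// ler_expR ler_wpM2r ?norm1_ge0//.
by rewrite lerDr.
Qed.

Lemma closure_classD F G : closure_class F -> closure_class G ->
  closure_class (fun y => F y + G y).
Proof.
move=> [sF [K [c [c0 [FK1 FK2]]]] vF] [sG [K' [c' [c0' [GK1 GK2]]]] vG]; split.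
- by move=> y; apply: cmeasurableD; [exact: sF|exact: sG].
- exists (K + K'), (c + c'); split; first by rewrite addr_ge0.
  have := exp_boundedZD 1 1 c0 c0' FK1 GK1; have := exp_boundedZD 1 1 c0 c0' FK2 GK2.
  rewrite normr1 !mul1r => h2 h1.
  by split=> y; [have := h1 y; rewrite ReD !mul1r|have := h2 y; rewrite ImD !mul1r].
have -> : nabla (fun y => F y + G y) = fun gam => nabla F gam + nabla G gam.
  apply/funext => gam; have [m1 m2] := sF (pairings gam); have [m3 m4] := sG (pairings gam).
  have := nabla_realZD 1 1 c0 c0' FK1 GK1 m1 m3; have := nabla_realZD 1 1 c0 c0' FK2 GK2 m2 m4.
  rewrite !mul1r => h2 h1; apply: complex_ext; rewrite ?ReD ?ImD /= -?h1 -?h2.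
    by apply: (congr1 (fun h => nabla_real h (pairings gam))); apply/funext => y; rewrite ReD !mul1r.
  by apply: (congr1 (fun h => nabla_real h (pairings gam))); apply/funext => y; rewrite ImD !mul1r.
exact: (L2_closureD (@wick_graph_cmeasurable _ _ sigma phi) vF vG).
Qed.

Lemma closure_classZ (a : R[i]) F : closure_class F -> closure_class (fun y => a * F y).
Proof.
move=> [sF [K [c [c0 [FK1 FK2]]]] vF]; split.
- by move=> y; apply: cmeasurableZ; exact: sF.
- exists ((`|complex.Re a| + `|complex.Im a|) * K), (c + c); split; first by rewrite addr_ge0.
  have h1 := exp_boundedZD (complex.Re a) (- complex.Im a) c0 c0 FK1 FK2.
  have h2 := exp_boundedZD (complex.Re a) (complex.Im a) c0 c0 FK2 FK1.
  rewrite normrN in h1; rewrite mulrDl.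
  by split=> y; [rewrite ReM -mulNr; exact: h1|rewrite ImM; exact: h2].
have -> : nabla (fun y => a * F y) = fun gam => a * nabla F gam.
  apply/funext => gam; have [m1 m2] := sF (pairings gam).
  have h1 := nabla_realZD (complex.Re a) (- complex.Im a) c0 c0 FK1 FK2 m1 m2.
  have h2 := nabla_realZD (complex.Re a) (complex.Im a) c0 c0 FK2 FK1 m2 m1.
  apply: complex_ext; rewrite ?ReM ?ImM /= -?h2 -?mulNr -?h1.
    by apply: (congr1 (fun h => nabla_real h (pairings gam))); apply/funext => y; rewrite ReM mulNr.
  by apply: (congr1 (fun h => nabla_real h (pairings gam))); apply/funext => y; rewrite ImM.
exact: (L2_closureZ (@wick_graph_cmeasurable _ _ sigma phi) a vF).
Qed.

End CylinderClass.

(** * Real exponentials, powers and characters of the pairings *)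

Section CylinderExponentials.
Context {R : realType} {d : nat}.
Variable sigma : {measure set (Rd R d) -> \bar R}.
Hypothesis sigma_radon : radon sigma.
Variable P : probability (Gamma R d) R.
Hypothesis P_poisson : is_poisson sigma P.
Variable phi : 'rV[R]_d -> R.
Hypothesis phi_test : test_function phi.
Variables (N : nat) (phis : 'I_N -> 'rV[R]_d -> R).
Hypothesis phis_test : forall i, test_function (phis i).
Implicit Types (gam : Gamma R d) (y s : 'rV[R]_N) (f : 'rV[R]_N -> R) (F : 'rV[R]_N -> R[i]).

Local Notation CC := (closure_class sigma P phi phis).

Definition dot s y : R := \sum_i s 0 i * y 0 i.

Lemma dotZ (a : R) s y : dot (a *: s) y = a * dot s y.
Proof. by rewrite /dot mulr_sumr; apply: eq_bigr => i _; rewrite mxE mulrA. Qed.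

Lemma dotDl s s' y : dot (s + s') y = dot s y + dot s' y.
Proof. by rewrite /dot -big_split/=; apply: eq_bigr => i _; rewrite mxE mulrDl. Qed.

Lemma dotDr s y z : dot s (y + z) = dot s y + dot s z.
Proof. by rewrite /dot -big_split/=; apply: eq_bigr => i _; rewrite mxE mulrDr. Qed.

Lemma dot_bound s y : `|dot s y| <= norm1 s * norm1 y.
Proof.
apply: le_trans (ler_norm_sum _ _ _) _; rewrite /norm1 mulr_sumr.
apply: ler_sum => i _; rewrite normrM ler_wpM2r//.
by rewrite (bigD1 i)//= lerDl sumr_ge0.
Qed.

Let theta s (x : 'rV[R]_d) : R := \sum_i s 0 i * phis i x.

Let theta_test s : test_function (theta s).
Proof. by apply: test_sum => i; exact: testZ. Qed.

Lemma dot_shifts s (x : Rd R d) : dot s (shifts phis x) = theta s x.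
Proof. by apply: eq_bigr => i _; rewrite mxE. Qed.

Lemma dot_pairings s gam : dot s (pairings phis gam) = pairing gam (theta s).
Proof.
have tc := test_square_sum phis_test.
rewrite (pairing_supp _ tc); last first.
  by move=> x h; rewrite /theta big1// => i _; rewrite (square_sum_eq0 _ h) mulr0.
rewrite exchange_big/=; apply: eq_bigr => i _; rewrite mxE (pairing_supp _ tc) ?mulr_sumr//.
by move=> x; exact: square_sum_eq0.
Qed.

Lemma measurable_dot_slice s y : measurable_fun setT (fun x => dot s (y + shifts phis x)).
Proof.
under eq_fun do rewrite dotDr dot_shifts; apply: measurable_funD; first exact: measurable_cst.
by apply: continuous_measurable_Rd; exact: test_continuous.
Qed.

(** With [psi = expR theta - 1], the exponential is a multiple of the Wick exponential of [psi], and
    translation by [shifts x] multiplies it by [1 + psi x]; the derivative is therefore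
    multiplication by [(phi, psi)]. *)
Lemma closure_class_exp s : CC (fun y => (expR (dot s y))%:C%C).
Proof.
have tpsi := test_exp (theta_test s); set psi := (fun x => _) in tpsi.
have p1 x : -1 < psi x by rewrite /psi ltrBrDr addNr expR_gt0.
pose K := expR (\int[sigma]_x psi x).
have E gam : expR (dot s (pairings phis gam)) = K * wick sigma psi gam.
  rewrite dot_pairings /K /wick -expRD addrC subrK; congr (expR (pairing _ _)).
  by apply/funext => x; rewrite /psi addrC subrK expRK.
split.
- move=> y; apply: cmeasurable_real; apply: measurableT_comp; first exact: measurable_expR.
  exact: measurable_dot_slice.
- exists 1, (norm1 s); split; first exact: norm1_ge0.
  split=> y /=; last by rewrite normr0 mul1r expR_ge0.
  rewrite mul1r ger0_norm ?expR_ge0// ler_expR; apply: le_trans (dot_bound s y).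
  exact: ler_norm.
- have h := L2_closureZ (@wick_graph_cmeasurable _ _ sigma phi) K%:C%C
    (wick_closure_wick sigma_radon P_poisson phi tpsi p1).
  rewrite (_ : (fun gam => _) = (fun gam => K%:C%C * (wick sigma psi gam)%:C%C)); last first.
    by apply/funext => gam; rewrite E real_complexM.
  rewrite (_ : nabla _ _ _ _ = (fun gam => K%:C%C * (\int[sigma]_x (phi x * psi x) *
    wick sigma psi gam)%:C%C)); first exact: h.
  apply/funext => gam; rewrite -real_complexM; apply: complex_ext => /=.
    rewrite mulrCA -E /nabla_real -RintegralZr//.
      apply: eq_Rintegral => x _; rewrite dotDr expRD dot_shifts /psi; ring.
    by apply: (integrable_test sigma_radon); apply: testM => //; case: phi_test.
  rewrite /nabla_real; under eq_Rintegral do rewrite subrr mul0r.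
  by rewrite Rintegral_cst// mul0r.
Qed.

Lemma closure_class0 : CC (fun=> 0).
Proof.
have := closure_classZ sigma_radon phi_test phis_test 0 (closure_class_exp 0).
by under eq_fun do rewrite mul0r.
Qed.

Lemma closure_class_sum I (r : seq I) (F : I -> 'rV[R]_N -> R[i]) :
  (forall i, CC (F i)) -> CC (fun y => \sum_(i <- r) F i y).
Proof.
move=> H; elim: r => [|i r IH].
  by under eq_fun do rewrite big_nil; exact: closure_class0.
by under eq_fun do rewrite big_cons; exact: (closure_classD sigma_radon phi_test phis_test (H i) IH).
Qed.

Lemma expR_diff_bound (x : R) : `|expR x - 1| <= `|x| * expR `|x|.
Proof.
have h1 := expR_ge1Dx x; have h2 := expR_ge1Dx (- x).
have [x0|x0] := leP 0 x.
  rewrite (ger0_norm x0) ger0_norm; last by rewrite subr_ge0 -expR0 ler_expR.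
  have e : expR (- x) * expR x = 1 by rewrite mulrC expRxMexpNx_1.
  have e0 := expR_gt0 x; move: (expR x) (expR (- x)) e e0 h1 h2 => a b; nra.
rewrite (ltr0_norm x0) ler0_norm; last by rewrite subr_le0 expR_le1 ltW.
by move: (expR x) (expR (- x)) h1 h2 => a b; nra.
Qed.

Lemma cvg_expR_quotient (u : R) :
  (fun j : nat => (expR (j.+1%:R^-1 * u) - 1) / j.+1%:R^-1) @ \oo --> u.
Proof.
have rep := pseries_rep_exp (- u).
have t01 (j : nat) : 0 < (j.+1%:R^-1 : R) <= 1 by rewrite invr_gt0 ltr0n/= invf_le1// ler1n.
have := pseries_rep_coefficient (n := 1) rep t01 (cvg_harmonic).
rewrite opprK expr1 divr1; under eq_fun => j do
  rewrite big_ord_recl big_ord0 addr0 /= !expr0 divr1 mulr1 expr1 mulNr opprK mulrC.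
by under [X in _ -> X @ _ --> _]eq_fun => j do rewrite mulrC [_ * u]mulrC.
Qed.

Lemma closure_class_pow s k : CC (fun y => (dot s y ^+ k)%:C%C).
Proof.
pose h (j : nat) : R := j.+1%:R^-1.
have h0 j : 0 < h j by rewrite invr_gt0.
have h1 j : h j <= 1 by rewrite invf_le1// ler1n.
have cu y : (fun j => ((expR (h j * dot s y) - 1) / h j) ^+ k) @ \oo --> dot s y ^+ k.
  by apply: (continuous_cvg _ (@exprn_continuous _ k _)); exact: cvg_expR_quotient.
(* From [|expR x - 1| <= |x| * expR |x|], [h j <= 1] and [u <= expR u]: a bound uniform in [j], at
   the price of doubling the exponent. *)
have bq j y : `|(expR (h j * dot s y) - 1) / h j| <= expR (2 * (norm1 s * norm1 y)).
  rewrite normrM normfV (gtr0_norm (h0 j)) ler_pdivrMr//.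
  apply: le_trans (expR_diff_bound _) _; rewrite normrM (gtr0_norm (h0 j)).
  rewrite -mulrA mulrC expRM_natl expr2; apply: ler_wpM2r; first exact: ltW.
  have db := dot_bound s y; apply: ler_pM; rewrite ?expR_ge0//.
    by apply: le_trans db _; have := expR_ge1Dx (norm1 s * norm1 y); lra.
  by rewrite ler_expR; apply: le_trans db; rewrite ler_piMl// ltW.
apply: (closure_class_lim sigma_radon P_poisson phi_test phis_test
  (K := 1) (c := 2 * norm1 s * k%:R)
  (F_ := fun j y => (((expR (h j * dot s y) - 1) / h j) ^+ k)%:C%C)).
- by rewrite !mulr_ge0// norm1_ge0.
- move=> j; rewrite (_ : (fun y => _) = fun y => \sum_(i < k.+1)
    (((-1) ^+ i / h j ^+ k) *+ 'C(k, i))%:C%C * (expR (dot ((h j * (k - i)%N%:R) *: s) y))%:C%C).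
    apply: closure_class_sum => i; apply: (closure_classZ sigma_radon phi_test phis_test).
    exact: closure_class_exp.
  apply/funext => y; under eq_bigr do rewrite -real_complexM; rewrite -real_complex_sum.
  congr (_%:C)%C; rewrite expr_div_n exprBn mulr_suml; apply: eq_bigr => i _.
  rewrite expr1n mulr1 dotZ mulrAC expRM_natr -(mulr_natr _ 'C(k, i)).
  by rewrite -[in RHS](mulr_natr _ 'C(k, i)); ring.
- move=> j; split=> y /=; last by rewrite normr0 mul1r expR_ge0.
  have -> : 2 * norm1 s * k%:R * norm1 y = k%:R * (2 * (norm1 s * norm1 y)) by ring.
  by rewrite mul1r normrX expRM_natl lerXn2r ?nnegrE ?expR_ge0.
- by move=> y; split => /=; [exact: cu|exact: cvg_cst].
Qed.

Definition expi s y : R[i] := Complex (cos (dot s y)) (sin (dot s y)).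

(** Wick exponentials have real [psi], so an imaginary exponent is out of their direct reach; the
    power series crosses from one to the other, with partial sums bounded by the real
    exponential. *)
Lemma closure_class_expi s : CC (expi s).
Proof.
(* [cc j] is the [j]-th power of the imaginary unit over [j!], written so that its parts are the
   coefficients of cosine and sine. *)
pose cc (j : nat) : R[i] := Complex ((~~ odd j)%:R * (-1) ^+ j./2 / j`!%:R)
  ((odd j)%:R * (-1) ^+ j.-1./2 / j`!%:R).
have Re_ k y : complex.Re (\sum_(j < k) cc j * (dot s y ^+ j)%:C%C) = series (cos_coeff (dot s y)) k.
  rewrite [RHS](_ : _ = \sum_(j < k) cos_coeff (dot s y) j); last first.
    by rewrite /series/= big_mkord.
  rewrite Re_sum; apply: eq_bigr => j _.
  by rewrite ReM /= mulr0 subr0 /cos_coeff/= -?exprnP; ring.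
have Im_ k y : complex.Im (\sum_(j < k) cc j * (dot s y ^+ j)%:C%C) = series (sin_coeff (dot s y)) k.
  rewrite [RHS](_ : _ = \sum_(j < k) sin_coeff (dot s y) j); last first.
    by rewrite /series/= big_mkord.
  rewrite Im_sum; apply: eq_bigr => j _.
  by rewrite ImM /= mulr0 add0r /sin_coeff/= -?exprnP; ring.
have bnd (a : nat -> R) y k : (forall j, `|a j| <= exp_coeff `|dot s y| j) ->
    `|series a k| <= 1 * expR (norm1 s * norm1 y).
  move=> ha; rewrite mul1r; apply: (@le_trans _ _ (expR `|dot s y|)); last first.
    by rewrite ler_expR; exact: dot_bound.
  apply: (@le_trans _ _ (series (exp_coeff `|dot s y|) k)).
    by apply: le_trans (ler_norm_sum _ _ _) _; apply: ler_sum.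
  apply: nondecreasing_cvgn_le; last exact: is_cvg_series_exp_coeff.
  by apply: nondecreasing_series => j _ _; rewrite exp_coeffE mulr_ge0 ?invr_ge0 ?exprn_ge0.
have sgn (b : bool) (m : nat) : `|b%:R * (-1) ^+ m : R| <= 1.
  by rewrite normrM normrX normrN normr1 expr1n mulr1; case: b; rewrite ?normr1 ?normr0.
apply: (closure_class_lim sigma_radon P_poisson phi_test phis_test
  (K := 1) (c := norm1 s)
  (F_ := fun k y => \sum_(j < k) cc j * (dot s y ^+ j)%:C%C)).
- exact: norm1_ge0.
- move=> k; apply: closure_class_sum => j.
  apply: (closure_classZ sigma_radon phi_test phis_test); exact: closure_class_pow.
- move=> k; split=> y; rewrite ?Re_ ?Im_; apply: bnd => j.
    rewrite /cos_coeff exp_coeffE/= -mulrA normrM (_ : `|_ / _| = `|dot s y| ^+ j / j`!%:R).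
      by rewrite [leRHS]mulrC ler_piMl ?sgn// mulr_ge0 ?exprn_ge0 ?invr_ge0.
    by rewrite normrM normrX normfV normr_nat.
  rewrite /sin_coeff exp_coeffE/= -mulrA normrM (_ : `|_ / _| = `|dot s y| ^+ j / j`!%:R).
    by rewrite [leRHS]mulrC ler_piMl ?sgn// mulr_ge0 ?exprn_ge0 ?invr_ge0.
  by rewrite normrM normrX normfV normr_nat.
- move=> y; split.
    under eq_fun do rewrite Re_; rewrite /expi/= cos.unlock; exact: is_cvg_series_cos_coeff.
  under eq_fun do rewrite Im_; rewrite /expi/= sin.unlock; exact: is_cvg_series_sin_coeff.
Qed.

End CylinderExponentials.

(** * From characters to bounded continuous functions of the pairings *)

Section BoundedCylinders.
Context {R : realType} {d : nat}.
Variable sigma : {measure set (Rd R d) -> \bar R}.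
Hypothesis sigma_radon : radon sigma.
Variable P : probability (Gamma R d) R.
Hypothesis P_poisson : is_poisson sigma P.
Variable phi : 'rV[R]_d -> R.
Hypothesis phi_test : test_function phi.
Variables (N : nat) (phis : 'I_N -> 'rV[R]_d -> R).
Hypothesis phis_test : forall i, test_function (phis i).
Implicit Types (y s : 'rV[R]_N) (f : 'rV[R]_N -> R) (F G : 'rV[R]_N -> R[i]).

Local Notation CC := (closure_class sigma P phi phis).

Definition cbounded (K : R) F :=
  forall y, `|complex.Re (F y)| <= K /\ `|complex.Im (F y)| <= K.

(* A multiplicative monotone class: [stable_class] is an algebra, closed under
   bounded pointwise limits, and contained in [closure_class]. *)
Definition stable_class1 F :=
  (exists K, cbounded K F) /\ forall s, CC (fun y => F y * expi s y).

Definition stable_class F :=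
  (exists K, cbounded K F) /\
  forall G, stable_class1 G -> stable_class1 (fun y => F y * G y).

Lemma cbounded_ge0 K F : cbounded K F -> 0 <= K.
Proof. by move=> /(_ 0)[+ _]; exact: le_trans. Qed.

Lemma cboundedM K K' F G : cbounded K F -> cbounded K' G ->
  cbounded (2 * (K * K')) (fun y => F y * G y).
Proof.
move=> FK GK y; have [h1 h2] := FK y; have [h3 h4] := GK y.
have le a b a' b' : `|a| <= K -> `|b| <= K' -> `|a'| <= K -> `|b'| <= K' ->
    `|a * b| + `|a' * b'| <= 2 * (K * K').
  by move=> ? ? ? ?; rewrite !normrM mulr_natl mulr2n; apply: lerD; exact: ler_pM.
split; first by rewrite ReM; apply: le_trans (ler_normB _ _) _; exact: le.
by rewrite ImM; apply: le_trans (ler_normD _ _) _; exact: le.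
Qed.

Lemma cboundedD K K' F G : cbounded K F -> cbounded K' G ->
  cbounded (K + K') (fun y => F y + G y).
Proof.
move=> FK GK y; have [h1 h2] := FK y; have [h3 h4] := GK y.
by split; rewrite ?ReD ?ImD; apply: le_trans (ler_normD _ _) _; exact: lerD.
Qed.

Lemma cbounded_cst (c : R[i]) : exists K, cbounded K (fun=> c).
Proof.
exists (`|complex.Re c| + `|complex.Im c|) => y.
by rewrite lerDl lerDr !normr_ge0.
Qed.

Lemma cbounded_expi s : cbounded 1 (expi s).
Proof. by move=> y; split; [exact: cos_max|exact: sin_max]. Qed.

Lemma expiD s s' y : expi s y * expi s' y = expi (s + s') y.
Proof.
apply: complex_ext; rewrite ?ReM ?ImM /= dotDl; first by rewrite cosD.
by rewrite sinD addrC; ring.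
Qed.

Lemma cbounded_exp K F : cbounded K F -> cexp_bounded K 0 F.
Proof.
by move=> FK; split=> y; rewrite mul0r expR0 mulr1; case: (FK y).
Qed.

Lemma ccvgM T (F_ : nat -> T -> R[i]) (F G : T -> R[i]) : ccvg F_ F ->
  ccvg (fun k t => F_ k t * G t) (fun t => F t * G t).
Proof.
move=> cF t; have [c1 c2] := cF t; split.
  under eq_fun do rewrite ReM; rewrite ReM.
  by apply: cvgB; apply: cvgM => //; exact: cvg_cst.
under eq_fun do rewrite ImM; rewrite ImM.
by apply: cvgD; apply: cvgM => //; exact: cvg_cst.
Qed.

Lemma cbounded_lim K (F_ : nat -> 'rV[R]_N -> R[i]) F : (forall k, cbounded K (F_ k)) ->
  ccvg F_ F -> cbounded K F.
Proof.
have lim_le (u : nat -> R) l : u @ \oo --> l -> (forall k, `|u k| <= K) -> `|l| <= K.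
  move=> ul uK; rewrite -(cvg_lim _ (cvg_norm ul))//; apply: limr_le; last exact: nearW.
  by apply/cvg_ex; eexists; exact: (cvg_norm ul).
move=> FK cF y; have [c1 c2] := cF y.
by split; [apply: lim_le c1 _|apply: lim_le c2 _] => k; case: (FK k y).
Qed.

Lemma stable_class1_lim K (F_ : nat -> 'rV[R]_N -> R[i]) F :
  (forall k, stable_class1 (F_ k)) -> (forall k, cbounded K (F_ k)) -> ccvg F_ F ->
  stable_class1 F.
Proof.
move=> HF FK cF; split; first by exists K; exact: cbounded_lim cF.
move=> s; apply: (closure_class_lim sigma_radon P_poisson phi_test phis_test
  (K := 2 * (K * 1)) (c := 0) (F_ := fun k y => F_ k y * expi s y)) => //.
- by move=> k; exact: ((HF k).2 s).
- by move=> k; apply: cbounded_exp; exact: (cboundedM (FK k) (cbounded_expi s)).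
- exact: (ccvgM _ cF).
Qed.

Lemma stable_class_lim K (F_ : nat -> 'rV[R]_N -> R[i]) F :
  (forall k, stable_class (F_ k)) -> (forall k, cbounded K (F_ k)) -> ccvg F_ F ->
  stable_class F.
Proof.
move=> HF FK cF; split; first by exists K; exact: cbounded_lim cF.
move=> G G1; have [[K' GK'] _] := G1.
apply: (@stable_class1_lim (2 * (K * K')) (fun k y => F_ k y * G y)).
- by move=> k; exact: ((HF k).2 _ G1).
- by move=> k; exact: (cboundedM (FK k) GK').
- exact: (ccvgM _ cF).
Qed.

Lemma stable_class1D F G : stable_class1 F -> stable_class1 G ->
  stable_class1 (fun y => F y + G y).
Proof.
move=> [[K FK] F1] [[K' GK] G1]; split; first by exists (K + K'); exact: cboundedD.
move=> s; under eq_fun do rewrite mulrDl.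
exact: (closure_classD sigma_radon phi_test phis_test (F1 s) (G1 s)).
Qed.

Lemma stable_classD F G : stable_class F -> stable_class G ->
  stable_class (fun y => F y + G y).
Proof.
move=> [[K FK] F1] [[K' GK] G1]; split; first by exists (K + K'); exact: cboundedD.
move=> H H1; under eq_fun do rewrite mulrDl.
exact: (stable_class1D (F1 _ H1) (G1 _ H1)).
Qed.

(** Elements of [stable_class] multiply [stable_class1] into itself, and such multipliers compose.
    Membership in [closure_class] alone would say nothing about products. *)
Lemma stable_classM F G : stable_class F -> stable_class G ->
  stable_class (fun y => F y * G y).
Proof.
move=> [[K FK] F1] [[K' GK] G1]; split; first by exists (2 * (K * K')); exact: cboundedM.
move=> H H1; under eq_fun do rewrite -mulrA.
exact: (F1 _ (G1 _ H1)).
Qed.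

Lemma stable_class_cst (c : R[i]) : stable_class (fun=> c).
Proof.
have [K cK] := cbounded_cst c; split; first by exists K.
move=> G [[K' GK] G1]; split; first by exists (2 * (K * K')); exact: (cboundedM cK GK).
move=> s; under eq_fun do rewrite -mulrA.
exact: (closure_classZ sigma_radon phi_test phis_test c (G1 s)).
Qed.

(** Multiplication by a character only translates the frequency; for this reason [stable_class1]
    quantifies over all frequencies. *)
Lemma stable_class_expi s : stable_class (expi s).
Proof.
split; first by exists 1; exact: cbounded_expi.
move=> G [[K' GK] G1]; split.
  by exists (2 * (1 * K')); exact: (cboundedM (cbounded_expi s) GK).
move=> s'; under eq_fun do rewrite [expi s _ * _]mulrC -mulrA expiD.
exact: G1.
Qed.

Lemma stable_class_sum I (r : seq I) (F : I -> 'rV[R]_N -> R[i]) :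
  (forall i, stable_class (F i)) -> stable_class (fun y => \sum_(i <- r) F i y).
Proof.
move=> H; elim: r => [|i r IH].
  by under eq_fun do rewrite big_nil; exact: stable_class_cst.
by under eq_fun do rewrite big_cons; exact: (stable_classD (H i) IH).
Qed.

(** The multiplier is evaluated at the constant 1 and at frequency 0; that 1 belongs to
    [stable_class1] is the statement on characters. *)
Lemma stable_class_closure F : stable_class F -> CC F.
Proof.
have E0 y : expi 0 y = 1.
  rewrite /expi /dot big1; last by move=> i _; rewrite mxE mul0r.
  by rewrite cos0 sin0.
have one1 : stable_class1 (fun=> 1).
  split; first exact: cbounded_cst.
  move=> s; under eq_fun do rewrite mul1r.
  exact: (closure_class_expi sigma_radon P_poisson phi_test phis_test).
move=> [_ /(_ _ one1)[_ /(_ 0)]].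
by under eq_fun do rewrite E0 !mulr1.
Qed.

Definition real_stable f := stable_class (fun y => (f y)%:C%C).

Lemma real_stable_bounded f : real_stable f -> exists2 K : R, 0 <= K & forall y, `|f y| <= K.
Proof.
by move=> [[K FK] _]; exists K => [|y]; [exact: cbounded_ge0 FK|case: (FK y)].
Qed.

Lemma real_stable_lim K (f_ : nat -> 'rV[R]_N -> R) f : (forall k, real_stable (f_ k)) ->
  (forall k y, `|f_ k y| <= K) -> (forall y, (f_ ^~ y) @ \oo --> f y) -> real_stable f.
Proof.
move=> Hf fK cf; apply: (stable_class_lim (K := K) Hf).
  by move=> k y; split=> //=; rewrite normr0; apply: le_trans (fK k y).
by move=> y; split=> /=; [exact: cf|exact: cvg_cst].
Qed.

Lemma real_stable_cst (c : R) : real_stable (fun=> c).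
Proof. exact: stable_class_cst. Qed.

Lemma real_stableD f g : real_stable f -> real_stable g -> real_stable (fun y => f y + g y).
Proof.
by move=> sf sg; rewrite /real_stable; under eq_fun do rewrite real_complexD; exact: stable_classD sf sg.
Qed.

Lemma real_stableM f g : real_stable f -> real_stable g -> real_stable (fun y => f y * g y).
Proof.
by move=> sf sg; rewrite /real_stable; under eq_fun do rewrite real_complexM; exact: stable_classM sf sg.
Qed.

Lemma real_stableB f g : real_stable f -> real_stable g -> real_stable (fun y => f y - g y).
Proof.
move=> sf sg; under eq_fun do rewrite -mulN1r.
exact: (real_stableD sf (real_stableM (real_stable_cst (-1)) sg)).
Qed.

Lemma real_stable_sum I (r : seq I) (f : I -> 'rV[R]_N -> R) :
  (forall i, real_stable (f i)) -> real_stable (fun y => \sum_(i <- r) f i y).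
Proof.
move=> H; rewrite /real_stable; under eq_fun do rewrite real_complex_sum.
exact: (stable_class_sum r H).
Qed.

Lemma real_stable_prod I (r : seq I) (f : I -> 'rV[R]_N -> R) :
  (forall i, real_stable (f i)) -> real_stable (fun y => \prod_(i <- r) f i y).
Proof.
move=> H; elim: r => [|i r IH].
  by under eq_fun do rewrite big_nil; exact: real_stable_cst.
by under eq_fun do rewrite big_cons; exact: (real_stableM (H i) IH).
Qed.

Lemma real_stableX f k : real_stable f -> real_stable (fun y => f y ^+ k).
Proof.
move=> sf; elim: k => [|k IH]; first by under eq_fun do rewrite expr0; exact: real_stable_cst.
by under eq_fun do rewrite exprS; exact: (real_stableM sf IH).
Qed.

Lemma real_stable_exp f : real_stable f -> real_stable (fun y => expR (f y)).
Proof.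
move=> sf; have [K K0 fK] := real_stable_bounded sf.
apply: (@real_stable_lim (expR K) (fun k y => \sum_(0 <= j < k) f y ^+ j * j`!%:R^-1)).
- move=> k; apply: real_stable_sum => j.
  exact: (real_stableM (real_stableX j sf) (real_stable_cst _)).
- move=> k y; apply: (@le_trans _ _ (series (exp_coeff K) k)).
    apply: le_trans (ler_norm_sum _ _ _) _; apply: ler_sum => j _.
    rewrite normrM normrX normfV normr_nat exp_coeffE mulrC ler_wpM2l ?invr_ge0//.
    by rewrite lerXn2r ?nnegrE.
  apply: nondecreasing_cvgn_le; last exact: is_cvg_series_exp_coeff.
  by apply: nondecreasing_series => j _ _; rewrite exp_coeffE mulr_ge0 ?invr_ge0 ?exprn_ge0.
- move=> y; have := @exp_series R (f y) 1; rewrite mul1r.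
  by under eq_fun do rewrite expr1n mulr1.
Qed.

(* First the limit of [exp (- exp (- k f))], which is 1, 1/e or 0 according to
   the sign of [f], then that of its powers. *)
Lemma real_stable_positive f : real_stable f -> real_stable (fun y => (0 < f y)%R%:R).
Proof.
move=> sf; pose v y : R := if 0 < f y then 1 else if f y == 0 then expR (-1) else 0.
have sv : real_stable v.
  apply: (@real_stable_lim 1 (fun k y => expR (- expR (- (k%:R * f y))))).
  - move=> k; apply: real_stable_exp; under eq_fun do rewrite -mulN1r.
    apply: (real_stableM (real_stable_cst (-1))).
    apply: real_stable_exp; under eq_fun do rewrite -mulNr.
    exact: (real_stableM (real_stable_cst _) sf).
  - by move=> k y; rewrite ger0_norm ?expR_ge0// expR_le1 oppr_le0 expR_ge0.
  - move=> y; rewrite /v; case: (ltrgtP 0 (f y)) => fy.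
    + have c : (fun k : nat => expR (- (k%:R * f y))) @ \oo --> (0 : R).
        under eq_fun do rewrite -mulrN expRM_natl.
        by apply: cvg_expr; rewrite ger0_norm ?expR_ge0// expR_lt1 oppr_lt0.
      have h : (fun k : nat => expR (- expR (- (k%:R * f y)))) @ \oo --> expR (- 0 : R).
        by apply: (continuous_cvg _ (@continuous_expR R _)); exact: (cvgN c).
      by rewrite oppr0 expR0 in h.
    + apply: (@squeeze_cvgr _ _ _ _ (fun=> 0) (fun k => expR (f y) ^+ k)).
      * apply: nearW => k; rewrite expR_ge0/= -expRM_natl ler_expR.
        by have := expR_ge1Dx (- (k%:R * f y)); lra.
      * exact: cvg_cst.
      * by apply: cvg_expr; rewrite ger0_norm ?expR_ge0// expR_lt1.
    + by under eq_fun do rewrite -fy mulr0 oppr0 expR0; exact: cvg_cst.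
apply: (@real_stable_lim 1 (fun k y => v y ^+ k)).
- by move=> k; exact: (real_stableX k sv).
- move=> k y; rewrite normrX exprn_ile1// /v; case: ifP => _; first by rewrite normr1.
  case: ifP => _; last by rewrite normr0.
  by rewrite ger0_norm ?expR_ge0// expR_le1 lerN10.
- move=> y; rewrite /v; case: ifP => _; first by under eq_fun do rewrite expr1n; exact: cvg_cst.
  apply: cvg_expr; case: ifP => _; last by rewrite normr0.
  by rewrite ger0_norm ?expR_ge0// expR_lt1 ltrN10.
Qed.

Lemma real_stable_sin (h c : R) i : real_stable (fun y => sin (h * (c - y 0 i))).
Proof.
pose s : 'rV[R]_N := h *: delta_mx 0 i.
have ds y : dot s y = h * y 0 i.
  rewrite dotZ; congr (_ * _); rewrite /dot (bigD1 i)//= big1; last first.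
    by move=> j ji; rewrite mxE (negbTE ji) mul0r.
  by rewrite mxE !eqxx mul1r addr0.
have dNs y : dot (- s) y = - (h * y 0 i) by rewrite -scaleN1r dotZ ds mulN1r.
(* The coefficients of [sin (A - B) = sin A cos B - cos A sin B] on the characters with phases [B]
   and [- B], for [A = h * c] and [B = h * y 0 i]. *)
pose a : R[i] := Complex (sin (h * c) / 2) (cos (h * c) / 2).
pose b : R[i] := Complex (sin (h * c) / 2) (- cos (h * c) / 2).
rewrite /real_stable (_ : (fun y => _) = fun y => a * expi s y + b * expi (- s) y).
  exact: (stable_classD (stable_classM (stable_class_cst a) (stable_class_expi s))
    (stable_classM (stable_class_cst b) (stable_class_expi (- s)))).
apply/funext => y; apply: complex_ext; rewrite ?ReD ?ImD ?ReM ?ImM /= ds dNs cosN sinN.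
  by rewrite mulrBr sinB; field.
by field.
Qed.

(** Once [|h * (c - y 0 i)| < pi], the sine of this number is positive exactly when [c - y 0 i] is.
    Letting [h] tend to 0 reaches every [y], so a half-space is a limit of periodic sets. *)
Lemma real_stable_halfspace (c : R) i : real_stable (fun y => (c <= y 0 i)%R%:R).
Proof.
under eq_fun do rewrite leNgt.
have -> : (fun y : 'rV[R]_N => (~~ (y 0 i < c))%:R) = fun y => 1 - (y 0 i < c)%R%:R :> R.
  by apply/funext => y; case: (_ < _); rewrite ?subrr ?subr0.
apply: (real_stableB (real_stable_cst 1)).
apply: (@real_stable_lim 1 (fun k y => (0 < sin (k.+1%:R^-1 * (c - y 0 i)))%R%:R)).
- by move=> k; apply: real_stable_positive; exact: real_stable_sin.
- by move=> k y; case: (_ < _); rewrite ?normr1 ?normr0.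
- move=> y; apply: cvg_near_cst.
  pose z := c - y 0 i.
  have [k0 _ Hk0] : \forall k \near \oo, `|k.+1%:R^-1 * z| < pi.
    have h : (fun k => k.+1%:R^-1 * z) @ \oo --> (0 : R).
      by rewrite -(mul0r z); apply: cvgM; [exact: cvg_harmonic|exact: cvg_cst].
    have /cvgr0Pnorm_lt := h; apply; exact: pi_gt0.
  exists k0 => // k /= /Hk0 /=; rewrite -/z.
  have k1 : 0 < (k.+1%:R^-1 : R) by rewrite invr_gt0.
  rewrite ltr_norml => /andP[h1 h2]; congr (nat_of_bool _)%:R.
  rewrite -(subr_gt0 (y 0 i) c) -/z; apply/idP/idP => hz; last first.
    by apply: sin_gt0_pi; rewrite mulr_gt0.
  rewrite ltNge; apply/negP => z0; move: hz; apply/negP; rewrite -leNgt.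
  rewrite -oppr_ge0 -sinN; apply: sin_ge0_pi; apply/andP; split; last by rewrite lerNl ltW.
  by rewrite oppr_ge0 pmulr_rle0.
Qed.

(** Step functions on a grid of mesh [1 / (k + 1)] over the cube of half-width [k + 1] converge
    pointwise to [f]. They are combinations of products of differences of half-space indicators, and
    disjointness of the cells keeps the bound [B]. *)
Lemma real_stable_continuous f (B : R) : continuous f -> (forall y, `|f y| <= B) ->
  real_stable f.
Proof.
move=> cf fB.
pose a (k l : nat) : R := l%:R / k.+1%:R - k.+1%:R.
pose cell k l y i : R := (a k l <= y 0 i)%R%:R - (a k l.+1 <= y 0 i)%R%:R.
(* The number of cells per axis: the length [2 * (k + 1)] divided by the mesh. *)
pose L k := (2 * k.+1 * k.+1)%N.
have aE k l (z : R) : (a k l <= z) = (l%:R <= (z + k.+1%:R) * k.+1%:R).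
  by rewrite /a lerBlDr ler_pdivrMr.
have cellE k l y i : cell k l y i =
    ((l%:R <= (y 0 i + k.+1%:R) * k.+1%:R) && ((y 0 i + k.+1%:R) * k.+1%:R < l.+1%:R))%R%:R.
  rewrite /cell !aE ltNge; case: (leP l.+1%:R) => h; last first.
    by rewrite subr0 andbT.
  rewrite (_ : (l%:R <= _) = true) ?subrr//.
  by apply: le_trans h; rewrite ler_nat.
pose f_ k y : R := \sum_(q : {ffun 'I_N -> 'I_(L k)}) f (\row_i a k (q i)) *
  \prod_(i < N) cell k (q i) y i.
pose inside k (q : {ffun 'I_N -> 'I_(L k)}) y := forall i,
  (q i)%:R <= (y 0 i + k.+1%:R) * k.+1%:R < (q i).+1%:R.
have f_in k q y : inside k q y -> f_ k y = f (\row_i a k (q i)).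
  move=> qy; rewrite /f_ (bigD1 q)//= [X in _ + X]big1 ?addr0.
    by rewrite big1 ?mulr1// => i _; rewrite cellE qy.
  move=> q' qq'; have [i qi] : exists i, q' i != q i.
    apply/existsP; rewrite -negb_forall; apply: contra qq' => /forallP h.
    by apply/eqP/ffunP => i; apply/eqP.
  rewrite (bigD1 i)//= cellE; case: (boolP (_ && _)) => [/andP[h1 h2]|_]; last first.
    by rewrite mul0r mulr0.
  have /andP[h3 h4] := qy i; exfalso; move/negP: qi; apply; apply/eqP/val_inj/eqP.
  have e1 : (q' i < (q i).+1)%N by rewrite -(ltr_nat R); exact: le_lt_trans h1 h4.
  have e2 : (q i < (q' i).+1)%N by rewrite -(ltr_nat R); exact: le_lt_trans h3 h2.
  by rewrite /= eqn_leq -ltnS e1 -ltnS e2.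
have f_out k y : (forall q, ~ inside k q y) -> f_ k y = 0.
  move=> nq; rewrite /f_ big1// => q _.
  have [i ni] : exists i, ~~ ((q i)%:R <= (y 0 i + k.+1%:R) * k.+1%:R < (q i).+1%:R).
    apply: contrapT => h; apply: (nq q) => i; apply: contrapT => /negP h'.
    by apply: h; exists i.
  by rewrite (bigD1 i)//= cellE (negbTE ni) mul0r mulr0.
have B0 : 0 <= B by apply: le_trans (fB 0).
apply: (@real_stable_lim B f_).
- move=> k; apply: real_stable_sum => q; apply: (real_stableM (real_stable_cst _)).
  apply: real_stable_prod => i.
  exact: (real_stableB (real_stable_halfspace _ i) (real_stable_halfspace _ i)).
- move=> k y; have [[q qy]|nq] := pselect (exists q, inside k q y).
    by rewrite (f_in _ _ _ qy).
  by rewrite f_out ?normr0// => q qy; apply: nq; exists q.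
move=> y; apply/cvgrPdist_lt => e e0.
have /nbhs_ballP[r/= r0 Hr] : \forall z \near y, `|f y - f z| < e.
  by have /cvgrPdist_lt := cf y; apply.
have [k1 _ Hk1] := near_infty_natSinv_lt (PosNum r0).
(* The first threshold makes the mesh smaller than [r], the second puts [y] inside the cube. *)
exists (maxn k1 (Num.truncn (norm1 y))) => // k /=; rewrite geq_max => /andP[k1k yk].
have k0 : 0 < k.+1%:R :> R by rewrite ltr0n.
have {}yk : norm1 y < k.+1%:R.
  by apply: lt_le_trans (truncnS_gt _) _; rewrite ler_nat.
have yi i : `|y 0 i| < k.+1%:R.
  by apply: le_lt_trans yk; rewrite /norm1 (bigD1 i)//= lerDl sumr_ge0.
pose x i : R := (y 0 i + k.+1%:R) * k.+1%:R.
have x0 i : 0 <= x i.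
  by have := yi i; rewrite ltr_norml => /andP[h _]; rewrite mulr_ge0//; lra.
have xL i : (Num.truncn (x i) < L k)%N.
  rewrite -(ltr_nat R); apply: le_lt_trans (_ : x i < _); first by rewrite truncn_le// x0.
  rewrite /x /L !natrM ltr_pM2r// mulr_natl mulr2n ltrD2r.
  by have := yi i; rewrite ltr_norml => /andP[].
pose q : {ffun 'I_N -> 'I_(L k)} := [ffun i => Ordinal (xL i)].
have qy : inside k q y by move=> i; rewrite ffunE/= truncn_itv// x0.
rewrite (f_in _ _ _ qy); apply: Hr; split => // j i; rewrite ord1 /ball/= mxE.
apply: le_lt_trans (Hk1 k k1k); rewrite /a; have /andP[h1 h2] := qy i.
have -> : y 0 i - ((q i)%:R / k.+1%:R - k.+1%:R) =
    ((y 0 i + k.+1%:R) * k.+1%:R - (q i)%:R) * k.+1%:R^-1 by field; rewrite gt_eqF.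
rewrite normrM normfV (gtr0_norm k0); apply: ler_piMl; first by rewrite invr_ge0 ltW.
have e1 : (q i).+1%:R = (q i)%:R + 1 :> R by rewrite -natr1.
rewrite e1 in h2; rewrite ler_norml; apply/andP; split; lra.
Qed.

End BoundedCylinders.

(** * The derivative on cylinder functions and its closure *)

Section NullCountable.
Context {R : realType} {d : nat}.
Variable sigma : {measure set (Rd R d) -> \bar R}.
Hypothesis sigma_non_atomic : non_atomic sigma.

Lemma Rintegral_off_countable (A : set 'rV[R]_d) (h : Rd R d -> R) : countable A ->
  measurable_fun setT h ->
  \int[sigma]_x (if x \in A then 0 else h x) = \int[sigma]_x h x.
Proof.
move=> cA mh; have mA : measurable (A : set (Rd R d)).
  by apply: countable_measurable => // x; exact: measurable_set1_Rd.
have mh' : measurable_fun setT (fun x : Rd R d => if x \in A then 0 else h x).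
  rewrite (_ : (fun x => _) = fun x => \1_(~` A) x * h x).
    by apply: measurable_funM => //; apply: measurable_indic; exact: measurableC.
  by apply/funext => x; rewrite indicE in_setC; case: ifP; rewrite ?mul0r ?mul1r.
congr fine; apply: ae_eq_integral => //; [exact/measurable_EFinP|exact/measurable_EFinP|].
apply: negligibleS (negligible_countable sigma_non_atomic cA) => x /= h'.
apply: contrapT => nA; apply: h' => _ /=; case: ifP => //.
by rewrite inE.
Qed.

End NullCountable.

Section SmoothBounded.
Context {R : realType} {N : nat}.
Implicit Types f g : 'rV[R]_N -> R.

Let bc f := continuous f /\ exists M : R, forall x, `|f x| <= M.

Let bc_cst (c : R) : bc (fun=> c).
Proof. by split; [exact: cst_continuous|exists `|c|]. Qed.

Let bcD f g : bc f -> bc g -> bc (fun x => f x + g x).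
Proof.
move=> [cf [M fM]] [cg [M' gM]]; split; first by move=> x; exact: (cvgD (cf x) (cg x)).
by exists (M + M') => x; apply: le_trans (ler_normD _ _) _; exact: lerD.
Qed.

Let bcM f g : bc f -> bc g -> bc (fun x => f x * g x).
Proof.
move=> [cf [M fM]] [cg [M' gM]]; split; first by move=> x; exact: (cvgM (cf x) (cg x)).
by exists (M * M') => x; rewrite normrM ler_pM.
Qed.

Lemma smooth_boundedP f : smooth_bounded f <-> forall k, smoothn bc k f.
Proof.
split=> [[sf bf]|H].
  apply/smoothnP => s; have [cs ds] := sf s; split=> //; split => //; exact: bf.
have /smoothnP {}H := H; split=> s; have [[cs bs] ds] := H s; by [].
Qed.

Lemma smooth_bounded_sum I (r : seq I) (f : I -> 'rV[R]_N -> R) :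
  (forall i, smooth_bounded (f i)) -> smooth_bounded (fun x => \sum_(i <- r) f i x).
Proof.
move=> sf; apply/smooth_boundedP => k; apply: (smoothn_sum bc_cst bcD) => i.
exact: ((smooth_boundedP _).1 (sf i) k).
Qed.

Lemma smooth_boundedZ (c : R) f : smooth_bounded f -> smooth_bounded (fun x => c * f x).
Proof.
move=> /smooth_boundedP sf; apply/smooth_boundedP => k.
exact: (smoothnM bcD bcM (smoothn_cst bc_cst k c) (sf k)).
Qed.

(* A bounded approximation of [exp (y_j)] as [e] tends to 0. *)
Definition bounded_exp (e : R) (j : 'I_N) (y : 'rV[R]_N) : R := (e + expR (- y 0 j))^-1.

Lemma bounded_exp_denominator (e : R) j (y : 'rV[R]_N) : 0 < e -> 0 < e + expR (- y 0 j).
Proof. by move=> e0; rewrite addr_gt0// expR_gt0. Qed.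

Lemma bounded_exp_ge0 (e : R) j (y : 'rV[R]_N) : 0 < e -> 0 <= bounded_exp e j y.
Proof. by move=> e0; rewrite invr_ge0 ltW// bounded_exp_denominator. Qed.

Lemma bounded_exp_bound e j y : 0 < e -> bounded_exp e j y <= e^-1.
Proof.
move=> e0; rewrite lef_pV2 ?posrE ?bounded_exp_denominator//.
by rewrite lerDl expR_ge0.
Qed.

Lemma bounded_exp_le e j y : 0 < e -> bounded_exp e j y <= expR (y 0 j).
Proof.
move=> e0; have -> : expR (y 0 j) = (expR (- y 0 j))^-1 by rewrite expRN invrK.
by rewrite lef_pV2 ?posrE ?bounded_exp_denominator ?expR_gt0// lerDr ltW.
Qed.

Lemma is_derive_coord (x v : 'rV[R]_N) j :
  is_derive x v (fun y : 'rV[R]_N => y 0 j) (v 0 j).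
Proof.
have c : (fun h : R => h^-1 *: (((fun y : 'rV[R]_N => y 0 j) \o shift x) (h *: v) - x 0 j))
    @ 0^' --> v 0 j.
  apply: cvg_near_cst; rewrite near_withinE; apply: nearW => h /= h0.
  by rewrite !mxE addrK scalerA mulVf ?scale1r//; apply/eqP.
by apply: DeriveDef; [apply/cvg_ex; eexists; exact: c|exact: (cvg_lim _ c)].
Qed.

Lemma smooth_coord j : smooth (fun y : 'rV[R]_N => y 0 j).
Proof.
apply/smoothP => -[|k]; first by split=> //; exact: coord_continuous.
apply: smoothn_step; first exact: coord_continuous.
move=> i l; exists (fun=> (delta_mx i l : 'rV[R]_N) 0 j).
  by apply: smoothn_cst => c; exact: cst_continuous.
by move=> x; exact: is_derive_coord.
Qed.

(** In direction [j] the function [G = bounded_exp e j] satisfies [G' = G - e * G ^+ 2], so its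
    derivatives of all orders are polynomials in the bounded function [G]. *)
Lemma smooth_bounded_exp e j : 0 < e -> smooth_bounded (bounded_exp e j).
Proof.
move=> e0; apply/smooth_boundedP.
have dn0 (x : 'rV[R]_N) : e + expR (- x 0 j) != 0 by rewrite gt_eqF ?bounded_exp_denominator.
have sden : smooth (fun y : 'rV[R]_N => e + expR (- y 0 j)).
  apply: smoothD; first exact: smooth_cst.
  apply: smooth_exp; under eq_fun do rewrite -mulN1r.
  exact: (smoothZ (-1) (smooth_coord j)).
have bG : bc (bounded_exp e j).
  split; first by apply: smooth_continuous; exact: smoothV.
  by exists e^-1 => y; rewrite ger0_norm ?bounded_exp_ge0// bounded_exp_bound.
elim=> [|k IH]; first by split.
apply: smoothn_step => // i l.
pose G := bounded_exp e j; pose D := (delta_mx i l : 'rV[R]_N).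
exists (fun y => D 0 j * (G y + (- e) * (G y * G y))).
  apply: (smoothnM bcD bcM (smoothn_cst bc_cst k _)).
  apply: (smoothnD bcD IH); apply: (smoothnM bcD bcM (smoothn_cst bc_cst k _)).
  exact: (smoothnM bcD bcM IH IH).
move=> x.
have dN : is_derive x D (fun y : 'rV[R]_N => - y 0 j) (- D 0 j).
  exact: (is_deriveN (is_derive_coord x D j)).
have [dN1 dN2] := dN.
have dE := is_derive_outer (is_derive_expR (- x 0 j)) dN1; rewrite dN2 in dE.
have [dS1 dS2] : is_derive x D (fun y : 'rV[R]_N => e + expR (- y 0 j)) (expR (- x 0 j) * - D 0 j).
  by have := is_deriveD (is_derive_cst e x D) dE; rewrite add0r.
apply: DeriveDef; first exact: derivableV.
rewrite deriveV// dS2 /G /bounded_exp.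
set E := expR _; have n0 : e + E != 0 by exact: dn0.
have -> : - (e + E) ^- 2 *: (E * - D 0 j) = - (e + E) ^- 2 * (E * - D 0 j) by [].
by field.
Qed.

End SmoothBounded.

Section NablaClosure.
Context {R : realType} {d : nat}.
Variable sigma : {measure set (Rd R d) -> \bar R}.
Hypothesis sigma_radon : radon sigma.
Hypothesis sigma_non_atomic : non_atomic sigma.
Variable P : probability (Gamma R d) R.
Hypothesis P_poisson : is_poisson sigma P.
Variable phi : 'rV[R]_d -> R.
Hypothesis phi_test : test_function phi.

Let mphi : measurable_fun setT (phi : Rd R d -> R).
Proof. by apply: continuous_measurable_Rd; exact: test_continuous. Qed.

(** At a point of [gam] the difference vanishes because [add_point] returns [gam]; at any other
    point it is a translation of the pairings. The two integrands differ on the countable set [gam]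
    only, which is null since [sigma] is non-atomic. *)
Lemma nablaP_cylinder N (phis : 'I_N -> 'rV[R]_d -> R) (F : 'rV[R]_N -> R[i]) gam :
  (forall i, test_function (phis i)) -> slice_measurable phis F ->
  nablaP sigma phi (fun gam => F (pairings phis gam)) gam = nabla sigma phi phis F gam.
Proof.
move=> tp mF; pose y := pairings phis gam.
have E1 x : ~ points gam x -> pairings phis (add_point gam x) = y + shifts phis x.
  move=> gx; apply/rowP => i; rewrite !mxE.
  by rewrite (pairing_add_point (tp i) _ gx).
have E2 x : points gam x -> pairings phis (add_point gam x) = y.
  move=> gx; apply/rowP => i; rewrite !mxE /pairing /= setUidl//.
  by move=> _ ->.
have E x : (F (pairings phis (add_point gam x)) - F y) * (phi x)%:C%C =
    if x \in points gam then 0 else (F (y + shifts phis x) - F y) * (phi x)%:C%C.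
  case: ifPn => [|] /=; rewrite ?notin_setE ?inE => gx; first by rewrite E2// subrr mul0r.
  by rewrite E1.
have [mR mI] := mF y.
rewrite /nablaP /cintegral /nabla /nabla_real; congr Complex.
  rewrite -[RHS](Rintegral_off_countable sigma_non_atomic (config_countable gam)).
    apply: eq_Rintegral => x _; rewrite E; case: ifP => // _.
    by rewrite ReM ReD ReN /= mulr0 subr0.
  by apply: measurable_funM => //; apply: measurable_funB => //; exact: measurable_cst.
rewrite -[RHS](Rintegral_off_countable sigma_non_atomic (config_countable gam)).
  apply: eq_Rintegral => x _; rewrite E; case: ifP => // _.
  by rewrite ImM ImD ImN /= mulr0 add0r.
by apply: measurable_funM => //; apply: measurable_funB => //; exact: measurable_cst.
Qed.

Lemma smooth_bounded_closure_class N (phis : 'I_N -> 'rV[R]_d -> R) (F : 'rV[R]_N -> R[i]) :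
  (forall i, test_function (phis i)) -> smooth_bounded (fun y => complex.Re (F y)) ->
  smooth_bounded (fun y => complex.Im (F y)) -> closure_class sigma P phi phis F.
Proof.
move=> tp sR sI.
have st (f : 'rV[R]_N -> R) : smooth_bounded f -> real_stable sigma P phi phis f.
  move=> [/(_ [::])[cf _] /(_ [::])[B fB]].
  exact: (real_stable_continuous sigma_radon P_poisson phi_test tp cf fB).
apply: (stable_class_closure sigma_radon P_poisson phi_test tp).
have i_ := stable_class_cst sigma_radon P phi_test tp (Complex 0 1).
have := stable_classD sigma_radon phi_test tp (st _ sR) (stable_classM i_ (st _ sI)).
congr stable_class; apply/funext => y.
by apply: complex_ext; rewrite ?ReD ?ImD ?ReM ?ImM/=; ring.
Qed.

Lemma cylinder_closure f : cylinder f -> wick_closure sigma P phi f (nablaP sigma phi f).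
Proof.
move=> [N [phis [F [tp sR sI fE]]]]; have [mF _ H] := smooth_bounded_closure_class tp sR sI.
have -> : f = fun gam => F (pairings phis gam) by apply/funext => gam; exact: fE.
have -> // : nablaP sigma phi (fun gam => F (pairings phis gam)) = nabla sigma phi phis F.
by apply/funext => gam; exact: nablaP_cylinder.
Qed.

Lemma nabla_real_exp N (psi : 'I_N -> 'rV[R]_d -> R) (a : 'I_N -> R) (y : 'rV[R]_N) :
  (forall j, test_function (psi j)) -> (forall j x, -1 < psi j x) ->
  nabla_real sigma phi (fun j x => ln (1 + psi j x)) (fun y => \sum_j a j * expR (y 0 j)) y =
  \sum_j a j * expR (y 0 j) * \int[sigma]_x (phi x * psi j x).
Proof.
move=> tp p1; rewrite /nabla_real.
have it j : sigma.-integrable setT (EFin \o (fun x => phi x * psi j x)).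
  by apply: (integrable_test sigma_radon); apply: testM => //; case: phi_test.
under [RHS]eq_bigr do rewrite -RintegralZl//.
rewrite -Rintegral_sum => [|j]; last first.
  by have := integrableZl measurableT (a j * expR (y 0 j)) (it j); under eq_fun do rewrite -EFinM.
apply: eq_Rintegral => x _; rewrite -sumrB mulr_suml; apply: eq_bigr => j _.
rewrite !mxE expRD lnK ?posrE; first by ring.
by have := p1 j x; lra.
Qed.

(** [nablaP_graph] is closed without taking a linear span, so a whole combination of Wick
    exponentials is approximated at once, by cylinder functions with one coordinate [ln (1 + psi j)]
    per exponential and [bounded_exp] in place of the exponential. *)
Lemma wick_span_nablaP F G : graph_span (wick_graph sigma phi) F G ->
  graph_closure (L2 P) (L2 P) (nablaP_graph sigma phi) F G.
Proof.
move=> [N [c [vs [ws [H -> ->]]]]].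
have /choice[psi Hpsi] := H.
have tp j : test_function (psi j) by case: (Hpsi j).
have p1 j x : -1 < psi j x by case: (Hpsi j).
pose phis j x := ln (1 + psi j x); have tphis j : test_function (phis j) by exact: test_ln.
(* The normalization that turns the exponential of the [j]-th pairing into a Wick exponential. *)
pose k j : R := expR (- \int[sigma]_x psi j x).
pose e (n : nat) : R := n.+1%:R^-1; have e0 n : 0 < e n by rewrite invr_gt0.
pose F_ n (y : 'rV[R]_N) := \sum_j c j * (k j * bounded_exp (e n) j y)%:C%C.
pose F' (y : 'rV[R]_N) := \sum_j c j * (k j * expR (y 0 j))%:C%C.
have ReE (h : 'I_N -> R) :
    complex.Re (\sum_j c j * (k j * h j)%:C%C) = \sum_j (complex.Re (c j) * k j) * h j.
  by rewrite Re_sum; apply: eq_bigr => j _; rewrite ReM/= mulr0 subr0 mulrA.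
have ImE (h : 'I_N -> R) :
    complex.Im (\sum_j c j * (k j * h j)%:C%C) = \sum_j (complex.Im (c j) * k j) * h j.
  by rewrite Im_sum; apply: eq_bigr => j _; rewrite ImM/= mulr0 add0r mulrA.
have sR n : smooth_bounded (fun y => complex.Re (F_ n y)).
  under eq_fun do rewrite ReE; apply: smooth_bounded_sum => j.
  by apply: smooth_boundedZ; exact: smooth_bounded_exp.
have sI n : smooth_bounded (fun y => complex.Im (F_ n y)).
  under eq_fun do rewrite ImE; apply: smooth_bounded_sum => j.
  by apply: smooth_boundedZ; exact: smooth_bounded_exp.
have CCn n := smooth_bounded_closure_class tphis (sR n) (sI n).
have mS n : slice_measurable phis (F_ n) by case: (CCn n).
have le1 j (y : 'rV[R]_N) : expR (y 0 j) <= expR (1 * norm1 y).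
  rewrite mul1r ler_expR; apply: le_trans (ler_norm _) _.
  by rewrite /norm1 (bigD1 j)//= lerDl sumr_ge0.
have bnd n (y : 'rV[R]_N) (a : 'I_N -> R) :
    `|\sum_j a j * bounded_exp (e n) j y| <= (\sum_j `|a j|) * expR (1 * norm1 y).
  apply: le_trans (ler_norm_sum _ _ _) _; rewrite mulr_suml; apply: ler_sum => j _.
  rewrite normrM ler_wpM2l// ger0_norm ?bounded_exp_ge0//.
  by apply: le_trans (le1 j y); exact: bounded_exp_le.
pose K := \sum_j `|complex.Re (c j) * k j| + \sum_j `|complex.Im (c j) * k j|.
have FK n : cexp_bounded K 1 (F_ n).
  split=> y; rewrite ?ReE ?ImE; apply: le_trans (bnd n y _) _; rewrite ler_wpM2r ?expR_ge0//.
    by rewrite lerDl sumr_ge0.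
  by rewrite lerDr sumr_ge0.
have cvg1 j (y : 'rV[R]_N) : (fun n => bounded_exp (e n) j y) @ \oo --> expR (y 0 j).
  have -> : expR (y 0 j) = (0 + expR (- y 0 j))^-1 by rewrite add0r expRN invrK.
  apply: cvgV; first by rewrite add0r gt_eqF// expR_gt0.
  by apply: cvgD; [exact: cvg_harmonic|exact: cvg_cst].
have cvgs (a : 'I_N -> R) (y : 'rV[R]_N) :
    (fun n => \sum_j a j * bounded_exp (e n) j y) @ \oo --> \sum_j a j * expR (y 0 j).
  by apply: cvg_big => [|j _]; [exact: add_continuous|apply: cvgM]; [exact: cvg_cst|exact: cvg1].
have cF : ccvg F_ F'.
  move=> y; split.
    by under eq_fun do rewrite ReE; rewrite ReE; exact: cvgs.
  by under eq_fun do rewrite ImE; rewrite ImE; exact: cvgs.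
have mW n : cmeasurable (fun gam => F_ n (pairings phis gam)) /\
    cmeasurable (nabla sigma phi phis (F_ n)).
  have [_ _ [m1 m2 _]] := CCn n; split; [exact: (square_integrable_measurable m1)|exact: (square_integrable_measurable m2)].
have [s1 s2 l1 l2] := nabla_dominated sigma_radon P_poisson phi_test tphis ler01 FK mS
  (fun n => (mW n).1) (fun n => (mW n).2) cF.
have wE j gam : k j * expR (pairings phis gam 0 j) = wick sigma (psi j) gam.
  by rewrite /wick mxE expRD mulrC.
have EF : (fun gam => F' (pairings phis gam)) = fun gam => \sum_j c j * vs j gam.
  apply/funext => gam; apply: eq_bigr => j _; rewrite wE.
  by have [_ _ -> _] := Hpsi j.
have EG : nabla sigma phi phis F' = fun gam => \sum_j c j * ws j gam.
  apply/funext => gam; apply: complex_ext => /=.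
    rewrite (_ : (fun y => _) = fun y : 'rV[R]_N => \sum_j (complex.Re (c j) * k j) * expR (y 0 j)).
      rewrite nabla_real_exp// Re_sum; apply: eq_bigr => j _.
      have [_ _ _ ->] := Hpsi j; rewrite -wE ReM/= mulr0 subr0.
      by ring.
    by apply/funext => y; rewrite ReE.
  rewrite (_ : (fun y => _) = fun y : 'rV[R]_N => \sum_j (complex.Im (c j) * k j) * expR (y 0 j)).
    rewrite nabla_real_exp// Im_sum; apply: eq_bigr => j _.
    have [_ _ _ ->] := Hpsi j; rewrite -wE ImM/= mulr0 add0r.
    by ring.
  by apply/funext => y; rewrite ImE.
rewrite EF in s1 l1; rewrite EG in s2 l2.
split=> //; exists (fun n gam => F_ n (pairings phis gam)), (fun n => nabla sigma phi phis (F_ n)).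
split=> // n; split; first by exists N, phis, (F_ n).
by apply/funext => gam; rewrite nablaP_cylinder.
Qed.

Lemma nablaP_closureE F G :
  graph_closure (L2 P) (L2 P) (nablaP_graph sigma phi) F G <-> wick_closure sigma P phi F G.
Proof.
split=> [[sF sG [vs [ws [H l1 l2]]]]|].
  apply: (L2_closure_cvg (@wick_graph_cmeasurable _ _ sigma phi) _ sF sG l1 l2) => n.
  by have [cf ->] := H n; exact: cylinder_closure.
move=> /(L2_closureP P P (wick_graph sigma phi))[sF sG H].
have q := L2_quadratic P.
apply: (graph_closure_lim q q _ _ _ sF sG).
- by move=> v; exact: square_integrable_measurable.
- by move=> v; exact: square_integrable_measurable.
- move=> v w [cf ->]; have [m1 m2 _] := cylinder_closure cf.
  by split; [exact: (square_integrable_measurable m1)|exact: (square_integrable_measurable m2)].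
move=> e e0; have [v [w [s h1 h2]]] := H _ e0; exists v, w; split=> //.
exact: wick_span_nablaP.
Qed.

End NablaClosure.

(** * Product measures and symmetric tensors *)

Definition tuple_cons {T : Type} {n} (p : (n.-tuple T * T)%type) : n.+1.-tuple T :=
  [tuple of p.2 :: p.1].

Section SigmaFinite.
Context {R : realType} {d1 d2 : measure_display}.
Context {T1 : measurableType d1} {T2 : measurableType d2}.

Lemma pushforward_sigma_finite (m : {sigma_finite_measure set T1 -> \bar R})
    (f : T1 -> T2) (g : T2 -> T1) :
  measurable_fun setT f -> measurable_fun setT g -> cancel f g ->
  exists M : {sigma_finite_measure set T2 -> \bar R},
    pushforward m f = M :> (set T2 -> \bar R).
Proof.
move=> mf mg fg.
pose N := measure_function_pushforward__canonical__measure_function_Measure m mf.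
have sf : sigma_finite setT (pushforward m f).
  have [F FT HF] := sigma_finiteT m.
  exists (fun k => g @^-1` F k); first by rewrite -preimage_bigcup -FT preimage_setT.
  move=> k; have [mF fF] := HF k; split.
    by rewrite -[X in measurable X]setTI; exact: mg.
  rewrite /pushforward (_ : f @^-1` _ = F k)//.
  by apply/seteqP; split => x /=; rewrite fg.
pose X := Measure_isSigmaFinite.Build _ _ _ (Measure.sort N) sf.
by exists (HB.pack_for {sigma_finite_measure set T2 -> \bar R} (Measure.sort N) X).
Qed.

Lemma product_measure_sfm (m1 : {sigma_finite_measure set T1 -> \bar R})
    (m2 : {sigma_finite_measure set T2 -> \bar R}) :
  exists M : {sigma_finite_measure set (T1 * T2)%type -> \bar R},
    (m1 \x m2)%E = M :> (set (T1 * T2)%type -> \bar R).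
Proof.
have sf : sigma_finite setT (m1 \x m2)%E.
  have /sigma_finiteP[F [FT ndF HF]] := sigma_finiteT m1.
  have /sigma_finiteP[G [GT ndG HG]] := sigma_finiteT m2.
  exists (fun n => F n `*` G n).
    apply/seteqP; split=> [[x y] _|] //.
    have [i _ Fx] : (\bigcup_i F i) x by rewrite -FT.
    have [j _ Gy] : (\bigcup_j G j) y by rewrite -GT.
    exists (maxn i j) => //; split.
      by have /subsetPset := ndF _ _ (leq_maxl i j); apply.
    by have /subsetPset := ndG _ _ (leq_maxr i j); apply.
  move=> n; have [mF fF] := HF n; have [mG fG] := HG n; split; first exact: measurableX.
  by rewrite product_measure1E// lte_mul_pinfty// ge0_fin_numE.
pose N := lebesgue_integral_fubini_product_measure1__canonical__measure_function_Measure m1 m2.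
pose X := Measure_isSigmaFinite.Build _ _ _ (Measure.sort N) sf.
by exists (HB.pack_for {sigma_finite_measure set (T1 * T2)%type -> \bar R} (Measure.sort N) X).
Qed.

End SigmaFinite.

Section TensorMeasure.
Context {R : realType} {disp : measure_display} {T : measurableType disp}.
Variable mu : {sigma_finite_measure set T -> \bar R}.
Local Open Scope ereal_scope.

Lemma measurable_tuple_cons n : measurable_fun setT (@tuple_cons T n).
Proof. by apply: measurable_cons. Qed.

Lemma measurable_tuple_uncons n :
  measurable_fun setT (fun t : n.+1.-tuple T => ([tuple of behead t], thead t)).
Proof.
apply/measurable_fun_pairP; split; first exact: measurable_behead.
exact: measurable_tnth.
Qed.

(** [tensor_measure] is defined on bare set functions, and the measure structure in degree [n + 1]
    presupposes the one in degree [n]. It is therefore obtained first as an existential, by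
    induction, and attached to [tensor_measure] by the instances below. *)
Lemma tensor_measure_sigma_finite n :
  exists M : {sigma_finite_measure set (n.-tuple T) -> \bar R},
    tensor_measure mu (n := n) = M :> (set _ -> \bar R).
Proof.
elim: n => [|n [M ME]]; first by exists (dirac [tuple]).
have [K KE] := product_measure_sfm M mu.
have [|N NE] := pushforward_sigma_finite K (@measurable_tuple_cons n) (@measurable_tuple_uncons n).
  by move=> -[t x]; rewrite /tuple_cons /= theadE; congr pair; exact/val_inj.
by exists N; rewrite -NE -KE -ME.
Qed.

Let tm0 n : tensor_measure mu (n := n) set0 = 0.
Proof. by have [M ->] := tensor_measure_sigma_finite n; exact: measure0. Qed.

Let tm_ge0 n A : 0 <= tensor_measure mu (n := n) A.
Proof. by have [M ->] := tensor_measure_sigma_finite n; exact: measure_ge0. Qed.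

Let tm_additive n : semi_sigma_additive (tensor_measure mu (n := n)).
Proof.
by have [M ->] := tensor_measure_sigma_finite n; exact: measure_semi_sigma_additive.
Qed.

Let tm_sigma_finite n : sigma_finite setT (tensor_measure mu (n := n)).
Proof. by have [M ->] := tensor_measure_sigma_finite n; exact: sigma_finiteT. Qed.

HB.instance Definition _ n := isMeasure.Build _ _ _ (tensor_measure mu (n := n))
  (tm0 n) (@tm_ge0 n) (@tm_additive n).

HB.instance Definition _ n :=
  Measure_isSigmaFinite.Build _ _ _ (tensor_measure mu (n := n)) (tm_sigma_finite n).

Lemma tensor_measureS n : tensor_measure mu (n := n.+1) =
  pushforward (tensor_measure mu (n := n) \x mu) (@tuple_cons T n).
Proof. by []. Qed.

Lemma integral_tensorS n (f : n.+1.-tuple T -> \bar R) : measurable_fun setT f ->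
  (forall t, 0 <= f t) ->
  \int[tensor_measure mu (n := n.+1)]_t f t =
  \int[tensor_measure mu (n := n)]_t \int[mu]_x f (tuple_cons (t, x)).
Proof.
move=> mf f0; have mc := @measurable_tuple_cons n.
rewrite tensor_measureS (ge0_integral_pushforward mc) ?preimage_setT//.
rewrite fubini_tonelli1//; first exact: measurableT_comp.
by move=> p; exact: f0.
Qed.

Lemma measurable_tensor_slice n (f : n.+1.-tuple T -> \bar R) : measurable_fun setT f ->
  (forall t, 0 <= f t) ->
  measurable_fun setT (fun t : n.-tuple T => \int[mu]_x f (tuple_cons (t, x))).
Proof.
move=> mf f0; have mc := @measurable_tuple_cons n.
exact: (@measurable_fun_fubini_tonelli_F _ _ _ _ _ mu _ (measurableT_comp mf mc) (fun p => f0 _)).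
Qed.

Local Close Scope ereal_scope.

Lemma measurable_prod_tnth n (g : 'I_n -> T -> R) (s : 'I_n -> 'I_n) :
  (forall i, measurable_fun setT (g i)) ->
  measurable_fun setT (fun t : n.-tuple T => \prod_(i < n) g i (tnth t (s i))).
Proof.
move=> mg; apply: measurable_prod => i _.
by apply: measurableT_comp => //; exact: measurable_tnth.
Qed.

Lemma prod_cons n (g : 'I_n.+1 -> T -> R) x (t : n.-tuple T) :
  \prod_(i < n.+1) g i (tnth (tuple_cons (t, x)) i) =
  g ord0 x * \prod_(i < n) g (lift ord0 i) (tnth t i).
Proof. by rewrite big_ord_recl; congr (_ * _); apply: eq_bigr => i _; rewrite tnthS. Qed.

Lemma tensor_integral_prod n (g : 'I_n -> T -> R) :
  (forall i, mu.-integrable setT (EFin \o g i)) ->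
  (tensor_measure mu (n := n)).-integrable setT
    (EFin \o (fun t => \prod_(i < n) g i (tnth t i))) /\
  \int[tensor_measure mu (n := n)]_t (\prod_(i < n) g i (tnth t i)) =
  \prod_(i < n) \int[mu]_x g i x.
Proof.
elim: n g => [|n IH] g ig.
  have -> : (fun t : 0.-tuple T => \prod_(i < 0) g i (tnth t i)) = fun=> 1.
    by apply/funext => t; rewrite big_ord0.
  have d1 : tensor_measure mu (n := 0) setT = 1%E by rewrite /= diracT.
  split; last first.
    by rewrite big_ord0 /Rintegral integral_cst// [X in (_ * X)%E](_ : _ = 1%E) ?mule1//; exact: d1.
  apply/integrableP; split; first exact/measurable_EFinP/measurable_cst.
  under eq_integral do rewrite /= normr1.
  by rewrite integral_cst// [X in (_ * X)%E](_ : _ = 1%E) ?mule1 ?ltry//; exact: d1.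
have mg i : measurable_fun setT (g i) by apply/measurable_EFinP; case/integrableP: (ig i).
pose f (t : n.+1.-tuple T) := \prod_(i < n.+1) g i (tnth t i).
have mf : measurable_fun setT f by exact: measurable_prod_tnth id mg.
pose G (t : n.-tuple T) := \prod_(i < n) g (lift ord0 i) (tnth t i).
have [iG EG] := IH (fun i => g (lift ord0 i)) (fun i => ig _).
have mc := @measurable_tuple_cons n.
have i1 : (tensor_measure mu (n := n) \x mu)%E.-integrable setT (EFin \o (f \o @tuple_cons T n)).
  apply/integrable12ltyP; first exact: (measurableT_comp (proj2 (measurable_EFinP _ _) mf) mc).
  have mg0 : measurable_fun setT (fun x => `|g ord0 x|%:E).
    by apply/measurable_EFinP; exact: measurableT_comp.
  have mG : measurable_fun setT (fun t => `|G t|%:E).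
    apply/measurable_EFinP; apply: measurableT_comp => //.
    by apply/measurable_EFinP; case/integrableP: iG.
  have E t : (\int[mu]_x `|(EFin \o (f \o @tuple_cons T n)) (t, x)| =
      (\int[mu]_x `|g ord0 x|%:E) * `|G t|%:E)%E.
    under eq_integral => x _ do rewrite /= /f prod_cons normrM EFinM.
    by rewrite ge0_integralZr.
  under eq_integral => t _ do rewrite E.
  have /integrableP[_ h1] := iG; have /integrableP[_ h2] := ig ord0.
  rewrite ge0_integralZl//; last by apply: integral_ge0 => x _; rewrite lee_fin.
  rewrite lte_mul_pinfty//; first by apply: integral_ge0 => x _; rewrite lee_fin.
  by rewrite ge0_fin_numE//; apply: integral_ge0 => x _; rewrite lee_fin.
split.
  by rewrite tensor_measureS; apply: (integrable_pushforward mc) => //; exact/measurable_EFinP.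
rewrite /Rintegral.
transitivity (fine (\int[tensor_measure mu (n := n) \x mu]_p (f (tuple_cons p))%:E)%E).
  have mE : measurable_fun setT (EFin \o f) by exact/measurable_EFinP.
  rewrite tensor_measureS; have := integral_pushforward mc mE i1 measurableT.
  by rewrite preimage_setT => ->.
rewrite -(integral12_prod_meas1 i1) /fubini_F /=.
under eq_integral => t _.
  under eq_integral => x _ do rewrite /= /f prod_cons mulrC EFinM.
  rewrite integralZl//; last exact: ig.
  over.
rewrite -(fineK (integrable_fin_num measurableT (ig ord0))).
rewrite integralZr//= fineM//; last exact: integrable_fin_num.
by rewrite big_ord_recl -EG mulrC.
Qed.

End TensorMeasure.

Section CauchySchwarz.
Context {R : realType} {disp : measure_display} {T : measurableType disp}.
Variable mu : {measure set T -> \bar R}.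

Lemma cauchy_schwarz (X Y : T -> R) : square_integrable mu (fun x => (X x)%:C%C) ->
  square_integrable mu (fun x => (Y x)%:C%C) ->
  (\int[mu]_x (X x * Y x)) ^+ 2 <= (\int[mu]_x (X x * X x)) * \int[mu]_x (Y x * Y x).
Proof.
move=> sX sY; have iXX := integrable_prod_square sX sX.
have iXY := integrable_prod_square sX sY; have iYY := integrable_prod_square sY sY.
pose A := \int[mu]_x (X x * X x); pose B := \int[mu]_x (X x * Y x).
pose D := \int[mu]_x (Y x * Y x).
have H (c : R) : 0 <= A + (- (2 * c)) * B + (c * c) * D.
  have E : A + (- (2 * c)) * B + (c * c) * D = \int[mu]_x ((X x - c * Y x) ^+ 2).
    have iZ k (h : T -> R) : mu.-integrable setT (EFin \o h) ->
        mu.-integrable setT (EFin \o (fun x => k * h x)).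
      by move=> ih; have := integrableZl measurableT k ih; under eq_fun do rewrite -EFinM.
    have i1 := iZ (- (2 * c)) _ iXY; have i2 := iZ (c * c) _ iYY.
    have i3 : mu.-integrable setT
        (EFin \o (fun x => X x * X x + (- (2 * c)) * (X x * Y x))).
      by have := integrableD measurableT iXX i1; under eq_fun do rewrite -EFinD.
    rewrite /A /B /D -!RintegralZl// -!RintegralD//.
    by apply: eq_Rintegral => x _; ring.
  by rewrite E; apply: Rintegral_ge0 => x _; exact: sqr_ge0.
have A0 : 0 <= A by apply: Rintegral_ge0 => x _; rewrite -expr2 sqr_ge0.
have D0 : 0 <= D by apply: Rintegral_ge0 => x _; rewrite -expr2 sqr_ge0.
change (B ^+ 2 <= A * D).
move: D0; rewrite le_eqVlt => /orP[/eqP D0|D0].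
  rewrite -D0 mulr0; have [->|B0] := eqVneq B 0; first by rewrite expr0n.
  (* For [D = 0] the quadratic is affine in [c]; this choice gives it the value [- A - 2], which is
     negative. *)
  have := H ((A + 1) / B); rewrite -D0 mulr0 addr0.
  have -> : A + - (2 * ((A + 1) / B)) * B = - A - 2 by field.
  by lra.
(* The quadratic attains its minimum at [c = B / D]. *)
have := H (B / D); have -> : A + - (2 * (B / D)) * B + B / D * (B / D) * D = A - B ^+ 2 / D.
  by field; rewrite gt_eqF.
by rewrite subr_ge0 ler_pdivrMr.
Qed.

End CauchySchwarz.

(** * Symmetric tensors and contraction with a function *)

Section SymTensor.
Context {R : realType} {T : Type}.

Let fact_neq0 n : n`!%:R != 0 :> R.
Proof. by rewrite pnatr_eq0 -lt0n fact_gt0. Qed.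

Lemma sym_tensor_perm n (f : 'I_n -> T -> R) (s : 'S_n) (t : n.-tuple T) :
  sym_tensor f (tuple_perm s t) = sym_tensor f t.
Proof.
rewrite /sym_tensor; congr (_ * _); rewrite [RHS](reindex_inj (mulIg s)).
apply: eq_bigr => s' _; apply: eq_bigr => i _.
by rewrite /tuple_perm tnth_mktuple permM.
Qed.

Lemma sym_tensor_power n (psi : T -> R) (t : n.-tuple T) :
  sym_tensor (fun=> psi) t = tensor_power psi t.
Proof.
rewrite /sym_tensor /tensor_power.
rewrite (eq_bigr (fun=> \prod_(i < n) psi (tnth t i))) => [|s _].
  rewrite sumr_const card_Sn -[X in _ * X]mulr_natl mulrA mulVf ?mul1r//; exact: fact_neq0.
by rewrite [RHS](reindex_inj (@perm_inj _ s)).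
Qed.

Lemma tensor_power_perm n (psi : T -> R) (s : 'S_n) (t : n.-tuple T) :
  tensor_power psi (tuple_perm s t) = tensor_power psi t.
Proof. by rewrite -!sym_tensor_power sym_tensor_perm. Qed.

(** The permutations are sorted by the factor [j] that receives the first argument, that is by
    [s j = ord0]. Each class is a copy of ['S_n], and the quotient of the factorials is
    [n.+1%:R^-1]. *)
Lemma sym_tensor_cons n (f : 'I_n.+1 -> T -> R) x (t : n.-tuple T) :
  sym_tensor f (tuple_cons (t, x)) =
  n.+1%:R^-1 * \sum_(j < n.+1) f j x * sym_tensor (fun i => f (lift j i)) t.
Proof.
rewrite /sym_tensor.
have -> : \sum_(j < n.+1) f j x * (n`!%:R^-1 * \sum_(s : 'S_n)
    \prod_(i < n) f (lift j i) (tnth t (s i))) = n`!%:R^-1 *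
    \sum_(s : 'S_n.+1) \prod_(i < n.+1) f i (tnth (tuple_cons (t, x)) (s i)).
  rewrite (partition_big (fun s : 'S_n.+1 => (s^-1)%g ord0) xpredT)//= mulr_sumr.
  apply: eq_bigr => j _; rewrite mulrCA; congr (_ * _).
  rewrite mulr_sumr (reindex (lift_perm j ord0)) /=; last first.
    have inj : injective (@lift_perm n j ord0).
      move=> s s' ss'; apply/permP => k; apply: (@lift_inj _ ord0).
      by rewrite -!(lift_perm_lift j) ss'.
    (* [low] is the restriction of [s] to the indices other than [j], relabelled. The identity is a
       dummy value for the [s] that do not send [j] to [ord0]. *)
    have surj (s : 'S_n.+1) : exists s', s j = ord0 -> lift_perm j ord0 s' = s.
      have [sj|] := eqVneq (s j) ord0; last by move=> /eqP sj; exists 1%g.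
      pose low k := odflt k (unlift ord0 (s (lift j k))).
      have lowK k : lift ord0 (low k) = s (lift j k).
        rewrite /low; case: unliftP => [l ->//|/eqP]; rewrite -sj (inj_eq perm_inj).
        by rewrite eq_sym (negbTE (neq_lift _ _)).
      have inj_low : injective low.
        by move=> k l kl; apply: (@lift_inj _ j); apply: (@perm_inj _ s); rewrite -!lowK kl.
      exists (perm inj_low) => _; apply/permP => k.
      case: (unliftP j k) => [k'|] ->; last by rewrite lift_perm_id sj.
      by rewrite lift_perm_lift permE lowK.
    have [g Hg] := choice surj; exists g => s; last first.
      by rewrite inE => /eqP sj; apply: Hg; rewrite -sj permKV.
    by move=> _; apply: inj; apply: Hg; exact: lift_perm_id.
  apply: eq_big => [s|s _]; first by rewrite -{2}(lift_perm_id j ord0 s) permK eqxx.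
  rewrite (bigD1_ord j)//= lift_perm_id; congr (_ * _).
  by apply: eq_bigr => i _; rewrite lift_perm_lift tnthS.
rewrite mulrA; congr (_ * _); rewrite factS natrM invfM//.
Qed.

End SymTensor.

Section TensorL2.
Context {R : realType} {disp : measure_display} {T : measurableType disp}.
Variable mu : {sigma_finite_measure set T -> \bar R}.
Local Notation M n := (tensor_measure mu (n := n)).

Lemma square_integrable_prod n (g : 'I_n -> T -> R) :
  (forall i, square_integrable mu (fun x => (g i x)%:C%C)) ->
  square_integrable (M n) (fun t => (\prod_(i < n) g i (tnth t i))%:C%C).
Proof.
move=> sg; have mg i : measurable_fun setT (g i) by case: (sg i).
have [iG _] := tensor_integral_prod (fun i => integrable_prod_square (sg i) (sg i)).
apply: (square_integrable_le _ iG); last first.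
  by move=> t; rewrite sqabs_real expr2 -big_split.
by apply: cmeasurable_real; exact: measurable_prod_tnth id mg.
Qed.

Lemma sym_tensorE n (f : 'I_n -> T -> R) t :
  sym_tensor f t = (n`!%:R)^-1 * \sum_(s : 'S_n) \prod_(i < n) f (s i) (tnth t i).
Proof.
rewrite /sym_tensor; congr (_ * _); rewrite [RHS](reindex_inj (@invg_inj 'S_n)).
apply: eq_bigr => s _; rewrite (reindex_inj (@perm_inj _ s^-1%g)).
by apply: eq_bigr => i _; rewrite permKV.
Qed.

Lemma square_integrable_sym_tensor n (f : 'I_n -> T -> R) :
  (forall i, square_integrable mu (fun x => (f i x)%:C%C)) ->
  square_integrable (M n) (fun t => (sym_tensor f t)%:C%C).
Proof.
move=> sf; under eq_fun do rewrite sym_tensorE real_complexM real_complex_sum.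
apply: square_integrableZ; apply: square_integrable_sum => s.
by apply: (square_integrable_prod (g := fun i => f (s i))) => i.
Qed.

(** Integrating [phi] against one argument of a symmetric tensor removes each factor in turn, with
    weight [1 / (n + 1)]. The annihilation operator becomes an integral in one variable, to which
    Cauchy-Schwarz applies whatever the rank of the tensor. *)
Lemma contraction n (phi : T -> R) (f : 'I_n.+1 -> T -> R) t :
  square_integrable mu (fun x => (phi x)%:C%C) ->
  (forall i, square_integrable mu (fun x => (f i x)%:C%C)) ->
  \sum_(j < n.+1) (\int[mu]_x (phi x * f j x)) * sym_tensor (fun i => f (lift j i)) t =
  n.+1%:R * \int[mu]_x (phi x * sym_tensor f (tuple_cons (t, x))).
Proof.
move=> sp sf; pose c j := n.+1%:R^-1 * sym_tensor (fun i => f (lift j i)) t.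
have ip j := integrable_prod_square sp (sf j).
have E x : phi x * sym_tensor f (tuple_cons (t, x)) = \sum_(j < n.+1) c j * (phi x * f j x).
  rewrite sym_tensor_cons mulrCA mulr_sumr mulr_sumr; apply: eq_bigr => j _.
  by rewrite /c; ring.
under eq_Rintegral do rewrite E.
rewrite Rintegral_sum => [|j]; last first.
  by have := integrableZl measurableT (c j) (ip j); under eq_fun do rewrite -EFinM.
rewrite mulr_sumr; apply: eq_bigr => j _; rewrite RintegralZl//; last exact: ip.
have nz : n.+1%:R != 0 :> R by rewrite pnatr_eq0.
by rewrite /c [n.+1%:R * _]mulrA [n.+1%:R * _]mulrA divff// mul1r mulrC.
Qed.

End TensorL2.

(** * Boundedness of the annihilation operator in each degree *)

Section AnnihilationBound.
Context {R : realType} {d : nat}.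
Variable sigma : {sigma_finite_measure set (Rd R d) -> \bar R}.
Variable phi : 'rV[R]_d -> R.
Hypothesis sphi : square_integrable sigma (fun x => (phi x)%:C%C).
Local Notation M n := (tensor_measure sigma (n := n)).
Local Notation slice v t := (fun x : Rd R d => v (tuple_cons (t, x))).

(** The square of [n + 1] times the norm of [phi], for the plain norms on powers of the measure,
    without the factorial weights of Fock space. *)
Definition annihilation_bound n : R := n.+1%:R ^+ 2 * \int[sigma]_x (phi x * phi x).

Lemma Exp_n_quadratic n : quadratic (Exp_n sigma n) cmeasurable.
Proof. by have [q1 q2 q3 q4] := L2_quadratic (M n); split. Qed.

Lemma mem_Exp_n n (h : n.-tuple (Rd R d) -> R[i]) : square_integrable (M n) h ->
  (forall (s : 'S_n) t, h (tuple_perm s t) = h t) -> mem_l2 (Exp_n sigma n) h.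
Proof. by move=> sh hs; split=> // s; apply: aeW => t; exact: hs. Qed.

Lemma Exp_n_cmeasurable n (h : n.-tuple (Rd R d) -> R[i]) :
  mem_l2 (Exp_n sigma n) h -> cmeasurable h.
Proof. by move=> [/square_integrable_measurable]. Qed.

(* On the span of the decomposable tensors the annihilation operator is
   [v |-> (n + 1) int phi(x) v(x, .) dsigma(x)]; Cauchy-Schwarz bounds it. *)
Definition contracts n (v : n.+1.-tuple (Rd R d) -> R[i]) (w : n.-tuple (Rd R d) -> R[i]) :=
  [/\ cmeasurable v, cmeasurable w, forall t, square_integrable sigma (slice v t) &
    forall t,
      complex.Re (w t) = n.+1%:R * \int[sigma]_x (phi x * complex.Re (slice v t x)) /\
      complex.Im (w t) = n.+1%:R * \int[sigma]_x (phi x * complex.Im (slice v t x))].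

Lemma square_integrable_Re (h : Rd R d -> R[i]) : square_integrable sigma h ->
  square_integrable sigma (fun x => (complex.Re (h x))%:C%C) /\
  square_integrable sigma (fun x => (complex.Im (h x))%:C%C).
Proof.
move=> /square_integrableP[mh fh]; have ms := measurable_sqabsE mh.
have le (g : Rd R d -> R[i]) : cmeasurable g -> (forall x, sqabs (g x) <= sqabs (h x)) ->
    square_integrable sigma g.
  move=> mg gh; apply/square_integrableP; split=> //.
  by apply: le_lt_trans fh; apply: (le_sqnorm sigma mg ms) => x; rewrite lee_fin.
split; apply: le; try by apply: cmeasurable_real; case: mh.
  by move=> x; rewrite sqabs_real lerDl sqr_ge0.
by move=> x; rewrite sqabs_real lerDr sqr_ge0.
Qed.

Lemma contracts_span n v w : graph_span (@annihilation_tensor _ _ sigma phi n) v w ->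
  contracts v w.
Proof.
apply: graph_span_ind => [|a v1 w1 v2 w2 [f [sf -> ->]] [mv mw sv Hw]].
  split; [exact: cmeasurable_cst|exact: cmeasurable_cst| |].
    by move=> t; exact: square_integrable0.
  by move=> t; under eq_Rintegral do rewrite mulr0; rewrite Rintegral_cst// mul0r mulr0.
have s1 := square_integrable_sym_tensor sf.
have s1' t : square_integrable sigma (fun x => (sym_tensor f (tuple_cons (t, x)))%:C%C).
  under eq_fun do rewrite sym_tensor_cons real_complexM real_complex_sum.
  apply: square_integrableZ; apply: square_integrable_sum => j.
  by under eq_fun do rewrite mulrC real_complexM; exact: square_integrableZ.
split.
- by apply: cmeasurableD => //; apply: cmeasurableZ; exact: square_integrable_measurable s1.
- apply: cmeasurableD => //; apply: cmeasurableZ.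
  under eq_fun do rewrite real_complex_sum; apply: cmeasurable_sum => j.
  under eq_fun do rewrite real_complexM; apply: cmeasurableZ.
  apply: (@square_integrable_measurable _ _ _ (M n)).
  by apply: (square_integrable_sym_tensor (f := fun i => f (lift j i))) => i.
- by move=> t; apply: square_integrableD; [exact: square_integrableZ|exact: sv].
move=> t; have [r1 r2] := square_integrable_Re (sv t).
have i0 := integrable_prod_square sphi (s1' t).
have i1 := integrable_prod_square sphi r1; have i2 := integrable_prod_square sphi r2.
have [h1 h2] := Hw t; rewrite ReD ImD ReM ImM h1 h2 /= !mulr0 subr0 add0r contraction//.
have E (b : R) (g : Rd R d -> R) : sigma.-integrable setT (fun x => (phi x * g x)%:E) ->
    b * (n.+1%:R * \int[sigma]_x (phi x * sym_tensor f (tuple_cons (t, x)))) +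
    n.+1%:R * \int[sigma]_x (phi x * g x) =
    n.+1%:R * \int[sigma]_x (phi x * (b * sym_tensor f (tuple_cons (t, x)) + g x)).
  move=> ig; rewrite mulrCA -mulrDr -RintegralZl// -RintegralD//; last first.
    by have := integrableZl measurableT b i0; under eq_fun do rewrite -EFinM.
  by congr (_ * _); apply: eq_Rintegral => x _; ring.
split; rewrite E//; congr (_ * _); apply: eq_Rintegral => x _; congr (_ * _).
  by rewrite ReD ReM /= mulr0 subr0.
by rewrite ImD ImM /= mulr0 add0r.
Qed.

Lemma contracts_bound n v w : contracts (n := n) v w ->
  (sqnorm (M n) w <= (annihilation_bound n)%:E * sqnorm (M n.+1) v)%E.
Proof.
move=> [mv mw sv Hw]; have ms := measurable_sqabsE mv.
have s0 (t : n.+1.-tuple (Rd R d)) : (0 <= (sqabs (v t))%:E)%E by rewrite lee_fin sqabs_ge0.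
have A0 : 0 <= \int[sigma]_x (phi x * phi x).
  by apply: Rintegral_ge0 => x _; rewrite -expr2 sqr_ge0.
have B0 : 0 <= annihilation_bound n by rewrite mulr_ge0// sqr_ge0.
rewrite /sqnorm -/(sqabs _) (integral_tensorS sigma ms s0) -ge0_integralZl//; last 2 first.
- exact: (measurable_tensor_slice sigma ms s0).
- by move=> t _; apply: integral_ge0 => x _; exact: s0.
apply: le_sqnorm => //.
  by apply: measurable_funeM; exact: (measurable_tensor_slice sigma ms s0).
move=> t; have [h1 h2] := Hw t; have [r1 r2] := square_integrable_Re (sv t).
have i1 := integrable_prod_square r1 r1; have i2 := integrable_prod_square r2 r2.
have -> : (\int[sigma]_x (sqabs (v (tuple_cons (t, x))))%:E =
    (\int[sigma]_x (complex.Re (slice v t x) * complex.Re (slice v t x)) +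
     \int[sigma]_x (complex.Im (slice v t x) * complex.Im (slice v t x)))%:E)%E.
  rewrite -RintegralD// /Rintegral fineK.
    by apply: eq_integral => x _; rewrite /sqabs !expr2.
  apply: integrable_fin_num => //.
  by have := integrableD measurableT i1 i2; under eq_fun do rewrite -EFinD.
rewrite lee_fin /sqabs h1 h2 /annihilation_bound.
have c1 := cauchy_schwarz sphi r1; have c2 := cauchy_schwarz sphi r2.
by rewrite !exprMn -mulrDr -[leRHS]mulrA ler_wpM2l ?sqr_ge0// mulrDr lerD.
Qed.

(** The span is linear, so the operator bound applied to a difference is a Lipschitz bound, which
    then extends to the closure. For relations between functions it also says that the extension is
    single-valued up to distance 0. *)
Lemma annihilation_n_lipschitz n h k h' k' :
  annihilation_n sigma phi h k -> annihilation_n sigma phi h' k' ->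
  (sqdist (L2 (M n)) k k' <= (annihilation_bound n)%:E * sqdist (L2 (M n.+1)) h h')%E.
Proof.
have q := Exp_n_quadratic n; have q' := Exp_n_quadratic n.+1.
have B0 : 0 <= annihilation_bound n.
  rewrite mulr_ge0 ?sqr_ge0//.
  by apply: Rintegral_ge0 => x _; rewrite -expr2 sqr_ge0.
have span v w v' w' : graph_span (@annihilation_tensor _ _ sigma phi n) v w ->
    graph_span (@annihilation_tensor _ _ sigma phi n) v' w' ->
    (sqdist (Exp_n sigma n) w w' <= (annihilation_bound n)%:E * sqdist (Exp_n sigma n.+1) v v')%E.
  move=> s s'; have := contracts_bound (contracts_span (graph_spanD s (graph_spanZ (-1) s'))).
  by under eq_fun do rewrite mulN1r; under [X in sqnorm (M n.+1) X]eq_fun do rewrite mulN1r.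
move=> /(graph_closureP q' q)[mh mk H] /(graph_closureP q' q)[mh' mk' H'].
apply: (approximable_le
  (G := fun w v => graph_span (@annihilation_tensor _ _ sigma phi n) v w) q q' B0).
- by move=> w v /contracts_span[].
- by move=> w v w' v'; exact: span.
- exact: Exp_n_cmeasurable mk.
- exact: Exp_n_cmeasurable mh.
- exact: Exp_n_cmeasurable mk'.
- exact: Exp_n_cmeasurable mh'.
- by move=> e /H[v [w [s d1 d2]]]; exists w, v.
- by move=> e /H'[v [w [s d1 d2]]]; exists w, v.
Qed.

End AnnihilationBound.

(** * Fock space *)

Section FockSpace.
Context {R : realType} {d : nat}.
Variable sigma : {sigma_finite_measure set (Rd R d) -> \bar R}.
Local Notation M n := (tensor_measure sigma (n := n)).
Implicit Types (f g h : fock_seq (R := R) (d := d)).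
Local Open Scope ereal_scope.

Definition fock_term f g n : \bar R := (n`!%:R)%:E * sqdist (Exp_n sigma n) (f n) (g n).

Definition fock_cmeasurable f := forall n, cmeasurable (f n).

Definition fock0 : fock_seq (R := R) (d := d) := fun _ _ => 0%R.
Arguments fock0 : clear implicits.

Definition truncate N f : fock_seq (R := R) (d := d) := fun n t => if (n < N)%N then f n t else 0%R.
Arguments truncate : clear implicits.

Lemma fock_term_ge0 f g n : 0 <= fock_term f g n.
Proof. by rewrite mule_ge0// ?lee_fin// (sqdist_ge0 (Exp_n_quadratic sigma n)). Qed.

Lemma fock_quadratic : quadratic (fock sigma) fock_cmeasurable.
Proof.
split=> [f g|f|f g|e f g h e0 mf mg mh].
- by apply: nneseries_ge0 => n _ _; exact: fock_term_ge0.
- by apply: eseries0 => n _ _; rewrite (sqdistxx (Exp_n_quadratic sigma n)) mule0.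
- by apply: eq_eseriesr => n _; rewrite (sqdistC (Exp_n_quadratic sigma n)).
have e1 : (0 <= 1 + e)%R by rewrite addr_ge0// ltW.
have e2 : (0 <= 1 + e^-1)%R by rewrite addr_ge0// invr_ge0 ltW.
rewrite /= /fock_sqdist -!nneseriesZl//; last 2 first.
- by move=> n _; exact: fock_term_ge0.
- by move=> n _; exact: fock_term_ge0.
rewrite -nneseriesD//; last 2 first.
- by move=> n _ _; rewrite mule_ge0// ?lee_fin//; exact: fock_term_ge0.
- by move=> n _ _; rewrite mule_ge0// ?lee_fin//; exact: fock_term_ge0.
apply: lee_nneseries => n; first by move=> _ _; exact: fock_term_ge0.
move=> _; rewrite !(muleCA _ (n`!%:R)%:E) -muleDr//; last first.
  by apply: ge0_adde_def; rewrite inE mule_ge0// ?lee_fin//;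
    exact: (sqdist_ge0 (Exp_n_quadratic sigma n)).
rewrite lee_wpmul2l// ?lee_fin//.
exact: (sqdist_triangle (Exp_n_quadratic sigma n) e0 (mf n) (mg n) (mh n)).
Qed.

Lemma fock_partial_le N f g : \sum_(0 <= n < N) fock_term f g n <= fock_sqdist sigma f g.
Proof. by apply: nneseries_lim_ge => n _ _; exact: fock_term_ge0. Qed.

Lemma fock_term_le n f g : fock_term f g n <= fock_sqdist sigma f g.
Proof.
apply: le_trans (fock_partial_le n.+1 f g); rewrite big_nat_recr//= leeDr//.
by apply: sume_ge0 => k _; exact: fock_term_ge0.
Qed.

Lemma Exp_n_le_fock n f g : sqdist (Exp_n sigma n) (f n) (g n) <= fock_sqdist sigma f g.
Proof.
apply: le_trans (fock_term_le n f g); rewrite /fock_term -[leLHS]mul1e.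
apply: lee_wpmul2r; first exact: (sqdist_ge0 (Exp_n_quadratic sigma n)).
by rewrite lee_fin ler1n fact_gt0.
Qed.

Lemma fock_le_partial c f g : (forall N, \sum_(0 <= n < N) fock_term f g n <= c) ->
  fock_sqdist sigma f g <= c.
Proof.
move=> H; apply: lime_le; last exact: nearW.
by apply: is_cvg_nneseries => n _ _; exact: fock_term_ge0.
Qed.

Lemma fock_sqdist_finite N f g : (forall n, (N <= n)%N -> fock_term f g n = 0) ->
  fock_sqdist sigma f g = \sum_(0 <= n < N) fock_term f g n.
Proof.
move=> H; rewrite /fock_sqdist (nneseries_split 0 N); last first.
  by move=> n _; exact: fock_term_ge0.
by rewrite add0n eseries0 ?adde0// => n Nn _; exact: H.
Qed.

Lemma truncate_lt N f n : (n < N)%N -> truncate N f n = f n.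
Proof. by move=> nN; apply/funext => t; rewrite /truncate nN. Qed.

Lemma truncate_ge N f n : (N <= n)%N -> truncate N f n = fun=> 0%R.
Proof. by move=> nN; apply/funext => t; rewrite /truncate ltnNge nN. Qed.

Lemma fock_truncate N f g : fock_sqdist sigma (truncate N f) (truncate N g) =
  \sum_(0 <= n < N) fock_term f g n.
Proof.
rewrite (fock_sqdist_finite (N := N)) => [|n Nn].
  by rewrite !big_mkord; apply: eq_bigr => n _; rewrite /fock_term !truncate_lt.
by rewrite /fock_term !truncate_ge// (sqdistxx (Exp_n_quadratic sigma n)) mule0.
Qed.

Lemma fock_truncate_self N f : fock_sqdist sigma (truncate N f) f =
  \sum_(N <= n <oo) fock_term f fock0 n.
Proof.
rewrite /fock_sqdist (nneseries_split 0 N); last first.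
  by move=> n _; exact: fock_term_ge0.
rewrite add0n big_mkord big1 ?add0e => [|n _].
  rewrite ereal_series [RHS]ereal_series; apply: eq_eseriesr => n Nn.
  rewrite /fock_term (sqdistC (Exp_n_quadratic sigma n)).
  by congr (_ * sqdist _ _ _); apply/funext => t; rewrite /truncate ltnNge Nn.
rewrite (_ : truncate N f n = f n); last by apply/funext => t; rewrite /truncate ltn_ord.
by rewrite (sqdistxx (Exp_n_quadratic sigma n)) mule0.
Qed.

Lemma fock_tail f (e : R) : fock_sqdist sigma f fock0 < +oo -> (0 < e)%R ->
  exists N0, forall N, (N0 <= N)%N -> fock_sqdist sigma (truncate N f) f <= e%:E.
Proof.
move=> ff e0; have := nneseries_tail_cvg ff (fun n _ => fock_term_ge0 f fock0 n).
move=> /fine_cvgP[[K1 _ fin] /cvgrPdist_le cv]; have [K2 _ H] := cv _ e0.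
exists (maxn K1 K2) => N; rewrite geq_max => /andP[k1 k2].
rewrite fock_truncate_self -(fineK (fin _ k1)) lee_fin.
by have := H _ k2; rewrite sub0r normrN; apply: le_trans; exact: ler_norm.
Qed.

Lemma mem_Exp_n0 n : mem_l2 (Exp_n sigma n) (fun=> 0%R).
Proof. by apply: mem_Exp_n => //; exact: square_integrable0. Qed.

Lemma mem_fock_truncate N f : (forall n, mem_l2 (Exp_n sigma n) (f n)) ->
  mem_l2 (fock sigma) (truncate N f).
Proof.
move=> mf; split=> [n|].
  have [nN|nN] := ltnP n N; first by rewrite truncate_lt.
  by rewrite truncate_ge//; exact: mem_Exp_n0.
have -> : (fun _ _ => 0%R) = truncate N fock0.
  by apply/functional_extensionality_dep => n; apply/funext => t; rewrite /truncate if_same.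
rewrite fock_truncate big_mkord; apply: lte_sum_pinfty => n _.
rewrite lte_mul_pinfty// ?lee_fin//; have [[_ _ h] _] := mf n.
by rewrite sqnormE in h.
Qed.

Lemma fock_cmeasurable0 : fock_cmeasurable fock0.
Proof. by move=> n; exact: cmeasurable_cst. Qed.

Lemma mem_fock_near f g : fock_cmeasurable f -> (forall n, mem_l2 (Exp_n sigma n) (g n)) ->
  fock_sqdist sigma f fock0 < +oo -> fock_sqdist sigma f g < +oo -> mem_l2 (fock sigma) g.
Proof.
move=> mf mg ff fg; split; first exact: mg.
have mg' : fock_cmeasurable g by move=> n; exact: (Exp_n_cmeasurable (mg n)).
apply: le_lt_trans (sqdist_triangle fock_quadratic ltr01 mg' mf fock_cmeasurable0) _.
rewrite (sqdistC fock_quadratic g) invr1.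
have t0 : (0 : \bar R) <= (1 + 1)%:E by rewrite lee_fin.
by apply: lte_add_pinfty; [exact: (lte_mul_pinfty t0 _ fg)|exact: (lte_mul_pinfty t0 _ ff)].
Qed.

(** Completeness in each degree yields the components of the limit. Their symmetry comes from the
    symmetry of the sequences of values that [limsup_value] receives. *)
Lemma fock_complete (f : nat -> fock_seq (R := R) (d := d)) :
  (forall k n, square_integrable (M n) (f k n)) ->
  (forall k n (s : 'S_n) t, f k n (tuple_perm s t) = f k n t) ->
  (forall e : R, (0 < e)%R -> exists K, forall k l, (K <= k)%N -> (K <= l)%N ->
    fock_sqdist sigma (f k) (f l) <= e%:E) ->
  exists g, (forall n, mem_l2 (Exp_n sigma n) (g n)) /\ l2cvg (fock sigma) f g.
Proof.
move=> sf pf cf; have mf k : fock_cmeasurable (f k).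
  by move=> n; exact: square_integrable_measurable (sf k n).
have H n : exists i : nat -> nat, let h t := limsup_value (fun j => f (i j) n t) in
    square_integrable (M n) h /\ l2cvg (L2 (M n)) (fun k => f k n) h.
  apply: L2_complete => // e e0; have [K HK] := cf _ e0; exists K => k l Kk Kl.
  exact: le_trans (Exp_n_le_fock n (f k) (f l)) (HK _ _ Kk Kl).
have [i Hi] := choice H.
pose g : fock_seq := fun n t => limsup_value (fun j => f (i n j) n t).
have mg n : mem_l2 (Exp_n sigma n) (g n).
  apply: mem_Exp_n; first by case: (Hi n).
  by move=> s t; rewrite /g; congr limsup_value; apply/funext => j; exact: pf.
have mg' n := Exp_n_cmeasurable (mg n).
exists g; split=> //; apply/(l2cvgP fock_quadratic) => e e0.
have e4 : (0 < e / 4)%R by rewrite divr_gt0.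
(* [K] is fixed before [N]: for each truncation a far index [l], depending on [N], is inserted
   between [f k] and [g]. *)
have [K HK] := cf _ e4; exists K => k Kk; apply: fock_le_partial => N.
rewrite -fock_truncate.
have mt h : fock_cmeasurable h -> fock_cmeasurable (truncate N h).
  move=> mh n; have [nN|nN] := ltnP n N; first by rewrite truncate_lt.
  by rewrite truncate_ge//; exact: cmeasurable_cst.
have [l Kl Hl] : exists2 l, (K <= l)%N & \sum_(0 <= n < N) fock_term (f l) g n <= (e / 4)%:E.
  suff [L HL] : exists L, forall l, (L <= l)%N ->
      \sum_(0 <= n < N) fock_term (f l) g n <= (e / 4)%:E.
    by exists (maxn K L); [exact: leq_maxl|apply: HL; exact: leq_maxr].
  elim: N (e / 4)%R e4 {mt} => [|N IH] a a0.
    by exists 0%N => l _; rewrite big_nil lee_fin ltW.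
  have a2 : (0 < a / 2)%R by rewrite divr_gt0.
  have [L1 HL1] := IH _ a2.
  have b0 : (0 < a / 2 / N`!%:R)%R by rewrite divr_gt0// ltr0n fact_gt0.
  have [L2 HL2] := (l2cvgP (L2_quadratic (M N)) _ _).1 (Hi N).2 _ b0.
  exists (maxn L1 L2) => l; rewrite geq_max => /andP[l1 l2].
  rewrite big_nat_recr//= [a in a%:E]splitr EFinD; apply: leeD; first exact: HL1.
  rewrite /fock_term; apply: le_trans (lee_wpmul2l _ (HL2 _ l2)) _; rewrite ?lee_fin//.
  by rewrite mulrC divfK// pnatr_eq0 -lt0n fact_gt0.
apply (sqdist_triangle2 fock_quadratic (mt _ (mf k)) (mt _ (mf l)) (mt _ mg')).
  by rewrite /= fock_truncate; apply: le_trans (fock_partial_le _ _ _) _; exact: HK.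
by rewrite /= fock_truncate.
Qed.

End FockSpace.

Arguments fock0 {R d} n t : rename.
Arguments truncate {R d} N f n t : rename.

(** * The chaos isometry *)

Section ChaosSpan.
Context {R : realType} {d : nat}.
Variable sigma : {sigma_finite_measure set (Rd R d) -> \bar R}.
Hypothesis sigma_radon : radon sigma.
Variable P : probability (Gamma R d) R.
Hypothesis P_poisson : is_poisson sigma P.
Variable C : forall n, config R d -> (n.-tuple (Rd R d) -> R) -> R.
Hypothesis C_charlier : charlier_kernels sigma C.
Local Notation M n := (tensor_measure sigma (n := n)).
Local Notation fock_seq := (fock_seq (R := R) (d := d)).
Implicit Types (f g : fock_seq) (psi : 'rV[R]_d -> R) (F G : Gamma R d -> R[i]).

Lemma test_square_integrable psi : test_function psi ->
  square_integrable sigma (fun x => (psi x)%:C%C).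
Proof.
move=> tp; apply: (square_integrable_le (G := fun x : Rd R d => psi x * psi x)).
- by apply: cmeasurable_real; apply: continuous_measurable_Rd; exact: test_continuous.
- by apply: (integrable_test sigma_radon); apply: testM => //; case: tp.
- by move=> x; rewrite sqabs_real expr2.
Qed.

Lemma square_integrable_tensor_power n psi : test_function psi ->
  square_integrable (M n) (fun t => (tensor_power psi t)%:C%C).
Proof.
by move=> /test_square_integrable sp; exact: (@square_integrable_prod _ _ _ sigma n (fun=> psi) (fun=> sp)).
Qed.

Lemma tensor_power_gram n psi chi : test_function psi -> test_function chi ->
  \int[M n]_t (tensor_power psi t * tensor_power chi t) = (\int[sigma]_x (psi x * chi x)) ^+ n.
Proof.
move=> tp tc; have i1 : sigma.-integrable setT (EFin \o (fun x : Rd R d => psi x * chi x)).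
  by apply: (integrable_test sigma_radon); apply: testM => //; case: tp.
have [_] := tensor_integral_prod (fun=> i1) (n := n).
rewrite prodr_const card_ord => <-; apply: eq_Rintegral => t _.
by rewrite /tensor_power -big_split.
Qed.

Lemma charlier_coefE n psi gam :
  C gam (@tensor_power R (Rd R d) n psi) = n`!%:R * charlier_coef C n psi gam.
Proof. by rewrite /charlier_coef mulrC divfK// pnatr_eq0 -lt0n fact_gt0. Qed.

Lemma charlier_square_integrable n psi : test_function psi ->
  square_integrable P (fun gam => (C gam (@tensor_power R (Rd R d) n psi))%:C%C).
Proof.
move=> tp; under eq_fun do rewrite charlier_coefE real_complexM.
apply: square_integrableZ.
exact: (charlier_coef_square_integrable sigma_radon P_poisson C_charlier n tp).
Qed.

Lemma charlier_gram n m psi chi : test_function psi -> test_function chi ->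
  \int[P]_gam (C gam (@tensor_power R (Rd R d) n psi) * C gam (@tensor_power R (Rd R d) m chi)) =
  if n == m then n`!%:R * (\int[sigma]_x (psi x * chi x)) ^+ n else 0.
Proof.
move=> tp tc; have sp := charlier_coef_square_integrable sigma_radon P_poisson C_charlier n tp.
have sc := charlier_coef_square_integrable sigma_radon P_poisson C_charlier m tc.
have E gam : C gam (@tensor_power R (Rd R d) n psi) * C gam (@tensor_power R (Rd R d) m chi) =
    (n`!%:R * m`!%:R) * (charlier_coef C n psi gam * charlier_coef C m chi gam).
  by rewrite !charlier_coefE; ring.
under eq_Rintegral do rewrite E.
rewrite RintegralZl//; last exact: integrable_prod_square.
rewrite (charlier_coef_orthogonal sigma_radon P_poisson C_charlier)//.
case: eqP => [<-|_]; last by rewrite mulr0.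
by field; rewrite pnatr_eq0 -lt0n fact_gt0.
Qed.

(* A Fock sequence is encoded as one function on the disjoint union of the
   [n.-tuple]s, so that [graph_span] applies to it. *)
Definition chaos_graph (v : {n : nat & n.-tuple (Rd R d)} -> R[i]) F :=
  exists n psi, [/\ test_function psi,
    v = (fun p => (if tag p == n then tensor_power psi (tagged p) else 0)%:C%C) &
    F = (fun gam => (C gam (@tensor_power R (Rd R d) n psi))%:C%C)].

Definition chaos_span f F := graph_span chaos_graph (fun p => f (tag p) (tagged p)) F.

Lemma chaos_spanP f F : chaos_span f F <->
  exists k (c : 'I_k -> R[i]) (m : 'I_k -> nat) (psi : 'I_k -> 'rV[R]_d -> R),
  [/\ forall j, test_function (psi j),
    forall n t, f n t = \sum_j c j * (if n == m j then tensor_power (psi j) t else 0)%:C%C &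
    F = fun gam => \sum_j c j * (C gam (@tensor_power R (Rd R d) (m j) (psi j)))%:C%C].
Proof.
split=> [[k [c [vs [ws [H fE FE]]]]]|[k [c [m [psi [tp fE FE]]]]]].
  have /choice[m Hm] := H; have /choice[psi Hpsi] := Hm.
  exists k, c, m, psi; split=> [j|n t|]; first by case: (Hpsi j).
    have := congr1 (fun v => v (Tagged (fun n => n.-tuple (Rd R d)) t)) fE; rewrite /= => ->.
    by apply: eq_bigr => j _; case: (Hpsi j) => _ -> _.
  by rewrite FE; apply/funext => gam; apply: eq_bigr => j _; case: (Hpsi j) => _ _ ->.
exists k, c, (fun j p => (if tag p == m j then tensor_power (psi j) (tagged p) else 0)%:C%C),
  (fun j gam => (C gam (@tensor_power R (Rd R d) (m j) (psi j)))%:C%C); split=> // [j|].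
  by exists (m j), (psi j).
by apply/funext => p; exact: fE.
Qed.

Lemma chaos_spanD f F g G : chaos_span f F -> chaos_span g G ->
  chaos_span (fun n t => f n t + g n t) (fun gam => F gam + G gam).
Proof. exact: graph_spanD. Qed.

Lemma chaos_spanZ (a : R[i]) f F : chaos_span f F ->
  chaos_span (fun n t => a * f n t) (fun gam => a * F gam).
Proof. exact: graph_spanZ. Qed.

Lemma chaos_span0 : chaos_span (@fock0 R d) (fun=> 0).
Proof.
apply/chaos_spanP; exists 0%N, (fun=> 0), (fun=> 0%N), (fun=> fun=> 0); split; first by case.
  by move=> n t; rewrite big_ord0.
by apply/funext => gam; rewrite big_ord0.
Qed.

Lemma chaos_span_square_integrable f F : chaos_span f F ->
  (forall n, square_integrable (M n) (f n)) /\ square_integrable P F.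
Proof.
move=> /chaos_spanP[k [c [m [psi [tp fE ->]]]]]; split=> [n|]; last first.
  apply: square_integrable_sum => j; apply: square_integrableZ.
  exact: charlier_square_integrable.
rewrite (_ : f n = fun t => \sum_j c j * (if n == m j then tensor_power (psi j) t else 0)%:C%C).
  apply: square_integrable_sum => j; apply: square_integrableZ.
  by case: eqP => [_|_]; [exact: square_integrable_tensor_power|exact: square_integrable0].
by apply/funext => t; exact: fE.
Qed.

Lemma chaos_span_perm f F n (s : 'S_n) t : chaos_span f F -> f n (tuple_perm s t) = f n t.
Proof.
move=> /chaos_spanP[k [c [m [psi [tp fE _]]]]]; rewrite !fE; apply: eq_bigr => j _.
by rewrite tensor_power_perm.
Qed.

Lemma chaos_span_mem f F n : chaos_span f F -> mem_l2 (Exp_n sigma n) (f n).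
Proof.
move=> H; apply: mem_Exp_n; first exact: (chaos_span_square_integrable H).1.
by move=> s t; exact: chaos_span_perm H.
Qed.

Lemma chaos_span_cmeasurable f F : chaos_span f F -> fock_cmeasurable f /\ cmeasurable F.
Proof.
move=> H; have [h1 h2] := chaos_span_square_integrable H.
by split=> [n|]; [exact: square_integrable_measurable (h1 n)|exact: square_integrable_measurable h2].
Qed.

(** Both squared norms are quadratic forms in the [c j] with the same Gram matrix: [n! * q ^+ n] for
    two terms of the same degree [n], and 0 for different degrees, by orthogonality of the kernels
    on one side and by the direct sum on the other. *)
Lemma chaos_span_norm f F : chaos_span f F -> fock_sqdist sigma f (@fock0 R d) = sqnorm P F.
Proof.
move=> /chaos_spanP[k [c [m [psi [tp fE ->]]]]].
pose q j l := \int[sigma]_x (psi j x * psi l x).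
pose a j l := complex.Re (c j) * complex.Re (c l) + complex.Im (c j) * complex.Im (c l).
pose N := (\max_j m j).+1; have mN j : (m j < N)%N by rewrite ltnS leq_bigmax.
have term n : fock_term sigma f (@fock0 R d) n = (n`!%:R * \sum_j \sum_l a j l *
    (if (n == m j) && (n == m l) then q j l ^+ n else 0))%:E.
  rewrite /fock_term EFinM; congr (_ * _)%E; rewrite /= -[LHS]sqnormE.
  pose X j (t : n.-tuple (Rd R d)) := if n == m j then tensor_power (psi j) t else 0.
  have sX j : square_integrable (M n) (fun t => (X j t)%:C%C).
    by rewrite /X; case: eqP => _; [exact: square_integrable_tensor_power|exact: square_integrable0].
  rewrite (_ : f n = fun t => \sum_j c j * (X j t)%:C%C); last by apply/funext => t; exact: fE.
  rewrite sqnorm_gram//; congr EFin; apply: eq_bigr => j _; apply: eq_bigr => l _.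
  congr (_ * _); rewrite /X; case: eqP => _ /=; last first.
    by under eq_Rintegral do rewrite mul0r; rewrite Rintegral_cst// mul0r.
  case: eqP => _; last by under eq_Rintegral do rewrite mulr0; rewrite Rintegral_cst// mul0r.
  exact: tensor_power_gram.
rewrite (fock_sqdist_finite (N := N)) => [|n Nn]; last first.
  rewrite term big1 ?mulr0// => j _; rewrite big1// => l _.
  by rewrite gtn_eqF ?mulr0//; exact: leq_trans (mN j) Nn.
rewrite sqnorm_gram; last by move=> j; exact: charlier_square_integrable.
under eq_bigr do rewrite term.
rewrite sumEFin; congr EFin; rewrite big_mkord.
under eq_bigr do rewrite mulr_sumr; rewrite exchange_big; apply: eq_bigr => j _ /=.
under eq_bigr do rewrite mulr_sumr; rewrite exchange_big; apply: eq_bigr => l _ /=.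
rewrite charlier_gram// (bigD1 (Ordinal (mN j)))//= eqxx [X in _ + X]big1 ?addr0; last first.
  move=> n nj; rewrite (_ : (n == m j :> nat) = false) ?mulr0//.
  by apply: contraNF nj => /eqP nj; apply/eqP/val_inj.
by case: eqP => _; rewrite ?mulr0// mulrCA.
Qed.

Lemma chaos_span_isometry f F g G : chaos_span f F -> chaos_span g G ->
  fock_sqdist sigma f g = sqdist (L2 P) F G.
Proof.
move=> H H'; have := chaos_span_norm (chaos_spanD H (chaos_spanZ (-1) H')).
under [in sqnorm _ _]eq_fun do rewrite mulN1r.
move=> E; rewrite [RHS](_ : _ = sqnorm P (fun gam => F gam - G gam))// -[RHS]E; apply: eq_eseriesr => n _; congr (_ * sqnorm _ _)%E.
by apply/funext => t; rewrite mulN1r subr0.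
Qed.

Lemma charlier_span_embed n h H : graph_span (@charlier_power _ _ C n) h H ->
  exists f, [/\ chaos_span f H, f n = h & forall m, m != n -> f m = fun=> 0].
Proof.
move=> [k [c [vs [ws [Hj -> ->]]]]]; have /choice[psi Hpsi] := Hj.
exists (fun m t => \sum_j c j * (if m == n then tensor_power (psi j) t else 0)%:C%C); split.
- apply/chaos_spanP; exists k, c, (fun=> n), psi; split=> //; first by move=> j; case: (Hpsi j).
  by apply/funext => gam; apply: eq_bigr => j _; case: (Hpsi j) => _ _ ->.
- by apply/funext => t; apply: eq_bigr => j _; rewrite eqxx; case: (Hpsi j) => _ -> _.
- move=> m mn; apply/funext => t; rewrite big1// => j _.
  by rewrite (negbTE mn) mulr0.
Qed.

Lemma chaos_span_components f F : chaos_span f F -> exists (Y : nat -> Gamma R d -> R[i]) N,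
  [/\ forall n, graph_span (@charlier_power _ _ C n) (f n) (Y n),
    forall n, (N <= n)%N -> f n = fun=> 0 &
    forall N', (N <= N')%N -> F = fun gam => \sum_(n < N') Y n gam].
Proof.
move=> /chaos_spanP[k [c [m [psi [tp fE ->]]]]].
exists (fun n gam => \sum_j (if n == m j then c j else 0) *
  (C gam (@tensor_power R (Rd R d) n (psi j)))%:C%C).
exists (\max_j m j).+1; have mN j : (m j < (\max_j m j).+1)%N by rewrite ltnS leq_bigmax.
split=> [n|n Nn|N' NN'].
- exists k, (fun j => if n == m j then c j else 0),
    (fun j t => (tensor_power (psi j) t)%:C%C),
    (fun j gam => (C gam (@tensor_power R (Rd R d) n (psi j)))%:C%C); split=> //.
    by move=> j; exists (psi j).
  apply/funext => t; rewrite fE; apply: eq_bigr => j _.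
  by case: ifP => _; rewrite ?mulr0 ?mul0r.
- apply/funext => t; rewrite fE big1// => j _.
  by rewrite gtn_eqF ?mulr0//; exact: leq_trans (mN j) Nn.
- apply/funext => gam; rewrite exchange_big; apply: eq_bigr => j _ /=.
  rewrite (bigD1 (Ordinal (leq_trans (mN j) NN')))//= eqxx [X in _ + X]big1 ?addr0//.
  move=> n nj; rewrite (_ : (n == m j :> nat) = false) ?mul0r//.
  by apply: contraNF nj => /eqP nj; apply/eqP/val_inj.
Qed.

Lemma charlier_span_isometry n h H h' H' : graph_span (@charlier_power _ _ C n) h H ->
  graph_span (@charlier_power _ _ C n) h' H' ->
  sqdist (L2 P) H H' = ((n`!%:R)%:E * sqdist (L2 (M n)) h h')%E.
Proof.
move=> /charlier_span_embed[f [fH <- f0]] /charlier_span_embed[g [gH <- g0]].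
rewrite -(chaos_span_isometry fH gH) (fock_sqdist_finite (N := n.+1)) => [|m nm]; last first.
  by rewrite /fock_term f0 ?g0 ?gtn_eqF// (sqdistxx (Exp_n_quadratic sigma m)) mule0.
rewrite big_nat_recr//= big_nat big1 ?add0e// => m /andP[_ mn].
by rewrite /fock_term f0 ?g0 ?ltn_eqF// (sqdistxx (Exp_n_quadratic sigma m)) mule0.
Qed.

End ChaosSpan.

(** * Extension of the isometry from the span to all of Fock space *)

Section ChaosMap.
Context {R : realType} {d : nat}.
Variable sigma : {sigma_finite_measure set (Rd R d) -> \bar R}.
Hypothesis sigma_radon : radon sigma.
Variable P : probability (Gamma R d) R.
Hypothesis P_poisson : is_poisson sigma P.
Variable C : forall n, config R d -> (n.-tuple (Rd R d) -> R) -> R.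
Hypothesis C_charlier : charlier_kernels sigma C.
Local Notation M n := (tensor_measure sigma (n := n)).
Local Notation fock_seq := (fock_seq (R := R) (d := d)).
Local Notation fock0 := (@fock0 R d).
Implicit Types (f g : fock_seq) (F G : Gamma R d -> R[i]) (Y : nat -> Gamma R d -> R[i]).

Let qF := fock_quadratic sigma.
Let qP := L2_quadratic P.
Let spanm f F (H : chaos_span C f F) := chaos_span_cmeasurable sigma_radon P_poisson C_charlier H.

Lemma chaos_cmeasurable f F : chaos sigma P C f F -> fock_cmeasurable f /\ cmeasurable F.
Proof.
move=> [[mf _] sF _]; split=> [n|]; first exact: Exp_n_cmeasurable (mf n).
exact: square_integrable_measurable sF.
Qed.

Lemma fock_sqdistD f f' g g' (e : R) : fock_cmeasurable f -> fock_cmeasurable f' ->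
  fock_cmeasurable g -> fock_cmeasurable g' ->
  (fock_sqdist sigma f f' <= (e / 4)%:E)%E -> (fock_sqdist sigma g g' <= (e / 4)%:E)%E ->
  (fock_sqdist sigma (fun n t => f n t + g n t)%R (fun n t => f' n t + g' n t)%R <= e%:E)%E.
Proof.
move=> mf mf' mg mg' ff gg.
have E1 : fock_sqdist sigma (fun n t => f n t + g n t) (fun n t => f' n t + g n t) =
    fock_sqdist sigma f f'.
  apply: eq_eseriesr => n _; congr (_ * sqnorm _ _)%E.
  by apply/funext => t; rewrite opprD addrACA subrr addr0.
have E2 : fock_sqdist sigma (fun n t => f' n t + g n t) (fun n t => f' n t + g' n t) =
    fock_sqdist sigma g g'.
  apply: eq_eseriesr => n _; congr (_ * sqnorm _ _)%E.
  by apply/funext => t; rewrite opprD addrACA subrr add0r.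
rewrite -E1 in ff; rewrite -E2 in gg.
have mD (h h' : fock_seq) : fock_cmeasurable h -> fock_cmeasurable h' ->
    fock_cmeasurable (fun n t => h n t + h' n t) by move=> mh mh' n; exact: cmeasurableD.
exact (sqdist_triangle2 qF (mD _ _ mf mg) (mD _ _ mf' mg) (mD _ _ mf' mg') ff gg).
Qed.

(** Each chaos comes with its own approximants in the span of powers; these are embedded in Fock
    space and added degree by degree. *)
Lemma charlier_integral_approx f Y : (forall n, charlier_integral sigma P C (f n) (Y n)) ->
  forall N, approximable (fock sigma) (L2 P) (chaos_span C) (truncate N f)
    (fun gam => \sum_(n < N) Y n gam).
Proof.
move=> fY; have mf n : cmeasurable (f n) by have [m _ _] := fY n; exact: Exp_n_cmeasurable m.
have mY n : cmeasurable (Y n) by have [_ m _] := fY n; exact: square_integrable_measurable m.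
have mt N : fock_cmeasurable (truncate N f).
  move=> n; have [nN|nN] := ltnP n N; first by rewrite truncate_lt.
  by rewrite truncate_ge//; exact: cmeasurable_cst.
elim=> [|N IH] e e0.
  exists fock0, (fun=> 0); split; first exact: chaos_span0.
    rewrite (_ : truncate 0 f = fock0) ?(sqdistxx qF) ?lee_fin ?ltW//.
  by under [X in sqdist _ _ X]eq_fun do rewrite big_ord0; rewrite (sqdistxx qP) lee_fin ltW.
have e4 : 0 < e / 4 by rewrite divr_gt0.
have [f' [F' [H' d1 d2]]] := IH _ e4.
have N0 : 0 < N`!%:R :> R by rewrite ltr0n fact_gt0.
(* The tolerance in degree [N] is divided by [N!], the weight of that degree in the Fock norm. *)
have a0 : 0 < e / 4 / N`!%:R by rewrite divr_gt0.
have /(graph_closureP (Exp_n_quadratic sigma N) qP)[_ _ /(_ _ a0)[h [K [hK d3 d4]]]] := fY N.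
have [g [gK gh g0]] := charlier_span_embed hK.
have [mf' mF'] := spanm H'; have [mg mK] := spanm gK.
pose s : fock_seq := fun n t => if n == N then f n t else 0.
have ms : fock_cmeasurable s.
  by move=> n; rewrite /s; case: eqP => _; [exact: mf|exact: cmeasurable_cst].
exists (fun n t => f' n t + g n t), (fun gam => F' gam + K gam); split.
- exact: chaos_spanD.
- have -> : truncate N.+1 f = fun n t => truncate N f n t + s n t.
    apply/functional_extensionality_dep => n; apply/funext => t.
    rewrite /truncate /s ltnS leq_eqVlt; case: ltngtP => _ /=; by rewrite ?addr0 ?add0r.
  apply: (fock_sqdistD mf' (mt N) mg ms d1).
  rewrite (fock_sqdist_finite (N := N.+1)) => [|n Nn]; last first.
    rewrite /fock_term g0 ?gtn_eqF// (_ : s n = fun=> 0).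
      by rewrite (sqdistxx (Exp_n_quadratic sigma n)) mule0.
    by apply/funext => t; rewrite /s gtn_eqF.
  rewrite big_nat_recr//= big_nat big1 ?add0e => [|n /andP[_ nN]].
    rewrite /fock_term gh (_ : s N = f N); last by apply/funext => t; rewrite /s eqxx.
    apply: le_trans (lee_wpmul2l _ d3) _; rewrite ?lee_fin//.
    by rewrite mulrC divfK ?gt_eqF.
  rewrite /fock_term g0 ?ltn_eqF// (_ : s n = fun=> 0).
    by rewrite (sqdistxx (Exp_n_quadratic sigma n)) mule0.
  by apply/funext => t; rewrite /s ltn_eqF.
- under [X in sqdist _ _ X]eq_fun do rewrite big_ord_recr/=.
  apply: sqdistD => //; first by apply: cmeasurable_sum.
  apply: le_trans d4 _; rewrite lee_fin ler_pdivrMr//.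
  by apply: ler_peMr; [exact: ltW|rewrite ler1n fact_gt0].
Qed.

Lemma chaos_approx f F : chaos sigma P C f F ->
  approximable (fock sigma) (L2 P) (chaos_span C) f F.
Proof.
move=> H e e0; have [mf' mF'] := chaos_cmeasurable H; have [[mf ff] sF [Y [HY cY]]] := H.
have e4 : 0 < e / 4 by rewrite divr_gt0.
have [N1 H1] := fock_tail ff e4; have [N2 H2] := (l2cvgP qP _ _).1 cY _ e4.
pose N := maxn N1 N2; have {}H1 := H1 N (leq_maxl _ _); have {}H2 := H2 N (leq_maxr _ _).
have [g [G [gG d1 d2]]] := charlier_integral_approx HY N e4; exists g, G; split=> //.
  have mt : fock_cmeasurable (truncate N f).
    move=> n; have [nN|nN] := ltnP n N; first by rewrite truncate_lt.
    by rewrite truncate_ge//; exact: cmeasurable_cst.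
  exact (sqdist_triangle2 qF (spanm gG).1 mt mf' d1 H1).
have mS : cmeasurable (fun gam => \sum_(n < N) Y n gam).
  apply: cmeasurable_sum => n; have [_ m _] := HY n; exact: square_integrable_measurable m.
exact (sqdist_triangle2 qP (spanm gG).2 mS mF' d2 H2).
Qed.

Lemma chaos_isometry f F g G : chaos sigma P C f F -> chaos sigma P C g G ->
  fock_sqdist sigma f g = sqdist (L2 P) F G.
Proof.
move=> H H'; have [mf mF] := chaos_cmeasurable H; have [mg mG] := chaos_cmeasurable H'.
have iso f1 F1 f2 F2 (H1 : chaos_span C f1 F1) (H2 : chaos_span C f2 F2) :=
  chaos_span_isometry sigma_radon P_poisson C_charlier H1 H2.
apply/eqP; rewrite eq_le; apply/andP; split; rewrite -[leRHS]mul1e.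
  apply: (approximable_le qF qP ler01 (@spanm) _ mf mF mg mG).
  - by move=> f1 F1 f2 F2 H1 H2; rewrite mul1e -(iso _ _ _ _ H1 H2).
  - exact: chaos_approx.
  - exact: chaos_approx.
apply: (approximable_le (G := fun F f => chaos_span C f F) qP qF ler01 _ _ mF mf mG mg).
- by move=> F1 f1 /spanm[].
- by move=> F1 f1 F2 f2 H1 H2; rewrite mul1e -(iso _ _ _ _ H1 H2).
- by move=> e /(chaos_approx H)[f1 [F1 [h1 h2 h3]]]; exists F1, f1.
- by move=> e /(chaos_approx H')[f1 [F1 [h1 h2 h3]]]; exists F1, f1.
Qed.

Lemma charlier_integral0 n : charlier_integral sigma P C (fun _ : n.-tuple (Rd R d) => 0) (fun=> 0).
Proof.
apply/(graph_closureP (Exp_n_quadratic sigma n) qP).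
split; [exact: mem_Exp_n0|exact: square_integrable0|move=> e e0].
exists (fun=> 0), (fun=> 0); rewrite (sqdistxx (Exp_n_quadratic sigma n)) (sqdistxx qP).
rewrite lee_fin ltW//; split=> //.
exists 0%N, (fun=> 0), (fun=> fun=> 0), (fun=> fun=> 0); split; first by case.
  by apply/funext => t; rewrite big_ord0.
by apply/funext => gam; rewrite big_ord0.
Qed.

Lemma chaos_truncate f Y N : (forall n, charlier_integral sigma P C (f n) (Y n)) ->
  chaos sigma P C (truncate N f) (fun gam => \sum_(n < N) Y n gam).
Proof.
move=> fY; split.
- by apply: mem_fock_truncate => n; case: (fY n).
- by apply: square_integrable_sum => n; case: (fY n).
exists (fun n => if (n < N)%N then Y n else fun=> 0); split=> [n|].
  have [nN|nN] := ltnP n N; first by rewrite truncate_lt.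
  by rewrite truncate_ge//; exact: charlier_integral0.
apply/(l2cvgP qP) => e e0; exists N => k Nk.
rewrite (_ : (fun gam => \sum_(n < k) _) = fun gam => \sum_(n < N) Y n gam).
  by rewrite (sqdistxx qP) lee_fin ltW.
apply/funext => gam; rewrite (big_ord_widen _ (fun n => Y n gam) Nk) [RHS]big_mkcond.
by apply: eq_bigr => n _; case: ifP.
Qed.

Lemma chaos_span_chaos f F : chaos_span C f F -> chaos sigma P C f F.
Proof.
move=> H; have [Y [N [HY f0 FE]]] := chaos_span_components H.
have sY n : charlier_integral sigma P C (f n) (Y n).
  apply/(graph_closureP (Exp_n_quadratic sigma n) qP); split.
  - exact: (chaos_span_mem sigma_radon P_poisson C_charlier n H).
  - have [f' [H' _ _]] := charlier_span_embed (HY n).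
    exact: (chaos_span_square_integrable sigma_radon P_poisson C_charlier H').2.
  - move=> e e0; exists (f n), (Y n); split; first exact: HY.
      by rewrite (sqdistxx (Exp_n_quadratic sigma n)) lee_fin ltW.
    by rewrite (sqdistxx qP) lee_fin ltW.
have := chaos_truncate N sY; rewrite -(FE N)//.
rewrite (_ : truncate N f = f)//; apply/functional_extensionality_dep => n.
have [nN|nN] := ltnP n N; first by rewrite truncate_lt.
by rewrite truncate_ge// f0.
Qed.

(** By isometry and completeness, preimages of a convergent sequence converge. The work is to write
    [G] as the series that [chaos] demands: the components of [F k] converge in each degree to some
    [Z n], and partial sums of [Z] are compared with a single [F k]. *)
Lemma chaos_lim (f : nat -> fock_seq) (F : nat -> Gamma R d -> R[i]) G :
  (forall k, chaos_span C (f k) (F k)) -> square_integrable P G -> l2cvg (L2 P) F G ->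
  exists2 g, chaos sigma P C g G & l2cvg (fock sigma) f g.
Proof.
move=> H sG cF; have mG := square_integrable_measurable sG.
have mF k := (spanm (H k)).2; have mf k := (spanm (H k)).1.
have cau (e : R) : 0 < e -> exists K, forall k l, (K <= k)%N -> (K <= l)%N ->
    (sqdist (L2 P) (F k) (F l) <= e%:E)%E.
  move=> e0; have e4 : 0 < e / 4 by rewrite divr_gt0.
  have [K HK] := (l2cvgP qP _ _).1 cF _ e4; exists K => k l Kk Kl.
  have h := HK _ Kl; rewrite (sqdistC qP) in h.
  exact (sqdist_triangle2 qP (mF k) mG (mF l) (HK _ Kk) h).
have iso k l := chaos_span_isometry sigma_radon P_poisson C_charlier (H k) (H l).
have [|k n s t|e e0|g [mg cg]] := @fock_complete _ _ sigma f.
- by move=> k n; exact: (chaos_span_square_integrable sigma_radon P_poisson C_charlier (H k)).1.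
- exact: chaos_span_perm (H k).
- by have [K HK] := cau _ e0; exists K => k l Kk Kl; rewrite iso; exact: HK.
have mg' : fock_cmeasurable g by move=> n; exact: Exp_n_cmeasurable (mg n).
have /choice[Y HY] : forall k, exists Y, (forall n, graph_span (@charlier_power _ _ C n) (f k n) (Y n)) /\
    exists N, (forall n, (N <= n)%N -> f k n = fun=> 0) /\
      forall N', (N <= N')%N -> F k = fun gam => \sum_(n < N') Y n gam.
  by move=> k; have [Y [N [h1 h2 h3]]] := chaos_span_components (H k); exists Y; split=> //; exists N.
have sY k n : square_integrable P (Y k n).
  have [f' [H' _ _]] := charlier_span_embed ((HY k).1 n).
  exact: (chaos_span_square_integrable sigma_radon P_poisson C_charlier H').2.
have /choice[Z HZ] : forall n, exists Z, square_integrable P Z /\ l2cvg (L2 P) (fun k => Y k n) Z.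
  move=> n; have [||i Hi] := L2_complete (mu := P) (u := fun k => Y k n); last by eexists; exact: Hi.
    by move=> k; exact: sY.
  move=> e /cau[K HK]; exists K => k l Kk Kl; apply: le_trans (HK _ _ Kk Kl).
  rewrite (charlier_span_isometry sigma_radon P_poisson C_charlier ((HY k).1 n) ((HY l).1 n)).
  by rewrite -iso; exact: (fock_term_le sigma n (f k) (f l)).
have gZ n : charlier_integral sigma P C (g n) (Z n).
  have [sZ cZ] := HZ n; split=> //; exists (fun k => f k n), (fun k => Y k n); split=> //.
    by move=> k; exact: (HY k).1.
  apply/(l2cvgP (Exp_n_quadratic sigma n)) => e e0.
  have [K HK] := (l2cvgP qF _ _).1 cg _ e0; exists K => k Kk.
  exact: le_trans (Exp_n_le_fock sigma n (f k) g) (HK _ Kk).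
exists g => //; split=> //.
  have [K HK] := (l2cvgP qF _ _).1 cg 1 ltr01.
  apply: (mem_fock_near (mf K) mg); last by apply: le_lt_trans (HK _ (leqnn K)) _; rewrite ltry.
  by have [[_ h] _ _] := chaos_span_chaos (H K).
exists Z; split=> //; apply/(l2cvgP qP) => e e0; have e4 : 0 < e / 4 by rewrite divr_gt0.
have [K1 H1] := (l2cvgP qF _ _).1 cg _ e4; have [K2 H2] := (l2cvgP qP _ _).1 cF _ e4.
pose k := maxn K1 K2; have {}H1 := H1 k (leq_maxl _ _); have {}H2 := H2 k (leq_maxr _ _).
have [_ [N [f0 _]]] := HY k; exists N => N' NN'.
have ct := chaos_truncate N' gZ; have [_ mS] := chaos_cmeasurable ct.
suff h : (sqdist (L2 P) (fun gam => (\sum_(n < N') Z n gam)%R) (F k) <= (e / 4)%:E)%E.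
  exact (sqdist_triangle2 qP mS (mF k) mG h H2).
rewrite -(chaos_isometry ct (chaos_span_chaos (H k))).
(* [f k] has finitely many nonzero components, so for large [N'] truncation leaves it unchanged and
   both arguments are truncated alike. *)
have -> : f k = truncate N' (f k).
  apply/functional_extensionality_dep => n.
  have [nN|nN] := ltnP n N'; first by rewrite truncate_lt.
  by rewrite truncate_ge// f0//; exact: leq_trans nN.
rewrite fock_truncate; apply: le_trans (fock_partial_le sigma N' g (f k)) _.
by rewrite [leLHS](sqdistC qF).
Qed.

End ChaosMap.

(** * The annihilation operator *)

Section Annihilation.
Context {R : realType} {d : nat}.
Variable sigma : {sigma_finite_measure set (Rd R d) -> \bar R}.
Hypothesis sigma_radon : radon sigma.
Variable P : probability (Gamma R d) R.
Hypothesis P_poisson : is_poisson sigma P.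
Variable C : forall n, config R d -> (n.-tuple (Rd R d) -> R) -> R.
Hypothesis C_charlier : charlier_kernels sigma C.
Variable phi : 'rV[R]_d -> R.
Hypothesis phi_test : test_function phi.
Local Notation M n := (tensor_measure sigma (n := n)).
Local Notation fock_seq := (fock_seq (R := R) (d := d)).
Local Notation coef := (charlier_coef C).
Local Notation tpower n psi := (@tensor_power R (Rd R d) n psi).
Implicit Types (f g : fock_seq) (F G : Gamma R d -> R[i]) (psi : 'rV[R]_d -> R).

Let sphi := test_square_integrable sigma_radon phi_test.
Let qP := L2_quadratic P.
Let wickm := @wick_graph_cmeasurable _ _ sigma phi.

Lemma annihilation_component f g n : annihilation sigma phi f g ->
  annihilation_n sigma phi (f n.+1) (g n).
Proof.
move=> [[mf _] [mg _] [fs [gs [H cf cg]]]].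
have q := Exp_n_quadratic sigma n; have q' := Exp_n_quadratic sigma n.+1.
apply: (graph_closure_lim q' q (@Exp_n_cmeasurable _ _ sigma n.+1)
  (@Exp_n_cmeasurable _ _ sigma n) _ (mf _) (mg _)) => [v w /(contracts_span sphi)[]//|e e0].
have [K1 H1] := (l2cvgP (fock_quadratic sigma) _ _).1 cf _ e0.
have [K2 H2] := (l2cvgP (fock_quadratic sigma) _ _).1 cg _ e0.
pose k := maxn K1 K2; exists (fs k n.+1), (gs k n); split.
- by have [_ _ _ h] := H k; exact: h.
- exact: le_trans (Exp_n_le_fock sigma n.+1 (fs k) f) (H1 k (leq_maxl _ _)).
- exact: le_trans (Exp_n_le_fock sigma n (gs k) g) (H2 k (leq_maxr _ _)).
Qed.

Lemma annihilation_tensor_power n psi : test_function psi ->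
  annihilation_tensor sigma phi (fun t => (tpower n.+1 psi t)%:C%C)
    (fun t => ((n.+1%:R * \int[sigma]_x (phi x * psi x)) * tpower n psi t)%:C%C).
Proof.
move=> tp; exists (fun=> psi); split.
- by move=> i; exact: test_square_integrable.
- by apply/funext => t; rewrite sym_tensor_power.
- apply/funext => t; congr (_%:C)%C; rewrite sumr_const card_ord sym_tensor_power.
  by rewrite -[RHS]mulr_natl mulrA.
Qed.

(** On combinations of powers everything is explicit: one element [K] is at once the chaos image of
    the annihilated tensor and the partner of [H] in the closed exponential graph. *)
Lemma charlier_span_annihilation n h H : graph_span (@charlier_power _ _ C n.+1) h H ->
  exists k K, [/\ graph_span (@annihilation_tensor _ _ sigma phi n) h k,
    graph_span (@charlier_power _ _ C n) k K & wick_closure sigma P phi H K].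
Proof.
move=> [l [c [vs [ws [Hj -> ->]]]]]; have /choice[psi Hpsi] := Hj.
have tp j : test_function (psi j) by case: (Hpsi j).
pose a j : R := n.+1%:R * \int[sigma]_x (phi x * psi j x).
exists (fun t => \sum_j c j * (a j * tpower n (psi j) t)%:C%C).
exists (fun gam => \sum_j c j * (a j * C gam (tpower n (psi j)))%:C%C); split.
- exists l, c, vs, (fun j t => (a j * tpower n (psi j) t)%:C%C); split=> // j.
  by have [_ -> _] := Hpsi j; exact: annihilation_tensor_power.
- exists l, (fun j => c j * (a j)%:C%C), (fun j t => (tpower n (psi j) t)%:C%C),
    (fun j gam => (C gam (tpower n (psi j)))%:C%C); split.
  + by move=> j; exists (psi j).
  + by apply/funext => t; apply: eq_bigr => j _; rewrite real_complexM mulrA.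
  + by apply/funext => t; apply: eq_bigr => j _; rewrite real_complexM mulrA.
- apply: (L2_closure_sum wickm) => j; apply: (L2_closureZ wickm).
  have [_ _ ->] := Hpsi j.
  (* The kernel of degree [n + 1] is [(n + 1)!] times the coefficient, and [(n + 1)!] splits into
     the factor [n + 1] of annihilation and the [n!] of the kernel of degree [n]. *)
  have := L2_closureZ wickm (n.+1`!%:R)%:C%C
    (wick_closure_charlier sigma_radon P_poisson phi_test C_charlier n.+1 (tp j)).
  congr graph_closure; apply/funext => gam; rewrite -real_complexM charlier_coefE//.
  by congr (_%:C)%C; rewrite factS natrM /a; ring.
Qed.

Lemma charlier_span_vacuum h H : graph_span (@charlier_power _ _ C 0) h H ->
  wick_closure sigma P phi H (fun=> 0).
Proof.
move=> [l [c [vs [ws [Hj _ ->]]]]]; have /choice[psi Hpsi] := Hj.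
rewrite (_ : (fun=> 0) = fun gam : Gamma R d => \sum_(j < l) c j * 0); last first.
  by apply/funext => gam; rewrite big1// => j _; rewrite mulr0.
apply: (L2_closure_sum wickm) => j; apply: (L2_closureZ wickm).
have [tp _ ->] := Hpsi j.
have := wick_closure_charlier sigma_radon P_poisson phi_test C_charlier 0 tp.
congr graph_closure; apply/funext => gam; last by rewrite mulr0.
by rewrite charlier_coefE mul1r.
Qed.

Lemma charlier_span_mem n h H : graph_span (@charlier_power _ _ C n) h H ->
  mem_l2 (Exp_n sigma n) h /\ square_integrable P H.
Proof.
move=> /charlier_span_embed[f [fH <- _]]; split.
  exact: (chaos_span_mem sigma_radon P_poisson C_charlier n fH).
exact: (chaos_span_square_integrable sigma_radon P_poisson C_charlier fH).2.
Qed.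

Lemma charlier_integral_bound n h H k K : charlier_integral sigma P C h H ->
  charlier_integral sigma P C k K ->
  (sqdist (L2 P) H K <= (n`!%:R)%:E * sqdist (Exp_n sigma n) h k)%E.
Proof.
have q := Exp_n_quadratic sigma n.
move=> /(graph_closureP q qP)[mh sH HH] /(graph_closureP q qP)[mk sK HK].
apply: (approximable_le (G := fun H h => graph_span (@charlier_power _ _ C n) h H) qP q).
- by rewrite ler0n.
- move=> H1 h1 /charlier_span_mem[m1 s1]; split; first exact: square_integrable_measurable s1.
  exact: Exp_n_cmeasurable m1.
- move=> H1 h1 H2 h2 s1 s2.
  by rewrite (charlier_span_isometry sigma_radon P_poisson C_charlier s1 s2).
- exact: square_integrable_measurable sH.
- exact: Exp_n_cmeasurable mh.
- exact: square_integrable_measurable sK.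
- exact: Exp_n_cmeasurable mk.
- by move=> e /HH[v [w [s1 d1 d2]]]; exists w, v.
- by move=> e /HK[v [w [s1 d1 d2]]]; exists w, v.
Qed.

Lemma span_charlier_integral n h H : graph_span (@charlier_power _ _ C n) h H ->
  charlier_integral sigma P C h H.
Proof.
move=> s; have [mh sH] := charlier_span_mem s; have q := Exp_n_quadratic sigma n.
apply/(graph_closureP q qP); split=> // e e0; exists h, H; split=> //.
  by rewrite (sqdistxx q) lee_fin ltW.
by rewrite (sqdistxx qP) lee_fin ltW.
Qed.

Lemma span_annihilation_n n h k : mem_l2 (Exp_n sigma n.+1) h -> mem_l2 (Exp_n sigma n) k ->
  graph_span (@annihilation_tensor _ _ sigma phi n) h k -> annihilation_n sigma phi h k.
Proof.
move=> mh mk s; have q := Exp_n_quadratic sigma n; have q' := Exp_n_quadratic sigma n.+1.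
apply/(graph_closureP q' q); split=> // e e0; exists h, k; split=> //.
  by rewrite (sqdistxx q') lee_fin ltW.
by rewrite (sqdistxx q) lee_fin ltW.
Qed.

(** Only [h] is approximated from the span. The annihilated approximant is close to [k] by the
    Lipschitz bound, hence its chaos image is close to [K], so that both members of the pair
    converge together. *)
Lemma charlier_wick_closure n h H k K : charlier_integral sigma P C h H ->
  charlier_integral sigma P C k K -> annihilation_n sigma phi (n := n) h k ->
  wick_closure sigma P phi H K.
Proof.
move=> cH cK a; have q := Exp_n_quadratic sigma n; have q' := Exp_n_quadratic sigma n.+1.
have /(graph_closureP q' qP)[mh sH HH] := cH; have /(graph_closureP q qP)[mk sK HK] := cK.
apply: (L2_closure_lim wickm sH sK) => e e0.
(* The constant of the composite bound; divisions use [B + 1] since [B] may be 0. *)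
pose B := n`!%:R * annihilation_bound sigma phi n.
have b0 : 0 <= annihilation_bound sigma phi n.
  by rewrite mulr_ge0 ?sqr_ge0//; apply: Rintegral_ge0 => x _; rewrite -expr2 sqr_ge0.
have B0 : 0 <= B by rewrite mulr_ge0.
have B1 : 0 < B + 1 by rewrite ltr_wpDl.
have a0 : 0 < e / (B + 1) by rewrite divr_gt0.
have [v [w [s d1 d2]]] := HH _ a0.
have [v' [w' [s1 s2 Vw]]] := charlier_span_annihilation s.
have ae : e / (B + 1) <= e.
  by rewrite ler_pdivrMr//; apply: ler_peMr; [exact: ltW|rewrite lerDr].
exists w, w'; split=> //; first by apply: le_trans d2 _; rewrite lee_fin.
have a' := span_annihilation_n (charlier_span_mem s).1 (charlier_span_mem s2).1 s1.
apply: le_trans (charlier_integral_bound (span_charlier_integral s2) cK) _.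
apply: le_trans (lee_wpmul2l _ (annihilation_n_lipschitz sphi a' a)) _; first by rewrite lee_fin.
apply: le_trans (lee_wpmul2l _ (lee_wpmul2l _ d1)) _; rewrite ?lee_fin//.
rewrite mulrA -/B mulrCA; apply: ler_piMr; first exact: ltW.
by rewrite ler_pdivrMr// mul1r lerDl.
Qed.

Lemma chaos_wick_closure f F g G : chaos sigma P C f F -> chaos sigma P C g G ->
  (forall n, annihilation_n sigma phi (f n.+1) (g n)) -> wick_closure sigma P phi F G.
Proof.
move=> [_ sF [Y [HY cY]]] [_ sG [Z [HZ cZ]]] a.
have V0 : wick_closure sigma P phi (Y 0%N) (fun=> 0).
  have /(graph_closureP (Exp_n_quadratic sigma 0) qP)[_ sY H0] := HY 0%N.
  apply: (L2_closure_lim wickm sY (square_integrable0 P)) => e e0.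
  have [v [w [s _ d2]]] := H0 _ e0.
  exists w, (fun=> 0); split=> //; first exact: charlier_span_vacuum s.
  by rewrite (sqdistxx qP) lee_fin ltW.
have VS n : wick_closure sigma P phi (Y n.+1) (Z n).
  exact: (charlier_wick_closure (HY n.+1) (HZ n) (a n)).
(* Partial sums of lengths [N.+1] and [N] are paired: degree 0 goes to 0, and degree [n + 1] to
   degree [n]. *)
apply: (L2_closure_cvg wickm (u := fun N gam => \sum_(n < N.+1) Y n gam)
  (w := fun N gam => \sum_(n < N) Z n gam)) => // [N|].
  have := L2_closureD wickm V0 (L2_closure_sum wickm (index_enum 'I_N) (fun n : 'I_N => VS n)).
  congr graph_closure; apply/funext => gam; last by rewrite add0r.
  by rewrite big_ord_recl.
apply/(l2cvgP qP) => e e0; have [K HK] := (l2cvgP qP _ _).1 cY _ e0.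
by exists K => k Kk; apply: HK; exact: leqW.
Qed.

End Annihilation.

(** * From the exponential graph back to Fock space; uniqueness of the image *)

Section TruncatedExponentials.
Context {R : realType} {d : nat}.
Variable sigma : {sigma_finite_measure set (Rd R d) -> \bar R}.
Hypothesis sigma_radon : radon sigma.
Variable P : probability (Gamma R d) R.
Hypothesis P_poisson : is_poisson sigma P.
Variable C : forall n, config R d -> (n.-tuple (Rd R d) -> R) -> R.
Hypothesis C_charlier : charlier_kernels sigma C.
Variable phi : 'rV[R]_d -> R.
Hypothesis phi_test : test_function phi.
Local Notation fock_seq := (fock_seq (R := R) (d := d)).
Local Notation coef := (charlier_coef C).
Local Notation tpower n psi := (@tensor_power R (Rd R d) n psi).
Implicit Types (f g : fock_seq) (F G : Gamma R d -> R[i]) (psi : 'rV[R]_d -> R).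

(** [annihilation_finite] acts on sequences with finitely many entries, so the exponentials are cut
    off; the image has one term fewer because a degree is lost. *)
Definition truncated_wick_graph F G := exists psi N, [/\ test_function psi,
  F = (fun gam => (\sum_(n < N.+1) coef n psi gam)%:C%C) &
  G = (fun gam => (\int[sigma]_x (phi x * psi x) * \sum_(n < N) coef n psi gam)%:C%C)].

Lemma truncated_wick_cmeasurable F G : truncated_wick_graph F G ->
  cmeasurable F /\ cmeasurable G.
Proof.
move=> [psi [N [tp -> ->]]].
have m k : measurable_fun setT (fun gam : Gamma R d => \sum_(n < k) coef n psi gam).
  by apply: measurable_sum => n; exact: (measurable_charlier_coef sigma_radon C_charlier).
split; apply: cmeasurable_real; first exact: m.
by apply: measurable_funM; [exact: measurable_cst|exact: m].
Qed.

Let truncm := truncated_wick_cmeasurable.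

Lemma wick_closure_truncated F G : wick_closure sigma P phi F G ->
  graph_closure (L2 P) (L2 P) (graph_span truncated_wick_graph) F G.
Proof.
move=> /(L2_closureP P P (wick_graph sigma phi))[sF sG H].
apply: (L2_closure_lim truncm sF sG) => e e0.
have [v [w [[k [c [vs [ws [Hj -> ->]]]]] d1 d2]]] := H _ e0.
exists (fun gam => \sum_j c j * vs j gam), (fun gam => \sum_j c j * ws j gam); split=> //.
apply: (L2_closure_sum truncm) => j; apply: (L2_closureZ truncm).
have [psi [tp p1 -> ->]] := Hj j; pose q := \int[sigma]_x (phi x * psi x).
have [B sB bB] := charlier_bound_square_integrable sigma_radon P_poisson tp tp.
have iB := integrable_prod_square sB sB.
(* The partial sums of the expansion at [t = 1], where it still converges to the Wick exponential
   because [psi] stays above -1; [charlier_bound] majorizes them. *)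
pose u N (gam : Gamma R d) := \sum_(n < N) coef n psi gam.
have ucvg gam : (u ^~ gam) @ \oo --> wick sigma psi gam.
  have E : (fun x => 1 * psi x) = psi by apply/funext => x; rewrite mul1r.
  have h : series (fun n => coef n psi gam * 1 ^+ n) @ \oo --> wick sigma (fun x => 1 * psi x) gam.
    by apply: (charlier_coef_series sigma_radon C_charlier) => // x; rewrite mul1r.
  rewrite E /series/= in h; move: h; under eq_fun do rewrite big_mkord.
  by under eq_fun do under eq_bigr do rewrite expr1n mulr1.
have ubound N gam : `|u N gam| <= B gam.
  have h : `|\sum_(n < N) coef n psi gam * 1 ^+ n| <= charlier_bound sigma psi psi gam.
    by apply: (charlier_coef_partial sigma_radon C_charlier); rewrite ?normr1.
  move: h; under eq_bigr do rewrite expr1n mulr1.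
  by move=> h; exact: le_trans h (bB gam).
have um N : measurable_fun setT (u N).
  by apply: measurable_sum => n; exact: (measurable_charlier_coef sigma_radon C_charlier).
have ul (a : R) s : square_integrable P (fun gam => (a * wick sigma psi gam)%:C%C) /\
    l2cvg (L2 P) (fun N gam => (a * u (N + s)%N gam)%:C%C) (fun gam => (a * wick sigma psi gam)%:C%C).
  apply: (L2_dominated (G := fun gam => (a * a) * (B gam * B gam))).
  - by move=> N; apply: cmeasurable_real; apply: measurable_funM.
  - move=> gam /=; apply: cvgM; first exact: cvg_cst.
    by have := ucvg gam; rewrite -(cvg_shiftn s).
  - by move=> gam /=; exact: cvg_cst.
  - move=> N gam; rewrite sqabs_real exprMn -!expr2 ler_wpM2l ?sqr_ge0//.
    rewrite -real_normK ?num_real// lerXn2r ?nnegrE// (le_trans _ (ubound 0%N gam))//.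
  - by have := integrableZl measurableT (a * a) iB; under eq_fun do rewrite -EFinM.
have [s1 l1] := ul 1 1%N; have [s2 l2] := ul q 0%N.
have E1 : (fun gam => (1 * wick sigma psi gam)%:C%C) = fun gam => (wick sigma psi gam)%:C%C.
  by apply/funext => gam; rewrite mul1r.
rewrite E1 in s1 l1; apply: (L2_closure_cvg truncm _ s1 s2 l1 l2) => N.
have su k0 : square_integrable P (fun gam => (u k0 gam)%:C%C).
  rewrite /u; under eq_fun do rewrite real_complex_sum; apply: square_integrable_sum => n.
  exact: (charlier_coef_square_integrable sigma_radon P_poisson C_charlier).
have sqN : square_integrable P (fun gam => (q * u N gam)%:C%C).
  by under eq_fun do rewrite real_complexM; exact: (square_integrableZ q%:C%C (su N)).
have T : truncated_wick_graph (fun gam => (u N.+1 gam)%:C%C) (fun gam => (q * u N gam)%:C%C).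
  by exists psi, N.
have := L2_closure_gen (su N.+1) sqN T.
by congr graph_closure; apply/funext => gam; rewrite ?mul1r ?addn1 ?addn0.
Qed.

Lemma chaos_span_series (a : nat -> R) N psi : test_function psi ->
  chaos_span C (fun n t => (if (n < N)%N then a n * tpower n psi t else 0)%:C%C)
    (fun gam => (\sum_(n < N) a n * C gam (tpower n psi))%:C%C).
Proof.
move=> tp; apply/chaos_spanP.
exists N, (fun j => (a j)%:C%C), (fun j => j : nat), (fun=> psi); split=> // [n t|].
  have [nN|nN] := ltnP n N.
    rewrite (bigD1 (Ordinal nN))//= eqxx [X in _ + X]big1 ?addr0; first by rewrite real_complexM.
    move=> j jn; rewrite (_ : (n == j :> nat) = false) ?mulr0//.
    by apply: contraNF jn => /eqP jn; apply/eqP/val_inj.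
  by rewrite big1// => j _; rewrite gtn_eqF ?mulr0//; exact: leq_trans (ltn_ord j) nN.
by apply/funext => gam; rewrite real_complex_sum; apply: eq_bigr => j _; rewrite real_complexM.
Qed.

Lemma truncated_wick_span F G : graph_span truncated_wick_graph F G -> exists f g,
  [/\ chaos_span C f F, chaos_span C g G & annihilation_finite sigma phi f g].
Proof.
(* The induction is run on exact statements, membership in spans and a common cut-off; closures are
   entered only afterwards. *)
pose H F G := exists f g N, [/\ chaos_span C f F, chaos_span C g G,
  forall n, graph_span (@annihilation_tensor _ _ sigma phi n) (f n.+1) (g n) &
  forall n, (N <= n)%N -> f n = fun=> 0].
move=> FG; suff [f [g [N [fF gG fg f0]]]] : H F G.
  have [mf _ _] := chaos_span_chaos sigma_radon P_poisson C_charlier fF.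
  have [mg _ _] := chaos_span_chaos sigma_radon P_poisson C_charlier gG.
  have [mfn _] := mf; have [mgn _] := mg.
  exists f, g; split; [exact: fF|exact: gG|split; [exact: mf|exact: mg| |]].
    by exists N => n Nn t; rewrite f0.
  by move=> n; exact: (span_annihilation_n (mfn n.+1) (mgn n) (fg n)).
apply: (graph_span_ind (H := H) _ _ FG) => [|b F1 G1 F2 G2 [psi [N1 [tp -> ->]]] [f [g [N2 [fF gG fg f0]]]]].
  exists fock0, fock0, 0%N; split=> // [||n]; [exact: chaos_span0|exact: chaos_span0|].
  (* The zero pair is 0 times a generator. *)
  have z : annihilation_tensor sigma phi (fun t => (tpower n.+1 (fun=> 0) t)%:C%C)
      (fun t => ((n.+1%:R * \int[sigma]_x (phi x * 0)) * tpower n (fun=> 0) t)%:C%C).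
    by apply: (annihilation_tensor_power sigma_radon); exact: test0.
  have := graph_spanZ 0 (graph_span_gen z).
  by congr graph_span; apply/funext => t; rewrite mul0r.
pose q := \int[sigma]_x (phi x * psi x).
pose a n : R := n`!%:R^-1.
exists (fun n t => b * (if (n < N1.+1)%N then a n * tpower n psi t else 0)%:C%C + f n t).
exists (fun n t => b * (if (n < N1)%N then (q * a n) * tpower n psi t else 0)%:C%C + g n t).
exists (maxn N1.+1 N2); split.
- apply: chaos_spanD => //; apply: chaos_spanZ.
  have := chaos_span_series a N1.+1 tp; congr chaos_span; apply/funext => gam.
  by congr (_%:C)%C; apply: eq_bigr => n _; rewrite /charlier_coef mulrC.
- apply: chaos_spanD => //; apply: chaos_spanZ.
  have := chaos_span_series (fun n => q * a n) N1 tp; congr chaos_span; apply/funext => gam.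
  congr (_%:C)%C; rewrite mulr_sumr; apply: eq_bigr => n _.
  by rewrite -mulrA; congr (_ * _); rewrite /charlier_coef mulrC.
- move=> n; apply: graph_spanD => //; apply: graph_spanZ; rewrite ltnS.
  have := graph_spanZ (if (n < N1)%N then a n.+1 else 0)%:C%C
    (graph_span_gen (annihilation_tensor_power sigma_radon phi n tp)).
  congr graph_span; apply/funext => t; rewrite -real_complexM; congr (_%:C)%C.
    by case: ifP; rewrite ?mul0r.
  (* The weight [1 / (n + 1)!] of degree [n + 1] times the factor [n + 1] of annihilation is the
     weight [1 / n!] of degree [n]: exponential vectors are eigenvectors. *)
  have E (x y z w : R) : x != 0 -> y != 0 -> (x * y)^-1 * (x * z * w) = z * y^-1 * w.
    by move=> x0 y0; field; rewrite x0 y0.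
  case: ifP; rewrite ?mul0r// -/q /a factS natrM => _.
  by apply: E; rewrite pnatr_eq0// -lt0n fact_gt0.
- move=> n; rewrite geq_max => /andP[h1 h2]; apply/funext => t.
  by rewrite ltnNge h1/= mulr0 add0r f0.
Qed.

Lemma wick_closure_chaos F G : wick_closure sigma P phi F G -> exists f g,
  [/\ chaos sigma P C f F, annihilation sigma phi f g & chaos sigma P C g G].
Proof.
move=> /wick_closure_truncated[sF sG [Fs [Gs [H cF cG]]]].
have /choice[fs Hfs] := fun k => truncated_wick_span (H k).
have /choice[gs Hgs] := Hfs.
have [f fF cf] := chaos_lim sigma_radon P_poisson C_charlier (f := fs)
  (fun k => let: And3 h _ _ := Hgs k in h) sF cF.
have [g gG cg] := chaos_lim sigma_radon P_poisson C_charlier (f := gs)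
  (fun k => let: And3 _ h _ := Hgs k in h) sG cG.
have [[mf _ _] [mg _ _]] := (fF, gG).
exists f, g; split; [exact: fF| |exact: gG].
split; [exact: mf|exact: mg|exists fs, gs; split; [|exact: cf|exact: cg] => k].
by have [_ _ h] := Hgs k.
Qed.

(** Distance 0 is carried from the common image [F] to its preimages by isometry, through each
    degree by the Lipschitz bound, and back by isometry. *)
Lemma annihilation_unique f g f' g' F G G' : chaos sigma P C f F -> chaos sigma P C f' F ->
  annihilation sigma phi f g -> annihilation sigma phi f' g' ->
  chaos sigma P C g G -> chaos sigma P C g' G' -> sqdist (L2 P) G G' = 0%E.
Proof.
move=> fF fF' a a' gG gG'.
rewrite -(chaos_isometry sigma_radon P_poisson C_charlier gG gG').
have f0 : fock_sqdist sigma f f' = 0%E.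
  by rewrite (chaos_isometry sigma_radon P_poisson C_charlier fF fF') (sqdistxx (L2_quadratic P)).
apply: eseries0 => n _ _; rewrite (_ : sqdist _ _ _ = 0%E) ?mule0//.
apply/eqP; rewrite eq_le (sqdist_ge0 (Exp_n_quadratic sigma n)) andbT.
have := annihilation_n_lipschitz (test_square_integrable sigma_radon phi_test)
  (annihilation_component sigma_radon phi_test n a) (annihilation_component sigma_radon phi_test n a').
move=> /le_trans; apply; rewrite (_ : sqdist _ _ _ = 0%E) ?mule0//.
apply/eqP; rewrite eq_le (sqdist_ge0 (Exp_n_quadratic sigma n.+1)) andbT -f0.
exact: (Exp_n_le_fock sigma n.+1 f f').
Qed.

End TruncatedExponentials.

(** * Sigma-finiteness of Radon measures and conclusion *)

Lemma radon_sigma_finite (R : realType) (d : nat)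
    (sigma : {measure set (Rd R d) -> \bar R}) : radon sigma -> sigma_finite setT sigma.
Proof.
move=> [cf _]; pose B (k : nat) : set (Rd R d) := [set x | forall i j, `|x i j| <= k%:R].
have cB k : compact (B k : set 'rV[R]_d) by exact: compact_box.
exists B => [|k].
  apply/seteqP; split=> // x _; exists (Num.truncn `|x : 'rV[R]_d|).+1 => // i j /=.
  apply: le_trans (ltW (truncnS_gt _)); rewrite (_ : `|x : 'rV[R]_d| = mx_norm x)// mx_normrE.
  exact: (le_bigmax 0 (fun ij => `|x ij.1 ij.2|) (i, j)).
split; last exact: cf.
by apply: closed_measurable_Rd; apply: compact_closed.
Qed.

Lemma nablaP_annihilation (R : realType) (d : nat)
    (sigma : {sigma_finite_measure set (Rd R d) -> \bar R})
    (sigma_radon : radon sigma) (sigma_non_atomic : non_atomic sigma)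
    (P : probability (Gamma R d) R) (P_poisson : is_poisson sigma P)
    (C : forall n, config R d -> (n.-tuple (Rd R d) -> R) -> R)
    (C_charlier : charlier_kernels sigma C)
    (phi : 'rV[R]_d -> R) (phi_test : test_function phi) F G :
  graph_closure (L2 P) (L2 P) (nablaP_graph sigma phi) F G <->
  exists f g : fock_seq, [/\ chaos sigma P C f F, annihilation sigma phi f g & chaos sigma P C g G].
Proof.
rewrite (nablaP_closureE sigma_radon sigma_non_atomic P_poisson phi_test); split.
  exact: wick_closure_chaos.
move=> [f [g [fF a gG]]].
exact: (chaos_wick_closure sigma_radon P_poisson C_charlier phi_test fF gG
  (fun n => annihilation_component sigma_radon phi_test n a)).
Qed.

Theorem proposition2p8 (R : realType) (d : nat)
    (sigma : {measure set (Rd R d) -> \bar R})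
    (sigma_radon : radon sigma) (sigma_non_atomic : non_atomic sigma)
    (P : probability (Gamma R d) R) (P_poisson : is_poisson sigma P)
    (C : forall n, config R d -> (n.-tuple (Rd R d) -> R) -> R)
    (C_charlier : charlier_kernels sigma C)
    (phi : 'rV[R]_d -> R) (phi_test : test_function phi) :
  [/\ forall f : Gamma R d -> R[i], cylinder f ->
        mem_l2 (L2 P) f /\ mem_l2 (L2 P) (nablaP sigma phi f),
      closable (L2 P) (L2 P) (nablaP_graph sigma phi) &
      forall F G : Gamma R d -> R[i],
        graph_closure (L2 P) (L2 P) (nablaP_graph sigma phi) F G <->
        exists f g : fock_seq,
          [/\ chaos sigma P C f F, annihilation sigma phi f g &
              chaos sigma P C g G]].
Proof.
(* Product measures and Fock space are built over a measure carrying a sigma-finite structure; [s]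
   is [sigma] equipped with it, so statements about [s] are convertible to statements about
   [sigma]. *)
have sf := radon_sigma_finite sigma_radon.
pose X := isSFinite.Build _ _ _ _ (sfinite_measure_sigma_finite sf).
pose Y := isSigmaFinite.Build _ _ _ _ sf.
pose s := HB.pack_for {sigma_finite_measure set (Rd R d) -> \bar R} (Measure.sort sigma) X Y.
have E F G : graph_closure (L2 P) (L2 P) (nablaP_graph sigma phi) F G <->
    exists f g : fock_seq,
      [/\ chaos sigma P C f F, annihilation sigma phi f g & chaos sigma P C g G].
  exact: (@nablaP_annihilation R d s sigma_radon sigma_non_atomic P P_poisson C C_charlier phi phi_test).
split=> // [f cf|F G G' /E[f [g [fF a gG]]] /E[f' [g' [fF' a' gG']]]].
  by have [] := cylinder_closure sigma_radon sigma_non_atomic P_poisson phi_test cf.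
exact: (@annihilation_unique R d s sigma_radon P P_poisson C C_charlier phi phi_test
  f g f' g' F G G' fF fF' a a' gG gG').
Qed.
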